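(* Let $\mu$ be a probability measure on $\mathbb{R}^d$, absolutely continuous with respect to Lebesgue measure and with convex support. Let $\varphi:(0,\infty)\to\mathbb{R}$ satisfy A1)–A4) (with constant $\Delta>0$ in A3)), let $A>0$, and suppose that for some $k>0$ and $1<\alpha\le 2$ $$\mathcal{I}_\mu(t)\ \ge\ k\,t\,\varphi\Bigl(\frac1t\Bigr)^{1-\frac1\alpha}\qquad\text{for } t\le \tfrac12 .$$ Then for every $\tau$ with $2\bigl(1-\frac1\alpha\bigr)\le\tau\le 1$ there exists $C_\tau>0$ depending on $\tau,\alpha,k,\lambda_2,\Delta$ such that for every smooth $f$ $$\int_{\mathbb{R}^d} f^2F_\tau\Bigl(\frac{f^2}{\int_{\mathbb{R}^d} f^2\,d\mu}\Bigr)d\mu\ \le\ C_\tau\int_{\mathbb{R}^d} f^2\,c_{A,\frac{\alpha\tau}{\alpha-1}}\Bigl(\frac{|\nabla f|}{|f|}\Bigr)d\mu .$$ In particular, for every smooth $f$, $$\int_{\mathbb{R}^d} f^2F_{2(1-\frac1\alpha)}\Bigl(\frac{f^2}{\int_{\mathbb{R}^d} f^2\,d\mu}\Bigr)d\mu\le C_{2(1-\frac1\alpha)}\int_{\mathbb{R}^d}|\nabla f|^2\,d\mu,$$ $$\int_{\mathbb{R}^d} f^2\varphi\Bigl(\frac{f^2}{\int_{\mathbb{R}^d} f^2\,d\mu}\Bigr)d\mu\le C_1\int_{\mathbb{R}^d} f^2c^*_{A,\alpha}\Bigl(\frac{|\nabla f|}{|f|}\Bigr)d\mu= C_1\int_{\mathbb{R}^d}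 f^2c_{A,\frac{\alpha}{\alpha-1}}\Bigl(\frac{|\nabla f|}{|f|}\Bigr)d\mu .$$ In particular, the result holds (this replacing the hypothesis on $\mathcal{I}_\mu$) if $\mu$ is convex and $g:\mathbb{R}^+\to\mathbb{R}$ is an increasing function such that $\int_{\mathbb{R}^d}e^{g(|x|)}\,d\mu(x)=1$ and for some $C>0$ one has $$\frac{g(r)}{\varphi^{1-\frac1\alpha}(e^{g(r)})}\ge C\,r .$$
   Context: $\mathbb{R}^+=[0,\infty)$. For a Borel set $S\subset\mathbb{R}^d$, $\mu^+(S)=\liminf_{h\to0+}\frac{\mu(S^h)-\mu(S)}{h}$, where $S^h=\{x:\mathrm{dist}(x,S)\le h\}$; the isoperimetric function is $\mathcal{I}_\mu(t)=\inf\{\mu^+(S): S \text{ Borel},\ \mu(S)=t\}$. Assumptions on a function $F:(0,\infty)\to\mathbb{R}$ (here $F=\varphi$): A1) $F$ is concave, increasing and $F(1)=0$; A2) $\lim_{y\to0}yF(y)=0$ and $\lim_{y\to\infty}F(y)=\infty$; A3) $yF(y)$ is convex on $[0,1+\Delta]$ for some $\Delta>0$; A4) there is $y_0\ge1$ such that $yF'(y)$ is non-increasing and $yF'(y)\le1$ on $[y_0,\infty)$. With $x_0$ the number such that $\varphi(x_0)=1$, define $F_\tau(x)=\varphi(x)$ for $0<x\le x_0$ and $F_\tau(x)=\frac1\tau(\varphi^\tau(x)-1)+1$ for $x\ge x_0$. For $A>0$, $q>1$: $c_{A,q}(x)=\frac{x^2}{2}$ if $|x|\le A$ and $c_{A,q}(x)=A^{2-q}\frac{|x|^q}{q}+A^2\frac{q-2}{2q}$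 if $|x|\ge A$. For $c:\mathbb{R}^+\to\mathbb{R}^+$, $c^*(x)=\sup_{y\ge0}(xy-c(y))$. $\lambda_2$ denotes a constant such that $\int(f-m_f)^2d\mu\le\lambda_2\int|\nabla f|^2d\mu$ for all smooth $f$, where $m_f=\inf\{t:\mu(f>t)\le\frac12\}$. A probability measure is called convex if it has the form $e^{-V}dx$ with $V$ a convex function (log-concave measure). Inequalities are understood for $f$ with $0<\int f^2d\mu<\infty$, and $yF(y)$ is taken to be $0$ at $y=0$.
   Formalization: The constant C_τ may also depend on φ and A (uniformity in them is false, e.g. A→∞ with φ=log, μ∝exp(-|x|^{3/2})), but not on μ or d; the growth condition on g is required only where g(r)>0, since the power is undefined where g(r)<0. *)

(* Defs.v *)
From HB Require Import structures.
From mathcomp Require Import all_boot all_order all_algebra.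
From mathcomp Require Import ring lra.
From mathcomp Require Import all_classical all_reals all_analysis.
From mathcomp Require Import measurable_realfun.

Set Implicit Arguments.
Unset Strict Implicit.
Unset Printing Implicit Defensive.

Import Order.TTheory GRing.Theory Num.Theory.
Import numFieldNormedType.Exports.

Local Open Scope classical_set_scope.
Local Open Scope ring_scope.

Section Space.
Variable R : realType.

(* 'rV[R]_d with its Borel sigma-algebra.  The library norm on 'rV[R]_d is the
   sup norm: it is used only through the topology, distances and lengths are
   measured with [enorm]. *)
Definition borelRd (d : nat) := g_sigma_algebraType (@open 'rV[R]_d).

Definition enorm (d : nat) (x : 'rV[R]_d) : R :=
  Num.sqrt (\sum_(i < d) x 0 i ^+ 2).

Definition consRd (d : nat) (p : measurableTypeR R * borelRd d) :
  borelRd d.+1 := row_mx (p.1%:M : 'rV[R]_1) (p.2 : 'rV[R]_d).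

Fixpoint lebesgueRd (d : nat) : set (borelRd d) -> \bar R :=
  match d with
  | 0%N => dirac ((0 : 'rV[R]_0) : borelRd 0)
  | n.+1 => pushforward (lebesgue_measure \x @lebesgueRd n)%E (@consRd n)
  end.

Lemma continuous_measurable_borelRd d (f : 'rV[R]_d -> R) :
  continuous f -> measurable_fun setT (f : borelRd d -> measurableTypeR R).
Proof.
move=> cf; apply: (measurability _ (RGenOpens.measurableE R)).
move=> _ [_ [a [b ->] <-]]; rewrite setTI; apply: sub_sigma_algebra.
by apply: open_comp => //= x _; exact: cf.
Qed.

Lemma measurable_consRd d : measurable_fun setT (@consRd d).
Proof.
apply: (@measurability _ _ _ (borelRd d.+1) _ _ (@open 'rV[R]_d.+1)) => //.
move=> _ [U oU <-]; rewrite setTI.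
pose box (p : rat * 'rV[rat]_d * nat) : set (measurableTypeR R * borelRd d) :=
  ball (ratr p.1.1 : R) p.2.+1%:R^-1 `*`
  [set v : 'rV[R]_d | forall i, ball (ratr (p.1.2 0 i) : R) p.2.+1%:R^-1 (v 0 i)].
pose good := [set p | box p `<=` @consRd d @^-1` U].
have -> : @consRd d @^-1` U = \bigcup_(p in good) box p.
  apply/seteqP; split=> [[x v] /= Uxv|x [p gp] /gp//].
  have /nbhs_ballP[e /= e0 eU] : nbhs (consRd (x, v) : 'rV[R]_d.+1) U.
    by apply: open_nbhs_nbhs; split.
  have [n nE] : exists n : nat, n.+1%:R^-1 < e / 2.
    have := near_infty_natSinv_lt (PosNum (divr_gt0 e0 (ltr0n R 2))).
    by move=> [N _ /(_ N (leqnn N))] /= h; exists N.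
  have apx (y : R) : exists q : rat, ball (ratr q : R) n.+1%:R^-1 y.
    have n0 : 0 < n.+1%:R^-1 :> R by rewrite invr_gt0 ltr0n.
    have /rat_in_itvoo[q] : y - n.+1%:R^-1 < y + n.+1%:R^-1.
      by rewrite ltrBlDr -addrA ltrDl addr_gt0.
    rewrite in_itv /= => /andP[q1 q2]; exists q.
    rewrite /ball /= ltr_norml ltrBlDr ltrBrDl; apply/andP; split => //.
    by rewrite addrC.
  have [q0 q0P] := apx x.
  have /choice[q qP] := fun i => apx (v 0 i).
  exists (q0, \row_i q i, n); last by split => //= i; rewrite mxE; exact: qP.
  have tri (c y z : R) : ball c n.+1%:R^-1 y -> ball c n.+1%:R^-1 z ->
      ball y e z.
    rewrite /ball /= => h1 h2; rewrite (_ : y - z = (c - z) - (c - y)); last by ring.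
    apply: le_lt_trans (ler_normB _ _) _.
    by rewrite [e]splitr; apply: ltrD; [exact: lt_trans h2 nE|exact: lt_trans h1 nE].
  move=> [x' v'] /= [/= h1 h2]; apply: eU; split => // i j.
  rewrite /consRd /= !mxE ord1; case: splitP => k _.
    by rewrite !ord1 !mxE /= !mulr1n; exact: (tri (ratr q0)).
  by apply: (tri (ratr (q k))) => //; have := h2 k; rewrite mxE.
rewrite bigcup_mkcond; apply: countable_bigcupT_measurable => [|p].
  exact: countableP.
case: ifPn => // _; apply: measurableX; first exact: measurable_ball.
rewrite (_ : mkset _ = \bigcap_(i in [set: 'I_d])
    ((fun v : 'rV[R]_d => v 0 i) @^-1`
       (ball (ratr (p.1.2 0 i) : R) p.2.+1%:R^-1))); last first.
  by apply/seteqP; split=> v h i; [move=> _; exact: h|exact: (h i)].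
apply: fin_bigcap_measurable => [|i _]; first exact: finite_finset.
rewrite -[X in measurable X]setTI.
apply: (continuous_measurable_borelRd (f := fun v => v 0 i)) => //.
  exact: coord_continuous.
exact: measurable_ball.
Qed.

Lemma consRd_head d p : (@consRd d p : 'rV[R]_d.+1) 0 0 = p.1.
Proof.
rewrite /consRd mxE; case: splitP => [j _|j //].
by rewrite ord1 mxE /= mulr1n.
Qed.

Lemma consRd_lift d p i :
  (@consRd d p : 'rV[R]_d.+1) 0 (lift ord0 i) = (p.2 : 'rV[R]_d) 0 i.
Proof.
have -> : lift ord0 i = rshift 1 i by exact/val_inj.
exact: (row_mxEr (p.1%:M : 'rV[R]_1) (p.2 : 'rV[R]_d)).
Qed.

Lemma measurable_uncons d :
  measurable_fun setT ((fun v : 'rV[R]_d.+1 => (v 0 0, rsubmx (v : 'rV_(1 + d))))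
    : borelRd d.+1 -> measurableTypeR R * borelRd d).
Proof.
apply/measurable_fun_pair.
  by apply: continuous_measurable_borelRd; exact: coord_continuous.
apply: (@measurability _ _ _ (borelRd d) _ _ (@open 'rV[R]_d)) => //.
move=> _ [U oU <-]; rewrite setTI; apply: sub_sigma_algebra.
apply: open_comp => //= x _ A /nbhs_ballP[e /= e0 eA].
apply/nbhs_ballP; exists e => //= y [_ xy]; apply: eA; split => // i j.
by rewrite !mxE; exact: xy.
Qed.

Section lebesgue_step.
Variables (d : nat) (m : {sigma_finite_measure set (borelRd d) -> \bar R}).

Let step : set (borelRd d.+1) -> \bar R :=
  pushforward (lebesgue_measure \x m)%E (@consRd d).

Let step0 : step set0 = 0%E.
Proof. by rewrite /step /pushforward preimage_set0 measure0. Qed.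

Let step_ge0 A : (0 <= step A)%E.
Proof. by rewrite /step /pushforward; exact: integral_ge0. Qed.

Let step_sigma_additive : semi_sigma_additive step.
Proof.
have /= := @measure_semi_sigma_additive _ _ _
  (pushforward (lebesgue_measure \x m)%E (@consRd d)).
by apply; exact: measurable_consRd.
Qed.

HB.instance Definition _ := isMeasure.Build _ _ _ step
  step0 step_ge0 step_sigma_additive.

Let step_sigma_finite : sigma_finite setT step.
Proof.
have [F FT Foo] : sigma_finite setT (lebesgue_measure \x m)%E.
  have /sigma_finiteP[F [TF ndF Foo]] := sigma_finiteT (@lebesgue_measure R).
  have /sigma_finiteP[G [TG ndG Goo]] := sigma_finiteT m.
  exists (fun n => F n `*` G n) => [|k].
    rewrite -setXTT TF TG predeqE => -[x y]; split.
      move=> [/= [n _ Fnx] [k _ Gky]]; exists (maxn n k) => //; split.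
      - by move: x Fnx; exact/subsetPset/ndF/leq_maxl.
      - by move: y Gky; exact/subsetPset/ndG/leq_maxr.
    by move=> [n _ []/= ? ?]; split; exists n.
  have [? ?] := Foo k; have [? ?] := Goo k; split; first exact: measurableX.
  by rewrite product_measure1E// lte_mul_pinfty// ge0_fin_numE.
pose un (v : borelRd d.+1) : measurableTypeR R * borelRd d :=
  ((v : 'rV[R]_d.+1) 0 0, rsubmx (v : 'rV_(1 + d))).
have unK p : un (consRd p) = p.
  by case: p => x v; rewrite /un consRd_head /consRd row_mxKr.
exists (fun n => un @^-1` F n); first by rewrite -preimage_bigcup -FT preimage_setT.
move=> n; have [mF oo] := Foo n; split.
  by rewrite -[X in measurable X]setTI; exact: measurable_uncons.
rewrite /step /pushforward (_ : _ @^-1` _ = F n)//.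
by apply/seteqP; split=> p /=; rewrite unK.
Qed.

HB.instance Definition _ :=
  Measure_isSigmaFinite.Build _ _ _ step step_sigma_finite.

Lemma lebesgueRd_step :
  exists m' : {sigma_finite_measure set (borelRd d.+1) -> \bar R},
    m' = pushforward (lebesgue_measure \x m)%E (@consRd d)
      :> (set (borelRd d.+1) -> \bar R).
Proof. by exists step. Qed.

End lebesgue_step.

Lemma lebesgueRdP d :
  exists m : {sigma_finite_measure set (borelRd d) -> \bar R},
    m = @lebesgueRd d :> (set (borelRd d) -> \bar R).
Proof.
elim: d => [|d [m mE]] /=.
  by exists (dirac ((0 : 'rV[R]_0) : borelRd 0)).
by rewrite -mE; exact: lebesgueRd_step.
Qed.

Section lebesgue_instance.
Variable d : nat.

Let leb0 : @lebesgueRd d set0 = 0%E.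
Proof. by have [m <-] := lebesgueRdP d; rewrite measure0. Qed.

Let leb_ge0 A : (0 <= @lebesgueRd d A)%E.
Proof. by have [m <-] := lebesgueRdP d. Qed.

Let leb_sigma_additive : semi_sigma_additive (@lebesgueRd d).
Proof. by have [m <-] := lebesgueRdP d; exact: measure_semi_sigma_additive. Qed.

HB.instance Definition _ := isMeasure.Build _ _ _ (@lebesgueRd d)
  leb0 leb_ge0 leb_sigma_additive.

Let leb_sigma_finite : sigma_finite setT (@lebesgueRd d).
Proof. by have [m <-] := lebesgueRdP d; exact: sigma_finiteT. Qed.

HB.instance Definition _ :=
  Measure_isSigmaFinite.Build _ _ _ (@lebesgueRd d) leb_sigma_finite.

End lebesgue_instance.

Lemma lebesgueRdS d A :
  @lebesgueRd d.+1 A = (lebesgue_measure \x @lebesgueRd d)%E (@consRd d @^-1` A).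
Proof. by []. Qed.

Lemma lebesgueRd_box d (a b : 'rV[R]_d) : (forall i, a 0 i <= b 0 i) ->
  @lebesgueRd d [set v : 'rV[R]_d | forall i, v 0 i \in `[a 0 i, b 0 i]] =
  (\prod_(i < d) (b 0 i - a 0 i))%:E.
Proof.
elim: d a b => [|d IH] a b ab.
  by rewrite big_ord0 /= diracE mem_set// => -[].
pose a' : 'rV[R]_d := \row_i a 0 (lift ord0 i).
pose b' : 'rV[R]_d := \row_i b 0 (lift ord0 i).
rewrite lebesgueRdS (_ : _ @^-1` _ = `[a 0 0, b 0 0]%classic `*`
  [set v : 'rV[R]_d | forall i, v 0 i \in `[a' 0 i, b' 0 i]]); last first.
  apply/seteqP; split => [p h|p [hx hv] i].
    split; first by have := h 0; rewrite consRd_head.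
    by move=> i; have := h (lift ord0 i); rewrite consRd_lift !mxE.
  case: (unliftP ord0 i) => [j ->|->].
    by rewrite consRd_lift; have := hv j; rewrite !mxE.
  by rewrite consRd_head.
rewrite product_measure1E//; last first.
  rewrite (_ : mkset _ = \bigcap_(i in [set: 'I_d])
    ((fun v : 'rV[R]_d => v 0 i) @^-1` `[a' 0 i, b' 0 i]%classic)); last first.
    by apply/seteqP; split=> v h i; [move=> _; exact: h|exact: (h i)].
  apply: fin_bigcap_measurable => [|i _]; first exact: finite_finset.
  rewrite -[X in measurable X]setTI.
  apply: (continuous_measurable_borelRd (f := fun v => v 0 i)) => //.
  exact: coord_continuous.
rewrite big_ord_recl EFinM; congr (_ * _)%E.
  have /= := lebesgue_measure_itv `[a 0 0, b 0 0].
  rewrite lte_fin => ->.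
  by case: ltgtP (ab 0) => // ->; rewrite subrr.
apply: etrans (IH a' b' _) _; first by move=> i; rewrite !mxE.
by congr EFin; apply: eq_bigr => i _; rewrite !mxE.
Qed.

End Space.

Section Calculus.
Variables (R : realType) (d : nat).
Implicit Types (f : 'rV[R]_d -> R) (S : set 'rV[R]_d).

Definition partial (i : 'I_d) f : 'rV[R]_d -> R :=
  fun x => 'D_(delta_mx 0 i : 'rV[R]_d) f x.

Definition grad f (x : 'rV[R]_d) : 'rV[R]_d := \row_i partial i f x.

Definition iter_partial (s : seq 'I_d) f : 'rV[R]_d -> R :=
  foldr partial f s.

(* C^oo: all iterated partial derivatives exist and are continuous. *)
Definition smooth f := forall s : seq 'I_d,
  continuous (iter_partial s f) /\
  forall i x, derivable (iter_partial s f) x (delta_mx 0 i : 'rV[R]_d).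

(* dist(x, S), equal to +oo when S is empty *)
Definition dist_set (x : 'rV[R]_d) S : \bar R :=
  ereal_inf [set (enorm (x - y))%:E | y in S].

Definition enlargement S (h : R) : set 'rV[R]_d :=
  [set x | (dist_set x S <= h%:E)%E].

End Calculus.

Section Measures.
Variables (R : realType) (d : nat) (mu : probability (borelRd R d) R).
Implicit Types (f : 'rV[R]_d -> R).
Local Open Scope ereal_scope.

Definition boundary_measure (S : set 'rV[R]_d) : \bar R :=
  limf_einf (fun h : R => (h^-1)%:E * (mu (enlargement S h) - mu S)) 0^'+.

Definition isoperimetric_function (t : R) : \bar R :=
  ereal_inf [set boundary_measure S |
    S in [set S : set (borelRd R d) | measurable S /\ mu S = t%:E]].

Definition measure_support : set 'rV[R]_d :=
  [set x | forall U : set 'rV[R]_d, open_nbhs x U -> 0 < mu U].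

(* V may take the value +oo, so that the density e^{-V} may vanish. *)
Definition log_concave := exists V : 'rV[R]_d -> \bar R,
  [/\ forall x, V x != -oo,
      forall (x y : 'rV[R]_d) (t : R), (0 <= t <= 1)%R ->
        V (t *: x + (1 - t) *: y)%R <= t%:E * V x + (1 - t)%:E * V y,
      measurable_fun setT (V : borelRd R d -> \bar R) &
      forall S : set (borelRd R d), measurable S ->
        mu S = \int[@lebesgueRd R d]_(x in S) expeR (- V x)].

Definition median f : R :=
  inf [set t : R | mu [set x | (t < f x)%R] <= (2^-1)%:E].

(* [lambda2] is an admissible value of the constant \lambda_2 of [mu]. *)
Definition median_poincare (lambda2 : R) := forall f, smooth f ->
  \int[mu]_x ((f x - median f) ^+ 2)%:E <=
  lambda2%:E * \int[mu]_x (enorm (grad f x) ^+ 2)%:E.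

Definition sq_integral f : \bar R := \int[mu]_x (f x ^+ 2)%:E.

Definition F_functional (F : R -> R) f : \bar R :=
  \int[mu]_x (f x ^+ 2 * F (f x ^+ 2 / fine (sq_integral f)))%:E.

(* At a zero of f the integrand below is 0 by the conventions 0^-1 = 0 and
   0 * +oo = 0; the integrands used are only affected on {f = 0, grad f <> 0},
   which is Lebesgue-negligible for f smooth. *)
Definition cost_energy (c : R -> \bar R) f : \bar R :=
  \int[mu]_x ((f x ^+ 2)%:E * c (enorm (grad f x) / `|f x|)%R).

End Measures.

Section Costs.
Variable R : realType.
Implicit Types (F phi : R -> R).

Definition condA1 F :=
  [/\ @convex_function R R^o `]0, +oo[%classic (fun y => - F y),
      {in `]0, +oo[ &, {homo F : x y / x < y}} & F 1 = 0].

Definition condA2 F :=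
  y * F y @[y --> 0^'+] --> 0 /\ F y @[y --> +oo] --> +oo.

(* At y = 0 the function y F(y) takes the value 0 * F 0 = 0. *)
Definition condA3 (Delta : R) F :=
  @convex_function R R^o `[0, 1 + Delta]%classic (fun y => y * F y).

Definition condA4 F := exists2 y0 : R, 1 <= y0 &
  [/\ forall y, y0 <= y -> derivable F y 1,
      forall y z, y0 <= y -> y <= z -> z * derive1 F z <= y * derive1 F y &
      forall y, y0 <= y -> y * derive1 F y <= 1].

Definition F_tau phi (x0 tau x : R) : R :=
  if x <= x0 then phi x else tau^-1 * (phi x `^ tau - 1) + 1.

Definition cost (A q x : R) : R :=
  if `|x| <= A then x ^+ 2 / 2
  else A `^ (2 - q) * (`|x| `^ q / q) + A ^+ 2 * ((q - 2) / (2 * q)).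

Definition conjugate (c : R -> R) (x : R) : \bar R :=
  ereal_sup [set (x * y - c y)%:E | y in [set y : R | 0 <= y]].

End Costs.

Section Conclusion.
Variables (R : realType) (d : nat) (mu : probability (borelRd R d) R).
Variables (phi : R -> R) (x0 A alpha : R).
Local Open Scope ereal_scope.

Definition test_function (f : 'rV[R]_d -> R) :=
  [/\ smooth f, 0 < sq_integral mu f & sq_integral mu f < +oo].

Definition modified_sobolev (C : R -> R) :=
  [/\ forall tau, (2 * (1 - alpha^-1) <= tau <= 1)%R ->
        (0 < C tau)%R /\
        forall f, test_function f ->
          F_functional mu (F_tau phi x0 tau) f <=
          (C tau)%:E *
            cost_energy mu (EFin \o cost A (alpha * tau / (alpha - 1))) f,
      forall f, test_function f ->
        F_functional mu (F_tau phi x0 (2 * (1 - alpha^-1))) f <=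
        (C (2 * (1 - alpha^-1)))%:E * \int[mu]_x (enorm (grad f x) ^+ 2)%:E &
      forall f, test_function f ->
        F_functional mu phi f <=
          (C 1)%:E * cost_energy mu (conjugate (cost A alpha)) f /\
        (C 1)%:E * cost_energy mu (conjugate (cost A alpha)) f =
          (C 1)%:E * cost_energy mu (EFin \o cost A (alpha / (alpha - 1))) f].

End Conclusion.

(* Main.v *)
(** Everything is reduced to one capacity-type inequality on the layers
    {a <= v < b} of a function v (layer_rate): if mu {v > a} <= 1/s and
    mu {v >= b} is not much smaller than mu {v > a}, then
      w(s) (b - a) mu {v >= b} <= int_{a <= v < b} |grad v|,
    with w(s) = kappa phi(s)^(1 - 1/alpha).

    Under the isoperimetric hypothesis this is the coarea inequality, obtained
    from the definition of mu^+ by Fatou's lemma, the difference quotients of v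
    being replaced by oscillations over small balls.  Under log-concavity, the
    Prekopa-Leindler inequality applied to {v > t} and to a ball of radius r
    bounds mu^+ {v > t} below by mu {v > t} ln(1 / mu {v > t}) / r, up to a
    constant; the exponential moment gives a radius r of order
    ln s / phi(s)^(1 - 1/alpha), because phi o exp is concave near infinity.

    Given layer_rate, let v = |f| / ||f||_2, t_j = 2^(j+1) and
    W_j = t_j^2 phi(t_j^2)^tau.  Each layer either has
    mu {v >= t_(j+1)} <= mu {v >= t_j} / 40, or the layer inequality and Young's
    inequality apply; both give
      W_(j+1) mu {v >= t_(j+1)} <= W_j mu {v >= t_j} / 2 + int_layer v^2 c(|grad v| / v),
    which sums to a bound for the part v >= 2 of the left-hand side.  The rest
    is at most a multiple of v^2 - 1, which has mean zero, plus a multiple of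
    (v - 1)^2, which a Poincare inequality controls, itself obtained
    from the dyadic argument with W_j = t_j^2. *)

Require Import Defs.
From mathcomp Require Import all_boot all_order all_algebra.
From mathcomp Require Import ring lra.
From mathcomp Require Import all_classical all_reals all_analysis.
From mathcomp Require Import measurable_realfun.

Set Implicit Arguments.
Unset Strict Implicit.
Unset Printing Implicit Defensive.

Import Order.TTheory GRing.Theory Num.Theory.
Import numFieldNormedType.Exports.

Local Open Scope classical_set_scope.
Local Open Scope ring_scope.

(** * Integration and level sets *)

(** The log-concave case dictates the comparable-mass clause of [layer_rate]. Mixing a set of mass p
    with a ball gains p ln(1/p) and loses ln(1/mu(ball)), about the mass outside the ball. One
    radius must serve all levels of a layer: it is chosen from the mass at the bottom, but the loss
    has to be small against the mass at the top. A bounded ratio of the two reconciles these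
    demands. With beta = 1 - 1/alpha, the range tau >= 2 beta says that the cost exponent q = tau /
    beta is at least 2. The cost then dominates both y^2, for the Poincare part, and y^q, which
    Young's inequality produces from the rate phi^beta and the weight phi^tau. The energy does not
    see the zeros of f, so every gradient integral must be confined to {v > 0}, even for the part of
    v below its median; this is the second use of truncation in the Cheeger inequality. The
    integrand on the left changes sign; it is dominated by a nonnegative measurable function minus a
    constant. *)

Lemma eq_indic (R : realType) (T T' : Type) (A : set T) (B : set T') x y :
  (A x <-> B y) -> \1_A x = \1_B y :> R.
Proof.
move=> h; rewrite !indicE; congr (_%:R); congr nat_of_bool.
by case/boolP: (x \in A) => [/set_mem/h/mem_set->//|/negP hA]; apply/esym/negbTE/negP => /set_mem/h/mem_set.
Qed.

Section Integration.
Local Open Scope ereal_scope.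
Context d (T : measurableType d) (R : realType).

(** No measurability is required: the integral of a nonnegative function is the supremum over the
    simple functions below it, and the signed case follows from positive and negative parts.
    Integrands built from [phi] can thus be compared without showing them measurable. *)
Lemma integral_monotone (m : {measure set T -> \bar R}) (D : set T)
    (f g : T -> \bar R) : (forall x, D x -> f x <= g x) ->
  \int[m]_(x in D) f x <= \int[m]_(x in D) g x.
Proof.
move=> fg; rewrite (integralE _ _ f) (integralE _ _ g).
suff H (f1 g1 : T -> \bar R) : (forall x, D x -> 0 <= f1 x) ->
    (forall x, D x -> f1 x <= g1 x) ->
    \int[m]_(x in D) f1 x <= \int[m]_(x in D) g1 x.
  apply: leeB; apply: H => x Dx //; rewrite ?funeposE ?funenegE.
    by rewrite ge_max !le_max lexx fg// orbT.
  by rewrite ge_max !le_max lexx leeN2 fg// orbT.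
move=> f0 fg1.
have g0 x : D x -> 0 <= g1 x by move=> Dx; exact: le_trans (f0 _ Dx) (fg1 _ Dx).
rewrite !ge0_integralE//; apply: le_ereal_sup => _ [h hf <-]; exists h => // x.
apply: le_trans (hf x) _; rewrite !patchE; case: ifPn => // /set_mem; exact: fg1.
Qed.

Lemma measurable_between (a b : T -> R) :
  measurable_fun setT a -> measurable_fun setT b ->
  measurable [set p : T * measurableTypeR R | (a p.1 <= p.2 < b p.1)%R].
Proof.
move=> ma mb.
have m1 : measurable_fun setT (fun p : T * measurableTypeR R => (a p.1 <= p.2)%R).
  apply: measurable_fun_ler; last exact: measurable_snd.
  by apply: measurableT_comp ma _; exact: measurable_fst.
have m2 : measurable_fun setT (fun p : T * measurableTypeR R => (p.2 < b p.1)%R).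
  apply: measurable_fun_ltr; first exact: measurable_snd.
  by apply: measurableT_comp mb _; exact: measurable_fst.
rewrite (_ : mkset _ = [set p | (a p.1 <= p.2)%R] `&` [set p | (p.2 < b p.1)%R]).
  by apply: measurableI; rewrite -[X in measurable X]setTI; [exact: m1|exact: m2].
by apply/seteqP; split=> p /andP.
Qed.

Lemma measurable_layer (m : {sigma_finite_measure set T -> \bar R}) (a b : T -> R) :
  measurable_fun setT a -> measurable_fun setT b ->
  measurable_fun setT
    (fun t : measurableTypeR R => m [set x | (a x <= t < b x)%R]).
Proof.
move=> ma mb; have := measurable_fun_ysection m (measurable_between ma mb).
congr measurable_fun; apply/funext => t /=; congr (m _).
by apply/seteqP; split=> x; rewrite /ysection/= inE.
Qed.

(* [b - a] is the Lebesgue measure of the section [{t | a <= t < b}]; Tonelli. *)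
Lemma layer_cake (m : {sigma_finite_measure set T -> \bar R}) (a b : T -> R) :
  measurable_fun setT a -> measurable_fun setT b ->
  (forall x, a x <= b x)%R ->
  \int[m]_x (b x - a x)%:E =
  \int[@lebesgue_measure R]_t m [set x | (a x <= t < b x)%R].
Proof.
move=> ma mb ab.
pose A : set (T * measurableTypeR R) := [set p | (a p.1 <= p.2 < b p.1)%R].
have mA : measurable A by exact: measurable_between ma mb.
have mf : measurable_fun setT (fun p : T * measurableTypeR R => (\1_A p)%:E : \bar R).
  by apply/measurable_EFinP; exact: measurable_indic.
transitivity (\int[m]_x \int[@lebesgue_measure R]_t (\1_A (x, t))%:E).
  apply: eq_integral => x _.
  rewrite (_ : (fun t => _) = (fun t => (\1_(`[a x, b x[%classic) t)%:E)); last first.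
    by apply/funext => t; congr EFin; apply: eq_indic; rewrite /A/= in_itv.
  rewrite integral_indic//= setIT lebesgue_measure_itv/= lte_fin.
  case: ltP => // h; congr EFin; apply/eqP; rewrite subr_eq0 eq_le h; exact: ab.
rewrite (fubini_tonelli (m1 := m) (m2 := lebesgue_measure) (fun p => (\1_A p)%:E))//.
apply: eq_integral => t _.
rewrite (_ : (fun x => _) = (fun x => (\1_[set x | (a x <= t < b x)%R] x)%:E)); last first.
  by apply/funext => x; congr EFin; apply: eq_indic.
rewrite integral_indic//= ?setIT//.
have m1 : measurable_fun setT (fun p => (a p <= t)%R).
  by apply: measurable_fun_ler => //; exact: measurable_cst.
have m2 : measurable_fun setT (fun p => (t < b p)%R).
  by apply: measurable_fun_ltr => //; exact: measurable_cst.
rewrite (_ : mkset _ = [set p | (a p <= t)%R] `&` [set p | (t < b p)%R]).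
  by apply: measurableI; rewrite -[X in measurable X]setTI; [exact: m1|exact: m2].
by apply/seteqP; split=> p /andP.
Qed.

Import HBNNSimple.

Lemma lt_integral_nnsfun (m : {measure set T -> \bar R}) (f : T -> \bar R) (y : \bar R) :
  (forall x, 0 <= f x) -> y < \int[m]_x f x ->
  exists2 h : {nnsfun T >-> R},
    forall x, (h x)%:E <= f x & y < \int[m]_x (h x)%:E.
Proof.
move=> f0; rewrite ge0_integralTE// => /ereal_sup_gt[_ [h hf <-] yh].
by exists h => //; rewrite integralT_nnsfun.
Qed.

End Integration.

Lemma pushforward_is_measure d1 d2 (T1 : measurableType d1) (T2 : measurableType d2)
    (R : realType) (m : {measure set T1 -> \bar R}) (f : T1 -> T2) :
  measurable_fun setT f ->
  exists m' : {measure set T2 -> \bar R},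
    m' = pushforward m f :> (set T2 -> \bar R).
Proof.
by move=> mf; exists (measure_function_pushforward__canonical__measure_function_Measure m mf).
Qed.

Section LevelSets.
Context d (T : measurableType d) (R : realType) (f : T -> R).
Hypothesis mf : measurable_fun setT f.

Let level_set (p : T -> bool) : measurable_fun setT p -> measurable [set x | p x].
Proof. by move=> /(_ measurableT [set true]); rewrite setTI; exact. Qed.

Lemma measurable_gt_set (t : R) : measurable [set x | t < f x].
Proof. by apply: level_set; exact: measurable_fun_ltr. Qed.

Lemma measurable_ge_set (t : R) : measurable [set x | t <= f x].
Proof. by apply: level_set; exact: measurable_fun_ler. Qed.

Lemma measurable_lt_set (t : R) : measurable [set x | f x < t].
Proof. by apply: level_set; exact: measurable_fun_ltr. Qed.

Lemma measurable_le_set (t : R) : measurable [set x | f x <= t].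
Proof. by apply: level_set; exact: measurable_fun_ler. Qed.

End LevelSets.

(** * The Prekopa-Leindler inequality *)

Section BrunnMinkowskiLine.
Context {R : realType}.
Local Notation leb := (@lebesgue_measure R).

(** Scaled by [c^-1], the image of Lebesgue measure under the affine map agrees with Lebesgue
    measure on half-open intervals, hence everywhere by uniqueness. *)
Lemma lebesgue_measure_affine (c e : R) (A : set (measurableTypeR R)) :
  0 < c -> measurable A ->
  leb ((fun x => c^-1 * (x - e)) @^-1` A) = (c%:E * leb A)%E.
Proof.
move=> c0 mA; have ci0 : 0 <= c^-1 by rewrite invr_ge0 ltW.
have mf : measurable_fun setT ((fun x => c^-1 * (x - e)) : measurableTypeR R -> measurableTypeR R).
  by apply: measurable_funM => //; exact: measurable_funB.
have [p pE] := pushforward_is_measure leb mf.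
pose m := mscale (NngNum ci0) p.
have H : forall X, ocitv X -> leb X = m X.
  move=> _ [[a b] _ <-]; rewrite /m /= /mscale/= pE /pushforward.
  rewrite (_ : _ @^-1` _ = `]c * a + e, c * b + e]%classic); last first.
    apply/seteqP; split => x /=; rewrite !in_itv/= ltr_pdivlMl// ler_pdivrMl//;
      by rewrite ltrBrDr lerBlDr.
  have := lebesgue_measure_itv `]c * a + e, c * b + e].
  rewrite /= !lte_fin ltrD2r ltr_pM2l// => h.
  rewrite lebesgue_measure_itv/= lte_fin; apply: etrans (congr1 (fun z => (c^-1)%:E * z)%E (esym h)).
  case: ifP => _; last by rewrite mule0.
  rewrite -!EFinD -EFinM; congr EFin; by field; exact: lt0r_neq0.
have := lebesgue_measure_unique H mA; rewrite /m /= /mscale/= pE => ->.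
by rewrite muleA -EFinM divff ?gt_eqF// mul1e.
Qed.

(** Lets the supremum over compact subsets in inner regularity pass through an inequality. Unless
    [z] is +oo, it forces [u] to be finite, so that [u] can be subtracted. *)
Lemma adde_ereal_sup_le (u z : \bar R) (c : R) (S : set (\bar R)) :
  (0 <= u)%E -> 0 < c -> S !=set0 -> (forall t, S t -> 0 <= t)%E ->
  (forall t, S t -> u + c%:E * t <= z)%E -> (u + c%:E * ereal_sup S <= z)%E.
Proof.
move=> u0 c0 [t0 St0] S0 H.
have [->|zoo] := eqVneq z +oo%E; first by rewrite leey.
have uz : (u <= z)%E.
  apply: le_trans (H _ St0); apply: leeDl; apply: mule_ge0; last exact: S0.
  by rewrite lee_fin ltW.
have uf : u \is a fin_num.
  by rewrite ge0_fin_numE// (le_lt_trans uz)// ltey.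
rewrite addeC -leeBrDr// -lee_pdivlMl//; apply: ge_ereal_sup => t St.
by rewrite lee_pdivlMl// leeBrDr// addeC; exact: H.
Qed.

(* [Z] contains translates of [(1 - l) A] and [l B] that meet in one point: pair each point of [A] with [min B] and each point of [B] with [max A]. *)
Lemma brunn_minkowski_compact (l : R) (A B Z : set R) : 0 < l -> l < 1 ->
  compact A -> compact B -> A !=set0 -> B !=set0 -> measurable (Z : set (measurableTypeR R)) ->
  (forall a b, A a -> B b -> Z ((1 - l) * a + l * b)) ->
  ((1 - l)%:E * leb A + l%:E * leb B <= leb Z)%E.
Proof.
move=> l0 l1 cA cB A0 B0 mZ H.
have l1' : 0 < 1 - l by rewrite subr_gt0.
have [a [Aa amax]] : exists a, A a /\ forall x, A x -> x <= a.
  have [a] := @compact_EVT_max _ R id A A0 cA (continuous_subspaceT (fun x => @cvg_id _ _)).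
  by rewrite inE => Aa h; exists a; split=> // x Ax; apply: h; rewrite inE.
have [b [Bb bmin]] : exists b, B b /\ forall x, B x -> b <= x.
  have [b] := @compact_EVT_min _ R id B B0 cB (continuous_subspaceT (fun x => @cvg_id _ _)).
  by rewrite inE => Bb h; exists b; split=> // x Bx; apply: h; rewrite inE.
pose U := (fun x => (1 - l)^-1 * (x - l * b)) @^-1` A : set (measurableTypeR R).
pose V := (fun x => l^-1 * (x - (1 - l) * a)) @^-1` B : set (measurableTypeR R).
have mA : measurable (A : set (measurableTypeR R)) by exact: compact_measurable.
have mB : measurable (B : set (measurableTypeR R)) by exact: compact_measurable.
rewrite -(lebesgue_measure_affine (l * b) l1' mA).
rewrite -(lebesgue_measure_affine ((1 - l) * a) l0 mB) -/U -/V.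
have mf c e (X : set (measurableTypeR R)) : measurable X ->
    measurable ((fun x => c^-1 * (x - e)) @^-1` X : set (measurableTypeR R)).
  move=> mX; rewrite -[X in measurable X]setTI.
  suff : measurable_fun setT (fun x : measurableTypeR R => c^-1 * (x - e) : measurableTypeR R) by apply.
  by apply: measurable_funM => //; exact: measurable_funB.
have mU : measurable U by exact: mf.
have mV : measurable V by exact: mf.
pose c0 : measurableTypeR R := (1 - l) * a + l * b.
have UZ : U `<=` Z.
  move=> x /H /(_ Bb); rewrite mulrA divff ?gt_eqF// mul1r.
  by rewrite subrK.
have VZ : V `<=` Z.
  move=> x /(H _ _ Aa); rewrite mulrA divff ?gt_eqF// mul1r addrC.
  by rewrite subrK.
have Uc x : U x -> x <= c0.
  move=> /amax; rewrite ler_pdivrMl// lerBlDr; exact.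
have Vc x : V x -> c0 <= x.
  move=> /bmin; rewrite ler_pdivlMl// lerBrDr addrC; exact.
have mUc : measurable (U `\ c0).
  by apply: measurableD => //; exact: measurable_set1.
have -> : leb U = leb (U `\ c0).
  apply/eqP; rewrite eq_le; apply/andP; split; last first.
    apply: le_measure; rewrite ?inE//; exact: subDsetl.
  rewrite (@measureDI _ _ _ leb U [set c0] mU (measurable_set1 _)).
  rewrite -[leRHS]adde0; apply: leeD => //.
  rewrite -(lebesgue_measure_set1 c0); apply: le_measure; rewrite ?inE//.
  exact: (@measurableI _ _ U [set c0] mU (measurable_set1 _)).
have dj : (U `\ c0) `&` V = set0.
  apply/seteqP; split=> x //= [[/Uc xc nx] /Vc cx].
  by apply: nx; apply/eqP; rewrite eq_le xc cx.
rewrite -(@measureU _ _ _ leb _ _ mUc mV dj).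
apply: le_measure; rewrite ?inE//; first exact: measurableU.
by move=> x [[/UZ]|/VZ].
Qed.

Lemma brunn_minkowski_line (l : R) (A B Z : set (measurableTypeR R)) : 0 < l -> l < 1 ->
  measurable A -> measurable B -> A !=set0 -> B !=set0 -> measurable Z ->
  (forall a b, A a -> B b -> Z ((1 - l) * a + l * b)) ->
  ((1 - l)%:E * leb A + l%:E * leb B <= leb Z)%E.
Proof.
move=> l0 l1 mA mB [a Aa] [b Bb] mZ H.
have l1' : 0 < 1 - l by rewrite subr_gt0.
have ne (X : set R) : [set leb K | K in [set K | compact K /\ K `<=` X]] !=set0.
  by exists (leb set0), set0 => //; split=> //; exact: compact0.
have ge0 (X : set R) t : [set leb K | K in [set K | compact K /\ K `<=` X]] t -> (0 <= t)%E.
  by move=> [K _ <-].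
rewrite (lebesgue_regularity_inner_sup mB).
apply: adde_ereal_sup_le => //.
  by rewrite mule_ge0// lee_fin ltW.
  exact: ge0.
move=> _ [KB [cKB KBB] <-]; rewrite addeC.
rewrite (lebesgue_regularity_inner_sup mA).
apply: adde_ereal_sup_le => //.
  by rewrite mule_ge0// lee_fin ltW.
  exact: ge0.
move=> _ [KA [cKA KAA] <-]; rewrite addeC.
(* The inner approximations may be empty; adjoining the points [a] and [b] gives nonempty compact
   sets without decreasing the measure. *)
have cU (X : set R) x : compact X -> compact (X `|` [set x]).
  by move=> cX; apply: compactU => //; exact: compact_set1.
have mono (X : set R) x : compact X -> (leb X <= leb (X `|` [set x]))%E.
  move=> cX; apply: le_measure; rewrite ?inE; last by move=> y; left.
    exact: compact_measurable.
  by apply: compact_measurable; exact: cU.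
apply: le_trans (@brunn_minkowski_compact l (KA `|` [set a]) (KB `|` [set b]) Z l0 l1 _ _ _ _ mZ _).
- by apply: leeD; apply: lee_wpmul2l; [rewrite lee_fin ltW|exact: mono|rewrite lee_fin ltW|exact: mono].
- exact: cU.
- exact: cU.
- by exists a; right.
- by exists b; right.
- by move=> x y [/KAA Ax|->] [/KBB By|->]; apply: H.
Qed.

End BrunnMinkowskiLine.

Section PrekopaLeindlerLine.
Context {R : realType}.
Local Notation leb := (@lebesgue_measure R).

Lemma weighted_AMGM (l x y : R) : 0 < l -> l < 1 -> 0 <= x -> 0 <= y ->
  x `^ (1 - l) * y `^ l <= (1 - l) * x + l * y.
Proof.
move=> l0 l1 x0 y0; have l1' : 0 < 1 - l by rewrite subr_gt0.
have := @conjugate_powR R (x `^ (1 - l)) (y `^ l) (1 - l)^-1 l^-1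
  (powR_ge0 _ _) (powR_ge0 _ _).
rewrite !invr_gt0 !invrK subrK -!powRrM !mulfV ?gt_eqF// !powRr1//.
by move=> /(_ l1' l0 erefl); rewrite (mulrC x) (mulrC y).
Qed.

Import HBNNSimple.

(* Stated with strict lower bounds [s], [t] on the values, so that it makes sense for [f], [g], [h] with values in the extended reals and passes to iterated integrals. *)
Lemma prekopa_leindler_line (l : R) (f g h : measurableTypeR R -> \bar R) :
  0 < l -> l < 1 ->
  (forall x, 0 <= f x)%E -> (forall x, 0 <= g x)%E -> (forall x, 0 <= h x)%E ->
  measurable_fun setT h ->
  (forall x y s t, 0 < s -> 0 < t -> (s%:E < f x)%E -> (t%:E < g y)%E ->
    ((s `^ (1 - l) * t `^ l)%:E <= h ((1 - l) * x + l * y)%R)%E) ->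
  forall s t, 0 < s -> 0 < t ->
    (s%:E < \int[leb]_x f x)%E -> (t%:E < \int[leb]_x g x)%E ->
    ((s `^ (1 - l) * t `^ l)%:E <= \int[leb]_x h x)%E.
Proof.
move=> l0 l1 f0 g0 h0 mh H s t s0 t0.
have l1' : 0 < 1 - l by rewrite subr_gt0.
have bnd (f1 : {nnsfun measurableTypeR R >-> R}) :
    exists a, 0 <= a /\ (forall x, f1 x <= a) /\
      forall u, 0 <= u -> u < a -> exists x, u < f1 x.
  have fne : range f1 !=set0 by exists (f1 0), 0.
  have /bounded_fun_has_ubound fub := simple_bounded f1.
  exists (sup (range f1)); split; last split.
  - have := fun_ge0 (s := f1) 0; move=> /le_trans; apply; apply: ub_le_sup => //; by exists 0.
  - by move=> x; apply: ub_le_sup => //; exists x.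
  - move=> u _ /sup_gt[//|_ [x _ <-] ux]; by exists x.
move=> /(lt_integral_nnsfun f0)[f1 f1f sf] /(lt_integral_nnsfun g0)[g1 g1g tg].
have [a [a0 [f1a fa]]] := bnd f1; have [b [b0 [g1b gb]]] := bnd g1.
have pos (f2 : {nnsfun measurableTypeR R >-> R}) (c r : R) : 0 < r -> 0 <= c ->
    (forall x, f2 x <= c) -> (r%:E < \int[leb]_x (f2 x)%:E)%E -> 0 < c.
  move=> r0; rewrite le_eqVlt => /predU1P[<-|//] f2c.
  rewrite integral0_eq ?lte_fin; first by rewrite ltNge (ltW r0).
  move=> x _; congr EFin; apply/eqP; rewrite eq_le f2c; exact: fun_ge0.
have {}a0 : 0 < a by exact: pos s0 a0 f1a sf.
have {}b0 : 0 < b by exact: pos t0 b0 g1b tg.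
pose c := a `^ (1 - l) * b `^ l.
have c0 : 0 < c by rewrite mulr_gt0 ?powR_gt0.
(* After normalisation both simple functions have supremum 1: below height 1 both superlevel sets
   are nonempty, as Brunn-Minkowski requires, and from height 1 on both are empty. Cutting [h] at
   [c] makes [K] real-valued and keeps it at most 1. *)
pose F x := f1 x / a; pose G x := g1 x / b.
pose K x := fine (mine (h x) c%:E) / c.
have mF : measurable_fun setT F by exact: measurable_funM.
have mG : measurable_fun setT G by exact: measurable_funM.
have mK : measurable_fun setT K.
  apply: measurable_funM => //; apply: measurableT_comp => //.
  exact: measurable_mine.
have F0 x : 0 <= F x by rewrite divr_ge0 ?fun_ge0// ltW.
have G0 x : 0 <= G x by rewrite divr_ge0 ?fun_ge0// ltW.
have mfin x : mine (h x) c%:E \is a fin_num.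
  by rewrite ge0_fin_numE ?gt_min ?ltry ?orbT// le_min h0 lee_fin ltW.
have K0 x : 0 <= K x.
  by rewrite divr_ge0 ?(ltW c0)// fine_ge0// le_min h0 lee_fin ltW.
have main r : ((1 - l)%:E * leb [set x | (0 <= r < F x)%R] +
    l%:E * leb [set x | (0 <= r < G x)%R] <= leb [set x | (0 <= r < K x)%R])%E.
  have [r01|r01] := boolP (0 <= r < 1); last first.
    rewrite (_ : [set x | _ <= _ < F _] = set0); last first.
      apply/seteqP; split=> x //= /andP[r0 rF]; move: r01; rewrite r0/= -leNgt => r1.
      by move: rF; rewrite /F ltNge (le_trans _ r1)// ler_pdivrMr// mul1r.
    rewrite (_ : [set x | _ <= _ < G _] = set0); last first.
      apply/seteqP; split=> x //= /andP[r0 rF]; move: r01; rewrite r0/= -leNgt => r1.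
      by move: rF; rewrite /G ltNge (le_trans _ r1)// ler_pdivrMr// mul1r.
    by rewrite !measure0 !mule0 adde0.
  have /andP[r0 r1] := r01.
  have ms (q : measurableTypeR R -> R) : measurable_fun setT q ->
      measurable [set x | (0 <= r < q x)%R].
    move=> mq; rewrite r0/= -[X in measurable X]setTI.
    have : measurable_fun setT (fun x => r < q x) by exact: measurable_fun_ltr.
    by apply.
  have ra : r * a < a by rewrite gtr_pMl.
  have rb : r * b < b by rewrite gtr_pMl.
  have [x0 fx0] := fa _ (mulr_ge0 r0 (ltW a0)) ra.
  have [y0 gy0] := gb _ (mulr_ge0 r0 (ltW b0)) rb.
  apply: brunn_minkowski_line => //.
  - exact: ms.
  - exact: ms.
  - by exists x0; rewrite /= r0 /F ltr_pdivlMr.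
  - by exists y0; rewrite /= r0 /G ltr_pdivlMr.
  - exact: ms.
  move=> x y /= /andP[_ rFx] /andP[_ rGy]; rewrite r0/=.
  have rm : r < Num.min (F x) (G y) by rewrite lt_min rFx.
  (* [H] takes strict bounds and returns a weak one; a height [r'] strictly above [r] restores the
     strict inequality [r < K]. *)
  have [r' rr'] : exists2 r', r < r' & r' < Num.min (F x) (G y).
    by exists ((r + Num.min (F x) (G y)) / 2); lra.
  have r'0 : 0 < r' by exact: le_lt_trans rr'.
  rewrite lt_min => /andP[r'F r'G].
  have r'1 : r' < 1.
    by apply: lt_le_trans r'F _; rewrite /F ler_pdivrMr// mul1r.
  apply: lt_le_trans rr' _; rewrite /K ler_pdivlMr//.
  rewrite -lee_fin fineK//= le_min lee_fin; apply/andP; split; last first.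
    by rewrite ger_pMl// ltW.
  have -> : r' * c = (r' * a) `^ (1 - l) * (r' * b) `^ l.
    rewrite !powRM ?ltW//.
    rewrite [RHS]mulrACA -powRD ?subrK ?powRr1 ?ltW//.
    by rewrite (gt_eqF ltr01).
  apply: H; rewrite ?mulr_gt0//.
    apply: lt_le_trans (f1f x); rewrite lte_fin.
    by move: r'F; rewrite /F ltr_pdivlMr.
  apply: lt_le_trans (g1g y); rewrite lte_fin.
  by move: r'G; rewrite /G ltr_pdivlMr.
have hK : (c%:E * \int[leb]_x (K x)%:E <= \int[leb]_x h x)%E.
  rewrite -ge0_integralZl_EFin//; last 3 first.
  - by move=> x _; rewrite lee_fin.
  - exact/measurable_EFinP.
  - exact: ltW.
  apply: integral_monotone => x _; rewrite -EFinM mulrC /K divfK ?gt_eqF// fineK//.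
  by rewrite ge_min lexx.
have LC (q : measurableTypeR R -> R) : measurable_fun setT q -> (forall x, 0 <= q x) ->
   (\int[leb]_x (q x)%:E = \int[leb]_r leb [set x | (0 <= r < q x)%R])%E.
  move=> mq q0.
  transitivity (\int[leb]_x (q x - cst 0 x)%:E)%E.
    by apply: eq_integral => x _; rewrite /= subr0.
  exact: layer_cake.
have ml (q : measurableTypeR R -> R) : measurable_fun setT q ->
   measurable_fun setT (fun r : measurableTypeR R => leb [set x | (0 <= r < q x)%R]).
  by move=> mq; apply: (@measurable_layer _ _ _ leb (cst 0) q).
have FGK : ((1 - l)%:E * \int[leb]_x (F x)%:E + l%:E * \int[leb]_x (G x)%:E
    <= \int[leb]_x (K x)%:E)%E.
  rewrite !LC// -!ge0_integralZl_EFin ?(ltW l0) ?(ltW l1')//; [|exact: ml..].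
  rewrite -ge0_integralD//; last 4 first.
  - by move=> x _; rewrite mule_ge0// lee_fin ltW.
  - by apply: measurable_funeM; exact: ml.
  - by move=> x _; rewrite mule_ge0// lee_fin ltW.
  - by apply: measurable_funeM; exact: ml.
  apply: (@integral_monotone _ (measurableTypeR R) R leb setT) => r _; exact: main.
have sF : ((s / a)%:E <= \int[leb]_x (F x)%:E)%E.
  rewrite (_ : (fun x => (F x)%:E) = (fun x => (a^-1)%:E * (f1 x)%:E)%E); last first.
    by apply/funext => x; rewrite -EFinM mulrC.
  rewrite ge0_integralZl_EFin ?invr_ge0 ?(ltW a0)//; last 2 first.
  - by move=> x _; rewrite lee_fin fun_ge0.
  - exact/measurable_EFinP.
  by rewrite mulrC EFinM; apply: lee_wpmul2l; rewrite ?lee_fin ?invr_ge0 ltW.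
have tG : ((t / b)%:E <= \int[leb]_x (G x)%:E)%E.
  rewrite (_ : (fun x => (G x)%:E) = (fun x => (b^-1)%:E * (g1 x)%:E)%E); last first.
    by apply/funext => x; rewrite -EFinM mulrC.
  rewrite ge0_integralZl_EFin ?invr_ge0 ?(ltW b0)//; last 2 first.
  - by move=> x _; rewrite lee_fin fun_ge0.
  - exact/measurable_EFinP.
  by rewrite mulrC EFinM; apply: lee_wpmul2l; rewrite ?lee_fin ?invr_ge0 ltW.
apply: le_trans hK.
apply: le_trans (lee_wpmul2l _ FGK); last by rewrite lee_fin ltW.
apply: le_trans (_ : (c * ((1 - l) * (s / a) + l * (t / b)))%:E <= _)%E; last first.
  rewrite EFinM; apply: lee_wpmul2l; first by rewrite lee_fin ltW.
  by rewrite EFinD !EFinM; apply: leeD; apply: lee_wpmul2l => //; rewrite lee_fin ltW.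
rewrite lee_fin.
have sa0 : 0 <= s / a by rewrite divr_ge0 ?ltW.
have tb0 : 0 <= t / b by rewrite divr_ge0 ?ltW.
(* The arithmetic mean of the normalised integrals dominates their geometric mean, in which [a] and
   [b] recombine into [c]. *)
apply: le_trans (ler_wpM2l (ltW c0) (weighted_AMGM l0 l1 sa0 tb0)).
by rewrite /c mulrACA -!powRM ?(ltW a0) ?(ltW b0)// !(mulrC a) !(mulrC b) !divfK ?gt_eqF.
Qed.

End PrekopaLeindlerLine.

Section PrekopaLeindler.
Context {R : realType}.
Local Notation leb := (@lebesgue_measure R).

Lemma integral_lebesgueRdS d (f : borelRd R d.+1 -> \bar R) :
  (forall x, 0 <= f x)%E -> measurable_fun setT f ->
  (\int[@lebesgueRd R d.+1]_x f x =
   \int[leb]_x \int[@lebesgueRd R d]_y f (consRd (x, y)))%E.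
Proof.
move=> f0 mf.
have mc := @measurable_consRd R d.
transitivity (\int[(leb \x @lebesgueRd R d)%E]_p f (consRd p))%E.
  rewrite (eq_measure_integral
    (measure_function_pushforward__canonical__measure_function_Measure (leb \x @lebesgueRd R d)%E mc)) //.
  by rewrite ge0_integral_pushforward.
apply: (@fubini_tonelli1 _ _ _ _ _ leb (@lebesgueRd R d) (fun p => f (consRd p))) => //.
exact: measurableT_comp.
Qed.

(** Induction on the dimension: the induction hypothesis on the fibres is exactly the pointwise
    hypothesis that the one-dimensional inequality asks of the fibre integrals. In dimension 0 the
    measure is the Dirac mass at the only point. *)
Lemma prekopa_leindler d (l : R) (f g h : borelRd R d -> \bar R) :
  0 < l -> l < 1 ->
  (forall x, 0 <= f x)%E -> (forall x, 0 <= g x)%E -> (forall x, 0 <= h x)%E ->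
  measurable_fun setT f -> measurable_fun setT g -> measurable_fun setT h ->
  (forall (x y : 'rV[R]_d) s t, 0 < s -> 0 < t -> (s%:E < f x)%E -> (t%:E < g y)%E ->
    ((s `^ (1 - l) * t `^ l)%:E <= h ((1 - l) *: x + l *: y)%R)%E) ->
  forall s t, 0 < s -> 0 < t ->
    (s%:E < \int[@lebesgueRd R d]_x f x)%E -> (t%:E < \int[@lebesgueRd R d]_x g x)%E ->
    ((s `^ (1 - l) * t `^ l)%:E <= \int[@lebesgueRd R d]_x h x)%E.
Proof.
move=> l0 l1; elim: d f g h => [|d IH] f g h f0 g0 h0 mf mg mh H s t s0 t0.
  rewrite !integral_dirac// !diracT !mul1e => sf tg.
  by apply: le_trans (H _ _ _ _ s0 t0 sf tg) _; rewrite !scaler0 addr0.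
rewrite !integral_lebesgueRdS//.
have mI (q : borelRd R d.+1 -> \bar R) : (forall x, 0 <= q x)%E -> measurable_fun setT q ->
    measurable_fun setT (fun x : measurableTypeR R => \int[@lebesgueRd R d]_y q (consRd (x, y)))%E.
  move=> q0 mq.
  apply: (@measurable_fun_fubini_tonelli_F _ _ _ _ _ (@lebesgueRd R d) (fun p => q (consRd p))) => //.
  by apply: measurableT_comp => //; exact: measurable_consRd.
have mS (q : borelRd R d.+1 -> \bar R) x : measurable_fun setT q ->
    measurable_fun setT (fun y : borelRd R d => q (consRd (x, y))).
  move=> mq; apply: measurableT_comp => //.
  apply: measurableT_comp; first exact: measurable_consRd.
  exact: measurable_pair1.
apply: prekopa_leindler_line => //.
- by move=> x; exact: integral_ge0.
- by move=> x; exact: integral_ge0.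
- by move=> x; exact: integral_ge0.
- exact: mI.
move=> x y s' t' s'0 t'0; apply: IH => //; try exact: mS.
move=> u v s1 t1 s10 t10 fu gv.
have := H _ _ _ _ s10 t10 fu gv; congr (_ <= h _)%E.
apply/rowP => i; rewrite [LHS]mxE [X in X + _ = _]mxE [X in _ + X = _]mxE.
case: (unliftP ord0 i) => [j ->|->]; last by rewrite !consRd_head.
by rewrite !consRd_lift !mxE.
Qed.

End PrekopaLeindler.

Lemma measurable_expeR (R : realType) : measurable_fun setT (@expeR R).
Proof.
rewrite (_ : expeR = fun x => maxe 0%E (er_map expR x)).
  apply: measurable_maxe => //; apply: (@measurable_er_map _ (measurableTypeR R)).
  exact: measurable_expR.
apply/funext => -[r| |]/=.
- by rewrite max_r// lee_fin expR_ge0.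
- by rewrite max_r// leey.
- by rewrite max_l// leNye.
Qed.

Section LogConcave.
Context {R : realType} {d : nat}.

(** Prekopa-Leindler for the density restricted to [X], [Y] and [Z]; convexity of [V] is the
    pointwise hypothesis, and a positive lower bound on the density excludes the value +oo of
    [V]. *)
Lemma log_concave_prekopa_leindler (mu : probability (borelRd R d) R)
    (l : R) (X Y Z : set (borelRd R d)) :
  log_concave mu -> 0 < l -> l < 1 ->
  measurable X -> measurable Y -> measurable Z ->
  (forall x y : 'rV[R]_d, X x -> Y y -> Z ((1 - l) *: x + l *: y)) ->
  fine (mu X) `^ (1 - l) * fine (mu Y) `^ l <= fine (mu Z).
Proof.
move=> [V [VNoo Vconv mV muE]] l0 l1 mX mY mZ XYZ.
have l1' : 0 < 1 - l by rewrite subr_gt0.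
pose e (x : borelRd R d) : \bar R := expeR (- V x).
have me : measurable_fun setT e.
  apply: measurableT_comp; first exact: measurable_expeR.
  exact: measurableT_comp.
have e0 x : (0 <= e x)%E by exact: expeR_ge0.
have muE' S : measurable S -> mu S = (\int[@lebesgueRd R d]_x (e \_ S) x)%E.
  by move=> mS; rewrite -integral_mkcond; exact: muE.
have r0 S x : (0 <= (e \_ S) x)%E by rewrite patchE; case: ifP.
have mr S : measurable S -> measurable_fun setT (e \_ S).
  by move=> mS; apply/(measurable_restrictT _ _).1 => //; exact: measurable_funTS.
have H (s t : R) : 0 < s -> 0 < t -> (s%:E < mu X)%E -> (t%:E < mu Y)%E ->
    ((s `^ (1 - l) * t `^ l)%:E <= mu Z)%E.
  rewrite !muE'//; apply: prekopa_leindler => //; try exact: mr.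
  move=> x y {}s {}t s0 t0; rewrite 2!patchE.
  case: ifPn => [/set_mem Xx|_]; last by rewrite lte_fin ltNge (ltW s0).
  case: ifPn => [/set_mem Yy|_]; last by move=> _; rewrite lte_fin ltNge (ltW t0).
  rewrite patchE mem_set; last exact: XYZ.
  rewrite /e => sx ty.
  have real (w : 'rV[R]_d) r : 0 < r -> (r%:E < expeR (- V w))%E -> exists a, V w = a%:E.
    move=> r00; case: (V w) (VNoo w) => [a _ _|_|//]; first by exists a.
    by rewrite /= lte_fin ltNge (ltW r00).
  have [a ax] := real _ _ s0 sx; have [b bx] := real _ _ t0 ty.
  have l01 : 0 <= 1 - l <= 1 by rewrite (ltW l1') gerBl ltW.
  have := Vconv x y (1 - l) l01; rewrite opprB addrCA subrr addr0 ax bx.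
  move: sx ty; rewrite ax bx /= !lte_fin => sa tb.
  case: (V _) (VNoo ((1 - l) *: x + l *: y)) => [c _|//|//].
  rewrite -!EFinM -EFinD !lee_fin => cab.
  apply: le_trans (_ : expR (- a) `^ (1 - l) * expR (- b) `^ l <= _).
    by apply: ler_pM; rewrite ?powR_ge0//; apply: ge0_ler_powR; rewrite ?nnegrE ?expR_ge0 ?ltW.
  rewrite -!expRM -expRD ler_expR; lra.
set p := fine (mu X); set q := fine (mu Y); set z := fine (mu Z).
have fm S : measurable S -> mu S = (fine (mu S))%:E.
  by move=> mS; rewrite fineK// fin_num_measure.
have : 0 <= p by exact: fine_ge0.
rewrite le_eqVlt => /predU1P[<-|p0]; first by rewrite powR0 ?mul0r ?fine_ge0 ?gt_eqF.
have : 0 <= q by exact: fine_ge0.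
rewrite le_eqVlt => /predU1P[<-|q0]; first by rewrite (powR0 (lt0r_neq0 l0)) mulr0 fine_ge0.
(* [H] needs numbers strictly below the two masses. The exponents sum to 1, so shrinking both masses
   by [c] costs exactly one factor [c], which then tends to 1. *)
have key c : 0 < c -> c < 1 -> c * (p `^ (1 - l) * q `^ l) <= z.
  move=> c0 c1; rewrite -lee_fin -(fm Z)//.
  have -> : c * (p `^ (1 - l) * q `^ l) = (c * p) `^ (1 - l) * (c * q) `^ l.
    rewrite !powRM ?(ltW c0) ?(ltW p0) ?(ltW q0)// [RHS]mulrACA -powRD ?subrK ?powRr1 ?(ltW c0)//.
    by rewrite (gt_eqF ltr01).
  apply: H; rewrite ?mulr_gt0//.
    by rewrite [mu X]fm// lte_fin gtr_pMl.
  by rewrite [mu Y]fm// lte_fin gtr_pMl.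
rewrite leNgt; apply/negP => zP; set P := _ * _ in zP key.
have z0 : 0 <= z by exact: fine_ge0.
have P0 : 0 < P by exact: le_lt_trans zP.
have := key ((z / P + 1) / 2).
have zP1 : z / P < 1 by rewrite ltr_pdivrMr// mul1r.
have zP0 : 0 <= z / P by apply: divr_ge0 => //; exact: ltW.
have c01 : 0 < (z / P + 1) / 2 by lra.
have c11 : (z / P + 1) / 2 < 1 by lra.
move=> /(_ c01 c11).
rewrite (_ : _ * P = (z + P) / 2); last by field; exact: lt0r_neq0.
lra.
Qed.

End LogConcave.

(** * Local slopes of functions on R^d *)

Section EuclideanNorm.
Context {R : realType} {d : nat}.
Implicit Types x y z : 'rV[R]_d.

Lemma enorm_ge0 x : 0 <= enorm x.
Proof. exact: sqrtr_ge0. Qed.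

Lemma sumr_sqr_ge0 (a : 'I_d -> R) : 0 <= \sum_i a i ^+ 2.
Proof. by apply: sumr_ge0 => i _; exact: sqr_ge0. Qed.

Lemma enorm_sqr x : enorm x ^+ 2 = \sum_i x 0 i ^+ 2.
Proof. by rewrite sqr_sqrtr// sumr_sqr_ge0. Qed.

Lemma enorm0 : enorm (0 : 'rV[R]_d) = 0.
Proof.
rewrite /enorm big1 ?sqrtr0// => i _; by rewrite mxE expr0n.
Qed.

Lemma enormZ (a : R) x : enorm (a *: x) = `|a| * enorm x.
Proof.
rewrite /enorm -sqrtr_sqr -sqrtrM ?sqr_ge0// mulr_sumr; congr Num.sqrt.
by apply: eq_bigr => i _; rewrite mxE exprMn.
Qed.

Lemma enormN x : enorm (- x) = enorm x.
Proof. by rewrite -scaleN1r enormZ normrN1 mul1r. Qed.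

Lemma enorm_distC x y : enorm (x - y) = enorm (y - x).
Proof. by rewrite -enormN opprB. Qed.

Lemma Cauchy_Schwarz_sum (a b : 'I_d -> R) :
  \sum_i a i * b i <= Num.sqrt (\sum_i a i ^+ 2) * Num.sqrt (\sum_i b i ^+ 2).
Proof.
set A := \sum_i a i ^+ 2; set B := \sum_i b i ^+ 2; set c := \sum_i _.
have A0 : 0 <= A by exact: sumr_sqr_ge0.
have B0 : 0 <= B by exact: sumr_sqr_ge0.
have key t : 0 <= A - 2 * t * c + t ^+ 2 * B.
  have -> : A - 2 * t * c + t ^+ 2 * B = \sum_i (a i - t * b i) ^+ 2.
    rewrite /A /c /B !mulr_sumr -sumrN -!big_split /=; apply: eq_bigr => i _; ring.
  exact: sumr_sqr_ge0.
suff : c ^+ 2 <= A * B.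
  move=> h; rewrite -sqrtrM//; apply: le_trans (ler_norm _) _.
  by rewrite -sqrtr_sqr ler_wsqrtr.
move: B0; rewrite le_eqVlt => /predU1P[B0|B0]; last first.
  have := key (c / B); rewrite -(pmulr_rge0 _ B0).
  rewrite (_ : B * _ = A * B - c ^+ 2); last by field; exact: lt0r_neq0.
  by rewrite subr_ge0.
rewrite -B0 mulr0; have c0 : c = 0; last by rewrite c0 expr0n.
rewrite /c big1// => i _; suff -> : b i = 0 by rewrite mulr0.
apply/eqP; rewrite -sqrf_eq0; apply/eqP.
by apply: (psumr_eq0P (P := predT) (F := fun i => b i ^+ 2)) => // j _; exact: sqr_ge0.
Qed.

Lemma enorm_triangle x y : enorm (x + y) <= enorm x + enorm y.
Proof.
rewrite -(@ler_pXn2r _ 2) ?nnegrE ?addr_ge0 ?enorm_ge0//.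
rewrite sqrrD !enorm_sqr.
have := Cauchy_Schwarz_sum (x 0) (y 0); rewrite -!/(enorm _) => h.
apply: le_trans (_ : \sum_i x 0 i ^+ 2 + (\sum_i x 0 i * y 0 i) *+ 2 + \sum_i y 0 i ^+ 2 <= _).
  rewrite -sumrMnl -!big_split /=; apply: ler_sum => i _; rewrite mxE sqrrD; lra.
by rewrite lerD2r lerD2l lerMn2r /= h.
Qed.

Lemma enorm_dist x y : `|enorm x - enorm y| <= enorm (x - y).
Proof.
rewrite ler_norml; apply/andP; split; last first.
  by rewrite lerBlDr; apply: le_trans (enorm_triangle _ _); rewrite subrK.
rewrite lerNl opprB lerBlDr enorm_distC.
by apply: le_trans (enorm_triangle _ _); rewrite subrK.
Qed.

Lemma enorm_sub_triangle x y z : enorm (x - z) <= enorm (x - y) + enorm (y - z).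
Proof. by apply: le_trans (enorm_triangle _ _); rewrite addrA subrK. Qed.

Lemma coord_le_enorm x i : `|x 0 i| <= enorm x.
Proof.
rewrite /enorm -sqrtr_sqr ler_wsqrtr// (bigD1 i)//= lerDl.
by apply: sumr_ge0 => j _; exact: sqr_ge0.
Qed.

Lemma enorm_le_sum x : enorm x <= \sum_i `|x 0 i|.
Proof.
rewrite -(@ler_pXn2r _ 2) ?nnegrE ?enorm_ge0 ?sumr_ge0// enorm_sqr.
rewrite expr2 mulr_suml; apply: ler_sum => i _.
rewrite -real_normK ?num_real// expr2 ler_wpM2l// (bigD1 i)//= lerDl.
by apply: sumr_ge0.
Qed.

Lemma enorm_ball x (e : R) y : enorm (y - x) < e -> ball x e y.
Proof.
move=> xy; split; first exact: le_lt_trans (enorm_ge0 _) xy.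
move=> i j; rewrite ord1 /ball/= distrC.
by apply: le_lt_trans xy; have := coord_le_enorm (y - x) j; rewrite !mxE.
Qed.

Lemma near_enorm x (e : R) : 0 < e -> \forall y \near x, enorm (y - x) < e.
Proof.
move=> e0; have e1 : 0 < e / d.+1%:R by rewrite divr_gt0.
apply: filterS (nbhsx_ballx x _ e1) => y [_ xy].
apply: le_lt_trans (enorm_le_sum _) _.
apply: (@le_lt_trans _ _ (\sum_(i < d) (e / d.+1%:R))).
  apply: ler_sum => i _; rewrite !mxE distrC; exact/ltW/xy.
rewrite sumr_const card_ord -[_ *+ d]mulr_natr -mulrA gtr_pMr//.
by rewrite mulrC ltr_pdivrMr// mul1r ltr_nat.
Qed.

Lemma nbhs_enormP x (A : set 'rV[R]_d) :
  nbhs x A <-> exists2 e : R, 0 < e & forall y, enorm (y - x) < e -> A y.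
Proof.
split => [/nbhs_ballP[e /= e0 eA]|[e e0 eA]].
  by exists e => // y /enorm_ball; exact: eA.
by apply: filterS (near_enorm x e0) => y; exact: eA.
Qed.

Lemma open_enormP (A : set 'rV[R]_d) : open A <->
  forall x, A x -> exists2 e : R, 0 < e & forall y, enorm (y - x) < e -> A y.
Proof.
rewrite openE; split => [oA x /oA /nbhs_enormP//|H x Ax].
exact/nbhs_enormP/H.
Qed.

Lemma continuous_enorm : continuous (@enorm R d).
Proof.
move=> x; apply: (cvgrPdist_lt (FF := @nbhs_filter _ x) _ _).2 => e e0; apply: filterS (near_enorm x e0) => y xy.
by apply: le_lt_trans (enorm_dist _ _) _; rewrite enorm_distC.
Qed.

Lemma compact_enorm_ball (r : R) : compact [set x : 'rV[R]_d | enorm x <= r].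
Proof.
apply: bounded_closed_compact.
  exists r; split=> [|M rM x /= xr]; first exact: num_real.
  apply/ltW; apply: le_lt_trans rM => //=.
  rewrite /Num.norm/= mx_normrE; apply: bigmax_le => //=.
    by apply: le_trans xr; exact: enorm_ge0.
  by move=> [i j] _ /=; rewrite ord1; apply: le_trans xr; exact: coord_le_enorm.
rewrite (_ : mkset _ = @enorm R d @^-1` [set t | t <= r]); last by [].
apply: closed_comp; last exact: closed_le.
by move=> x _; exact: continuous_enorm.
Qed.

End EuclideanNorm.

Section Slope.
Context {R : realType} {d : nat}.
Implicit Types (v u G H : 'rV[R]_d -> R) (x y z : 'rV[R]_d).

(* [G] bounds the two-point local Lipschitz constant of [v]; [enorm (grad f x)] is such a bound for smooth [f], but so is that of [|f|], a cutoff or a truncation. *)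
Definition slope_le v G := forall x (e : R), 0 < e ->
  exists2 r : R, 0 < r & forall y z, enorm (y - x) < r -> enorm (z - x) < r ->
    `|v y - v z| <= (G x + e) * enorm (y - z).

Definition line_slope_le (f L : R -> R) := forall t (e : R), 0 < e ->
  exists2 r : R, 0 < r & forall s s', `|s - t| < r -> `|s' - t| < r ->
    `|f s - f s'| <= (L t + e) * `|s - s'|.

Lemma slope_le_continuous v G : slope_le v G -> continuous v.
Proof.
move=> vG x; apply: (cvgrPdist_lt (FF := @nbhs_filter _ x) _ _).2 => e e0.
have [r r0 H] := vG x _ ltr01.
pose K := `|G x| + 1 + 1; have K0 : 0 < K by rewrite /K ltr_wpDl// addr_ge0.
have m0 : 0 < Num.min r (e / K) by rewrite lt_min r0 divr_gt0.
apply: filterS (near_enorm x m0) => y; rewrite lt_min => /andP[yr ye].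
have h := H x y; rewrite subrr enorm0 in h.
apply: le_lt_trans (h r0 yr) _; rewrite enorm_distC.
apply: le_lt_trans (_ : K * enorm (y - x) < _).
  by rewrite ler_wpM2r ?enorm_ge0// /K; have := ler_norm (G x); lra.
by rewrite mulrC -ltr_pdivlMr.
Qed.

Lemma slope_le_measurable v G : slope_le v G ->
  measurable_fun setT (v : borelRd R d -> measurableTypeR R).
Proof.
by move=> vG; apply: continuous_measurable_borelRd; exact: slope_le_continuous vG.
Qed.

Lemma slope_le_comp v G (f L : R -> R) : slope_le v G -> line_slope_le f L ->
  (forall x, 0 <= G x) -> (forall t, 0 <= L t) ->
  slope_le (f \o v) (fun x => L (v x) * G x).
Proof.
move=> vG fL G0 L0 x e e0.
(* Since [e1 <= 1], the product [(L + e1) * (G + e1)] exceeds [L * G] by at most [e1 * (L + G + 1)],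
   hence by at most [e]. *)
pose e1 := Num.min 1 (e / (L (v x) + G x + 1)).
have D0 : 0 < L (v x) + G x + 1 by rewrite ltr_wpDl// addr_ge0.
have e10 : 0 < e1 by rewrite lt_min ltr01 divr_gt0.
have [r1 r10 h1] := vG x e1 e10.
have [r2 r20 h2] := fL (v x) e1 e10.
have cv := slope_le_continuous vG.
have /nbhs_enormP[r3 r30 h3] : \forall y \near x, `|v y - v x| < r2.
  have := (cvgrPdist_lt (FF := @nbhs_filter _ x) _ _).1 (cv x) r2 r20.
  by apply: filterS => y; rewrite distrC.
exists (Num.min r1 r3); first by rewrite lt_min r10.
move=> y z; rewrite !lt_min => /andP[y1 y3] /andP[z1 z3].
apply: le_trans (h2 _ _ (h3 _ y3) (h3 _ z3)) _.
apply: le_trans (_ : (L (v x) + e1) * ((G x + e1) * enorm (y - z)) <= _).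
  by apply: ler_wpM2l; [apply: addr_ge0 => //; exact: ltW|exact: h1].
rewrite mulrA ler_wpM2r ?enorm_ge0//.
have e11 : e1 <= 1 by rewrite /e1 ge_min lexx.
have e1e : e1 * (L (v x) + G x + 1) <= e.
  by rewrite -ler_pdivlMr// /e1 ge_min lexx orbT.
have := G0 x; have := L0 (v x); nra.
Qed.

Lemma slope_le_mul u H w K (M : R) : slope_le u H -> slope_le w K ->
  (forall x, 0 <= u x <= M) -> (forall x, 0 <= w x <= 1) ->
  (forall x, 0 <= H x) -> (forall x, 0 <= K x) ->
  slope_le (fun x => u x * w x) (fun x => H x + M * K x).
Proof.
move=> uH wK uM w1 H0 K0 x e e0.
have M0 : 0 <= M by have /andP[ux0 uxM] := uM x; exact: le_trans uxM.
have D0 : 0 < 1 + M by rewrite ltr_wpDr.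
have e10 : 0 < e / (1 + M) by rewrite divr_gt0.
have [r1 r10 h1] := uH x _ e10; have [r2 r20 h2] := wK x _ e10.
exists (Num.min r1 r2); first by rewrite lt_min r10.
move=> y z; rewrite !lt_min => /andP[y1 y3] /andP[z1 z3].
have -> : u y * w y - u z * w z = (u y - u z) * w y + u z * (w y - w z) by ring.
apply: le_trans (ler_normD _ _) _; rewrite !normrM.
have /andP[wy0 wy1] := w1 y; have /andP[uz0 uzM] := uM z.
rewrite (ger0_norm wy0) (ger0_norm uz0).
apply: le_trans (_ : (H x + e / (1 + M)) * enorm (y - z) +
    M * ((K x + e / (1 + M)) * enorm (y - z)) <= _).
  apply: lerD.
    by apply: le_trans (h1 _ _ y1 z1); rewrite ler_piMr.
  by apply: ler_pM => //; exact: h2.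
rewrite le_eqVlt; apply/orP; left; apply/eqP.
by field; exact: lt0r_neq0.
Qed.

Lemma slope_le_enorm : slope_le (@enorm R d) (cst 1).
Proof.
move=> x e e0; exists 1 => // y z _ _ /=.
by apply: le_trans (enorm_dist _ _) _; rewrite ler_peMl ?enorm_ge0// lerDl ltW.
Qed.

(** Compactness of the ball outside which [u] vanishes makes the local Lipschitz bounds uniform. The
    resulting constant is the dominating function when the radii of the oscillations tend to 0. *)
Lemma slope_le_unif u H (r : R) : slope_le u H -> (forall x, 0 <= H x) ->
  (forall x, r < enorm x -> u x = 0) ->
  exists L rho : R, [/\ 0 < L, 0 < rho & forall y z,
    enorm (y - z) < rho -> `|u y - u z| <= L * enorm (y - z)].
Proof.
move=> uH H0 ur.
have cK := @compact_enorm_ball R d r.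
(* A single integer serves both as Lipschitz constant and as inverse radius, so that the covering
   argument runs along the filter [\oo]. *)
have /compact_near_coveringP/(_ nat \oo (fun n y => forall z, enorm (y - z) < n.+1%:R^-1 ->
    `|u y - u z| <= n.+1%:R * enorm (y - z)) _) := cK.
case.
  move=> x _; have [s s0 h] := uH x 1 ltr01.
  have s20 : 0 < s / 2 by rewrite divr_gt0.
  have := near_enorm x s20.
  have : \forall n \near \oo, (H x + 1 + 2 / s : R) <= n.+1%:R.
    near=> n; apply: le_trans (_ : n%:R <= _); last by rewrite ler_nat.
    by near: n; exact: nbhs_infty_ger.
  move=> hn hx.
  exists ([set y : 'rV[R]_d | enorm (y - x) < s / 2],
    [set n : nat | (H x + 1 + 2 / s : R) <= n.+1%:R]); first by split.
  move=> [y n] /= [ys ns] z yz.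
  have n2 : n.+1%:R^-1 <= s / 2 :> R.
    rewrite invf_ple ?posrE// invfM invrK mulrC; apply: le_trans ns.
    by rewrite lerDr addr_ge0.
  apply: le_trans (h y z _ _) _.
  - by apply: lt_le_trans ys _; lra.
  - rewrite (_ : z - x = (z - y) + (y - x)); last by rewrite addrA subrK.
    apply: le_lt_trans (enorm_triangle _ _) _.
    rewrite [ltRHS]splitr; apply: ltrD => //.
    by rewrite enorm_distC; exact: lt_le_trans n2.
  - rewrite ler_wpM2r ?enorm_ge0//; apply: le_trans ns.
    by rewrite lerDl; apply: divr_ge0 => //; exact: ltW.
move=> N _ /(_ N (leqnn N)) /= h.
exists N.+1%:R, N.+1%:R^-1; split; rewrite ?ltr0n ?invr_gt0// => y z yz.
have [yr|yr] := leP (enorm y) r; first exact: h.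
have [zr|zr] := leP (enorm z) r.
  rewrite distrC enorm_distC; apply: h => //; by rewrite enorm_distC.
by rewrite !ur// subrr normr0 mulr_ge0 ?enorm_ge0.
Unshelve. all: by end_near. Qed.

End Slope.

Section SmoothSlope.
Context {R : realType} {d : nat}.
Implicit Types (f : 'rV[R]_d -> R) (x y z : 'rV[R]_d).

Lemma smooth_continuous f : smooth f -> continuous f.
Proof. by move=> /(_ [::])[]. Qed.

Lemma smooth_derivable f i x : smooth f ->
  derivable f x (delta_mx 0 i : 'rV[R]_d).
Proof. by move=> /(_ [::])[]. Qed.

Lemma smooth_partial_continuous f i : smooth f -> continuous (partial i f).
Proof. by move=> /(_ [:: i])[]. Qed.

Lemma is_derive_line f i x (t : R) : smooth f ->
  is_derive t (1 : R) (fun s => f (x + s *: delta_mx 0 i))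
    (partial i f (x + t *: delta_mx 0 i)).
Proof.
move=> sf; have H := @smooth_derivable f i (x + t *: delta_mx 0 i) sf.
have E : (fun h : R => h^-1 *: (((fun s => f (x + s *: delta_mx 0 i)) \o shift t) (h *: (1 : R))
    - f (x + t *: delta_mx 0 i))) =
   (fun h : R => h^-1 *: ((f \o shift (x + t *: delta_mx 0 i)) (h *: (delta_mx 0 i : 'rV[R]_d))
    - f (x + t *: delta_mx 0 i))).
  apply/funext => h /=; congr (_ *: (f _ - _)).
  by rewrite /shift /= [h *: (1 : R)]mulr1 scalerDl addrCA.
by split; rewrite /derivable /derive /= E.
Qed.

Lemma partial_mean_value f i x (h : R) : smooth f ->
  exists2 c : R, `|c| <= `|h| &
    f (x + h *: delta_mx 0 i) - f x = partial i f (x + c *: delta_mx 0 i) * h.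
Proof.
move=> sf; pose g s := f (x + s *: delta_mx 0 i).
have dg t := @is_derive_line f i x t sf.
have cg (a b : R) : {within `[a, b], continuous g}.
  apply: derivable_within_continuous => t _; have [dgt _] := dg t; exact: dgt.
have g0 : g 0 = f x by rewrite /g scale0r addr0.
have [h0|h0] := leP 0 h.
  have [c] := MVT_segment h0 (fun t _ => dg t) (cg 0 h).
  rewrite in_itv/= => /andP[c0 ch] E; exists c; first by rewrite !ger0_norm.
  by rewrite -g0 E subr0.
have [c] := MVT_segment (ltW h0) (fun t _ => dg t) (cg h 0).
rewrite in_itv/= => /andP[hc c0] E; exists c.
  by rewrite !ler0_norm ?lerN2// ltW.
by apply: oppr_inj; rewrite opprB -g0 E sub0r mulrN.
Qed.

(** Change [z] into [y] one coordinate at a time and apply the mean value theorem to each change: by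
    continuity the partial derivatives met on the way are close to those at [x], and Cauchy-Schwarz
    bounds the main term by the Euclidean norm of the gradient. *)
Lemma smooth_slope_le f : smooth f -> slope_le f (fun x => enorm (grad f x)).
Proof.
move=> sf x e e0.
pose e1 := e / d.+1%:R; have e10 : 0 < e1 by rewrite divr_gt0.
have /nbhs_ballP[r /= r0 hr] : \forall y \near x, forall i,
    `|partial i f x - partial i f y| < e1.
  apply: (@filter_forall _ _ (fun i => [set y | `|partial i f x - partial i f y| < e1]) _ (nbhs_filter x)) => i.
  exact: (cvgrPdist_lt (FF := @nbhs_filter _ x) _ _).1 (@smooth_partial_continuous f i sf x) e1 e10.
(* A coordinate of an intermediate point is within r/3 of that of [x], up to the mean value shift,
   which is at most [|y_j - z_j| < 2r/3]. *)
have r3 : 0 < r / 3 by rewrite divr_gt0.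
exists (r / 3) => // y z yr zr.
pose m (k : nat) : 'rV[R]_d := \row_i (if (i < k)%N then y 0 i else z 0 i).
have mS (k : 'I_d) : m k.+1 = m k + (y 0 k - z 0 k) *: delta_mx 0 k.
  apply/rowP => i; rewrite !mxE eqxx/= ltnS leq_eqVlt.
  have [->|ik] /= := eqVneq i k; first by rewrite eqxx ltnn mulr1 addrCA subrr addr0.
  rewrite (_ : (i == k :> nat) = false) ?mulr0 ?addr0//.
  by apply/negbTE; apply: contra ik => /eqP/val_inj ->.
have step (k : 'I_d) : exists p : R, `|partial k f x - p| < e1 /\
    f (m k.+1) - f (m k) = p * (y 0 k - z 0 k).
  have [c ch E] := @partial_mean_value f k (m k) (y 0 k - z 0 k) sf.
  exists (partial k f (m k + c *: delta_mx 0 k)); rewrite mS; split => //.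
  apply: hr; split => // i j; rewrite ord1 /ball /= !mxE eqxx /=.
  have yj : `|y 0 j - x 0 j| < r / 3.
    by apply: le_lt_trans yr; have := coord_le_enorm (y - x) j; rewrite !mxE.
  have zj : `|z 0 j - x 0 j| < r / 3.
    by apply: le_lt_trans zr; have := coord_le_enorm (z - x) j; rewrite !mxE.
  have cj : `|c * (j == k)%:R| <= `|y 0 j - z 0 j|.
    by have [->|_] := eqVneq j k; rewrite /= ?mulr1 ?mulr0 ?normr0.
  have yz : `|y 0 j - z 0 j| < r / 3 + r / 3.
    rewrite (_ : y 0 j - z 0 j = (y 0 j - x 0 j) - (z 0 j - x 0 j)); last by ring.
    by apply: le_lt_trans (ler_normB _ _) _; exact: ltrD.
  move: cj; set C := c * _ => cj.
  have mj : `|(if (j < k)%N then y 0 j else z 0 j) - x 0 j| < r / 3 by case: ifP.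
  move: mj; set w := if _ then _ else _ => mj.
  rewrite distrC (_ : w + C - x 0 j = (w - x 0 j) + C); last by ring.
  apply: le_lt_trans (ler_normD _ _) _; lra.
have /choice[p hp] := step.
have E : f y - f z = \sum_(k < d) p k * (y 0 k - z 0 k).
  transitivity (\sum_(k < d) (f (m k.+1) - f (m k))).
    rewrite -(big_mkord predT (fun k => f (m k.+1) - f (m k))) telescope_sumr//.
    by congr (f _ - f _); apply/rowP => i; rewrite mxE ?ltn_ord.
  by apply: eq_bigr => k _; have [_ ->] := hp k.
have -> : f y - f z = \sum_(k < d) grad f x 0 k * (y - z) 0 k +
    \sum_(k < d) (p k - partial k f x) * (y - z) 0 k.
  by rewrite E -big_split /=; apply: eq_bigr => k _; rewrite !mxE; ring.
rewrite mulrDl; apply: le_trans (ler_normD _ _) _; apply: lerD.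
  rewrite ler_norml; apply/andP; split; last exact: Cauchy_Schwarz_sum.
  have h := Cauchy_Schwarz_sum (grad f x 0) ((z - y) 0).
  rewrite -!/(enorm _) (enorm_distC z) in h.
  rewrite lerNl -sumrN; apply: le_trans h; rewrite le_eqVlt; apply/orP; left; apply/eqP.
  by apply: eq_bigr => k _; rewrite !mxE; ring.
apply: le_trans (ler_norm_sum _ _ _) _.
apply: le_trans (_ : \sum_(k < d) e1 * enorm (y - z) <= _).
  apply: ler_sum => k _; rewrite normrM; apply: ler_pM => //; last exact: coord_le_enorm.
  by have [/ltW + _] := hp k; rewrite distrC.
rewrite sumr_const card_ord -mulrnAl ler_wpM2r ?enorm_ge0//.
by rewrite -mulr_natr /e1 -mulrA ger_pMr// mulrC ler_pdivrMr// mul1r ler_nat.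
Qed.

End SmoothSlope.

(** * Oscillations over small balls *)

Section LimInf.
Context {R : realType}.
Local Open Scope ereal_scope.

Lemma le_limn_einf (u v : (\bar R)^nat) : (forall n, u n <= v n) ->
  limn_einf u <= limn_einf v.
Proof.
move=> uv; rewrite !limn_einf_lim; apply: lee_lim; [exact: is_cvg_einfs..|].
apply: nearW => n; apply: le_ereal_inf_tmp => _ [k /= nk <-].
by apply: ge_ereal_inf; exists (u k) => //; exists k.
Qed.

Lemma limf_einf_le_limn_einf (T : topologicalType) (F : set_system T)
    (f : T -> \bar R) (h : nat -> T) :
  h n @[n --> \oo] --> F -> limf_einf f F <= limn_einf (f \o h).
Proof.
move=> hF; rewrite limf_einfE; apply: ge_ereal_sup => _ [V FV <-].
have [N _ hN] := hF V FV.
rewrite limn_einf_lim; have /cvg_lim -> // := @cvg_einfs_sup R (f \o h).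
apply: le_ereal_sup_tmp; exists (einfs (f \o h) N); first by exists N.
apply: le_ereal_inf_tmp => _ [k /= Nk <-]; apply: ge_ereal_inf.
by exists (f (h k)) => //; exists (h k) => //; exact: hN.
Qed.

End LimInf.

Section Oscillation.
Context {R : realType} {d : nat}.
Implicit Types (u H : 'rV[R]_d -> R) (x y z : 'rV[R]_d).

(** With [lower], a substitute for the gradient: [lower <= t < upper] holds where the ball meets
    both sides of the level [t]. By [layer_cake], the mass of these boundary layers integrates in
    [t] to the mean oscillation. *)
Definition upper (k rho : R) u x := sup [set u (k *: x + y) | y in [set y | enorm y < rho]].
Definition lower (k rho : R) u x := inf [set u (k *: x + y) | y in [set y | enorm y < rho]].

Section bounds.
Variables (k rho M : R) (u : 'rV[R]_d -> R).
Hypotheses (rho0 : 0 < rho) (u0M : forall x, 0 <= u x <= M).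

Lemma osc_neq0 x : [set u (k *: x + y) | y in [set y | enorm y < rho]] !=set0.
Proof. by exists (u (k *: x + 0)), 0 => //=; rewrite enorm0. Qed.

Lemma has_sup_osc x : has_sup [set u (k *: x + y) | y in [set y | enorm y < rho]].
Proof.
split; first exact: osc_neq0.
by exists M => _ [y _ <-]; have /andP[] := u0M (k *: x + y).
Qed.

Lemma has_inf_osc x : has_inf [set u (k *: x + y) | y in [set y | enorm y < rho]].
Proof.
split; first exact: osc_neq0.
by exists 0 => _ [y _ <-]; have /andP[] := u0M (k *: x + y).
Qed.

Lemma upper_ge x y : enorm y < rho -> u (k *: x + y) <= upper k rho u x.
Proof.
by move=> yr; apply: ub_le_sup; [have [] := has_sup_osc x|exists y].
Qed.

Lemma lower_le x y : enorm y < rho -> lower k rho u x <= u (k *: x + y).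
Proof.
by move=> yr; apply: ge_inf; [have [] := has_inf_osc x|exists y].
Qed.

Lemma upper_gt x t : t < upper k rho u x -> exists2 y, enorm y < rho & t < u (k *: x + y).
Proof.
by move=> /(sup_gt (osc_neq0 x))[_ [y yr <-] ty]; exists y.
Qed.

Lemma lower_lt x t : lower k rho u x < t -> exists2 y, enorm y < rho & u (k *: x + y) < t.
Proof.
by move=> /(inf_lt (osc_neq0 x))[_ [y yr <-] ty]; exists y.
Qed.

Lemma lower_le_upper x : lower k rho u x <= upper k rho u x.
Proof.
have r0 : enorm (0 : 'rV[R]_d) < rho by rewrite enorm0.
exact: le_trans (lower_le x r0) (upper_ge x r0).
Qed.

Lemma upper_sub_lower_le x (B : R) :
  (forall y z, enorm y < rho -> enorm z < rho ->
    u (k *: x + y) - u (k *: x + z) <= B) ->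
  upper k rho u x - lower k rho u x <= B.
Proof.
move=> H; rewrite lerBlDr; apply: ge_sup (osc_neq0 x) _ => _ [y yr <-].
rewrite -lerBlDl; apply: lb_le_inf (osc_neq0 x) _ => _ [z zr <-].
by have := H y z yr zr; lra.
Qed.

(** A supremum of continuous functions is lower semicontinuous, so its strict superlevel sets are
    open. *)
Lemma measurable_upper : continuous u ->
  measurable_fun setT (upper k rho u : borelRd R d -> measurableTypeR R).
Proof.
move=> cu; apply: (measurability _ (RGenOInfty.measurableE R)).
move=> _ [_ [t ->] <-]; rewrite setTI; apply: sub_sigma_algebra.
apply/open_enormP => x /=; rewrite in_itv/= andbT => /upper_gt[y yr ty].
have : open [set z : 'rV[R]_d | t < u (k *: z + y)].
  apply: (@open_comp _ _ (fun z => u (k *: z + y)) [set r | t < r]) => //.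
  move=> z _; apply: continuous_comp; last exact: cu.
  by apply: continuousD; [exact: scaler_continuous|exact: cst_continuous].
move=> /open_enormP/(_ x ty)[e e0 he]; exists e => // z /he tz.
rewrite /= in_itv/= andbT; apply: lt_le_trans tz _; exact: upper_ge.
Qed.

Lemma measurable_lower : continuous u ->
  measurable_fun setT (lower k rho u : borelRd R d -> measurableTypeR R).
Proof.
move=> cu; apply: (measurability _ (RGenInftyO.measurableE R)).
move=> _ [_ [t ->] <-]; rewrite setTI; apply: sub_sigma_algebra.
apply/open_enormP => x /=; rewrite in_itv/= => /lower_lt[y yr ty].
have : open [set z : 'rV[R]_d | u (k *: z + y) < t].
  apply: (@open_comp _ _ (fun z => u (k *: z + y)) [set r | r < t]) => //.
  move=> z _; apply: continuous_comp; last exact: cu.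
  by apply: continuousD; [exact: scaler_continuous|exact: cst_continuous].
move=> /open_enormP/(_ x ty)[e e0 he]; exists e => // z /he tz.
rewrite /= in_itv/=; apply: le_lt_trans tz; exact: lower_le.
Qed.

End bounds.

End Oscillation.

Section OscillationLimit.
Context {R : realType} {d : nat} (mu : probability (borelRd R d) R).
Variables (u H : 'rV[R]_d -> R) (M L r0 : R) (k rho : nat -> R).
Hypotheses (u0M : forall x, 0 <= u x <= M) (uH : slope_le u H)
  (H0 : forall x, 0 <= H x)
  (mH : measurable_fun setT (H : borelRd R d -> measurableTypeR R))
  (uL : forall y z, enorm (y - z) < r0 -> `|u y - u z| <= L * enorm (y - z))
  (rho_gt0 : forall n, 0 < rho n) (rho_r0 : forall n, 2 * rho n <= r0)
  (rho_cvg : rho n @[n --> \oo] --> 0) (k_cvg : k n @[n --> \oo] --> (1 : R)).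

Let q n x := (upper (k n) (rho n) u x - lower (k n) (rho n) u x) / (2 * rho n).

Let pair_lt n (y z : 'rV[R]_d) : enorm y < rho n -> enorm z < rho n ->
  enorm (y - z) < 2 * rho n.
Proof.
move=> yr zr; apply: le_lt_trans (enorm_triangle _ _) _.
by rewrite enormN mulr_natl mulr2n; exact: ltrD.
Qed.

Let q_le n x (B : R) : (forall y z, enorm y < rho n -> enorm z < rho n ->
    u (k n *: x + y) - u (k n *: x + z) <= B * enorm (y - z)) -> 0 <= B ->
  q n x <= B.
Proof.
move=> h B0; rewrite /q ler_pdivrMr ?mulr_gt0//.
apply: upper_sub_lower_le => // y z yr zr.
apply: le_trans (h y z yr zr) _; rewrite ler_wpM2l// ltW//; exact: pair_lt.
Qed.

(* The dilation factor [k n], tending to 1, is only needed in the log-concave case, where the Prekopa-Leindler inequality rescales the set by [1 / (1 - l)]. *)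
Lemma osc_limit : 0 <= L ->
  (limn_einf (fun n => \int[mu]_x (q n x)%:E) <= \int[mu]_x (H x)%:E)%E.
Proof.
move=> L0.
have cu : continuous u by exact: slope_le_continuous uH.
have mq n : measurable_fun setT (q n : borelRd R d -> R).
  apply: measurable_funM => //; apply: measurable_funB.
    exact: measurable_upper u0M cu.
  exact: measurable_lower u0M cu.
have qL n x : q n x <= L.
  apply: q_le => // y z yr zr; apply: le_trans (ler_norm _) _.
  apply: le_trans (uL _) _; rewrite addrAC opprD addrA subrr add0r addrC//.
  by apply: lt_le_trans (rho_r0 n); exact: pair_lt.
have qH x (e : R) : 0 < e -> \forall n \near \oo, q n x <= H x + e.
  move=> e0; have [r rr0 h] := uH x e0.
  have r20 : 0 < r / 2 by rewrite divr_gt0.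
  have x1 : 0 < (r / 2) / (enorm x + 1) by rewrite divr_gt0// ltr_wpDl ?enorm_ge0.
  have n1 : \forall n \near \oo, rho n < r / 2.
    have hr := (cvgrPdist_lt _ _).1 rho_cvg _ r20; near=> n.
    have : `|0 - rho n| < r / 2 by near: n; exact: hr.
    by rewrite sub0r normrN; apply: le_lt_trans; exact: ler_norm.
  have n2 := (cvgrPdist_lt _ _).1 k_cvg _ x1.
  near=> n; apply: q_le; last by rewrite addr_ge0// ltW.
  have near_x y : enorm y < rho n -> enorm (k n *: x + y - x) < r.
    move=> yr; rewrite addrAC -{2}(scale1r x) -scalerBl.
    apply: le_lt_trans (enorm_triangle _ _) _; rewrite enormZ [ltRHS]splitr.
    apply: ler_ltD; last by apply: lt_trans yr _; near: n; exact: n1.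
    rewrite distrC.
    have : `|1 - k n| < (r / 2) / (enorm x + 1) by near: n; exact: n2.
    rewrite ltr_pdivlMr ?ltr_wpDl ?enorm_ge0// => /ltW; apply: le_trans.
    by rewrite ler_wpM2l// lerDl.
  move=> y z yr zr; apply: le_trans (ler_norm _) _.
  apply: le_trans (h _ _ (near_x _ yr) (near_x _ zr)) _.
  by rewrite addrAC opprD addrA subrr add0r addrC.
(* [H] need not be bounded or integrable, but the excess of the quotient over [H] lies between 0 and
   [L] and tends to 0, so dominated convergence applies to it alone. *)
pose D n x := Num.max (q n x - H x) 0.
have mD n : measurable_fun setT (D n : borelRd R d -> R).
  by apply: measurable_maxr => //; exact: measurable_funB.
have D0 n x : 0 <= D n x by rewrite le_max lexx orbT.
have DL n x : D n x <= L.
  by rewrite ge_max L0 andbT lerBlDr (le_trans (qL n x))// lerDl.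
have mDE n : measurable_fun setT (fun x : borelRd R d => (D n x)%:E) by exact/measurable_EFinP.
have Dcvg : {ae mu, forall x, setT x -> (D n x)%:E @[n --> \oo] --> (0%E : \bar R)}.
  apply: aeW => x _; apply: cvg_EFin; first exact: nearW.
  apply/cvgrPdist_le => e e0.
  have hq := qH x e e0; near=> n; have h : q n x <= H x + e by near: n; exact: hq.
  by rewrite sub0r normrN /= ger0_norm// /D ge_max (ltW e0) andbT lerBlDl.
have iL : mu.-integrable setT (cst L%:E) by exact: finite_measure_integrable_cst.
have DLE : {ae mu, forall x n, setT x -> (`|(D n x)%:E| <= (cst L%:E) x)%E}.
  by apply: aeW => x n _; rewrite /= lee_fin ger0_norm.
have [_ _] := dominated_convergence measurableT mDE (measurable_cst _) Dcvg iL DLE.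
rewrite integral0 => Dint.
have step n : (\int[mu]_x (q n x)%:E <= \int[mu]_x (H x)%:E + \int[mu]_x (D n x)%:E)%E.
  have mHE : measurable_fun setT (fun x : borelRd R d => (H x)%:E) by exact/measurable_EFinP.
  rewrite -(@ge0_integralD _ _ _ mu setT measurableT _ _ _ mHE _ (mDE n))//.
  - apply: integral_monotone => x _; rewrite -EFinD lee_fin -lerBlDl /D le_max.
    by rewrite lexx.
  - by move=> x _; rewrite lee_fin.
  - by move=> x _; rewrite lee_fin; exact: D0.
apply: le_trans (le_limn_einf step) _.
have [Hoo|Hoo] := eqVneq (\int[mu]_x (H x)%:E)%E +oo%E; first by rewrite Hoo leey.
have Hf : (\int[mu]_x (H x)%:E)%E \is a fin_num.
  by rewrite ge0_fin_numE ?ltey// integral_ge0// => x _; rewrite lee_fin.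
have : (\int[mu]_x (H x)%:E + \int[mu]_x (D n x)%:E)%E @[n --> \oo] -->
    (\int[mu]_x (H x)%:E + 0)%E.
  by apply: cvgeD => //; [exact: fin_num_adde_defr|exact: cvg_cst].
by move=> /cvg_limn_einf_sup[-> _]; rewrite adde0.
Unshelve. all: by end_near. Qed.

End OscillationLimit.

(** * Isoperimetric and log-concave coarea inequalities *)

Lemma limn_einf_pZl_le (R : realType) (c : R) (u : (\bar R)^nat) : 0 < c ->
  (limn_einf (fun n => c%:E * u n) <= c%:E * limn_einf u)%E.
Proof.
move=> c0; rewrite !limn_einf_lim.
have /cvg_lim -> // := @cvg_einfs_sup R (fun n => c%:E * u n)%E.
have /cvg_lim -> // := @cvg_einfs_sup R u.
apply: ge_ereal_sup => _ [N _ <-]; rewrite -lee_pdivrMl//.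
apply: le_ereal_sup_tmp; exists (einfs u N); first by exists N.
apply: le_ereal_inf_tmp => _ [k /= Nk <-]; rewrite lee_pdivrMl//.
by apply: ge_ereal_inf; exists (c%:E * u k)%E => //; exists k.
Qed.

Section Enlargement.
Context {R : realType} {d : nat}.
Implicit Types (S : set 'rV[R]_d) (x y z : 'rV[R]_d).

Lemma enlargement_lt S (h h' : R) x : h < h' -> enlargement S h x ->
  exists2 y, S y & enorm (x - y) < h'.
Proof.
move=> hh' /= xh; have : (dist_set x S < h'%:E)%E.
  by apply: le_lt_trans xh _; rewrite lte_fin.
by move=> /ereal_inf_lt[_ [y Sy <-]]; rewrite lte_fin => xy; exists y.
Qed.

Lemma measurable_enlargement S (h : R) : measurable (enlargement S h : set (borelRd R d)).
Proof.
rewrite -[enlargement S h]setCK; apply: measurableC.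
apply: sub_sigma_algebra; apply/open_enormP => x /= /negP; rewrite -ltNge => hx.
have [e e0 he] : exists2 e : R, 0 < e & ((h + e)%:E <= dist_set x S)%E.
  case E : (dist_set x S) hx => [r| |] //.
    by rewrite lte_fin => hr; exists (r - h); rewrite ?subr_gt0// addrC subrK.
  by move=> _; exists 1 => //; rewrite leey.
have e20 : 0 < e / 2 by rewrite divr_gt0.
exists (e / 2) => // z zx; apply/negP; rewrite -ltNge.
apply: lt_le_trans (_ : (h + e / 2)%:E <= _)%E; first by rewrite lte_fin ltrDl.
apply: le_ereal_inf_tmp => _ [y Sy <-]; rewrite lee_fin.
have : ((h + e)%:E <= (enorm (x - y))%:E)%E.
  by apply: le_trans he _; apply: ereal_inf_lbound; exists y.
rewrite lee_fin; have := enorm_sub_triangle x z y; rewrite (enorm_distC x z); lra.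
Qed.

End Enlargement.

(** First-order expansion of the geometric mean at [l = 0], from [1 + x <= expR x]; it extracts a
    derivative from Prekopa-Leindler as [l] tends to 0. *)
Lemma powR_interp_ge (R : realType) (l a b : R) : 0 < a -> 0 < b ->
  a * (1 + l * (ln b - ln a)) <= a `^ (1 - l) * b `^ l.
Proof.
move=> a0 b0; rewrite /powR !gt_eqF// -expRD.
rewrite (_ : (1 - l) * ln a + l * ln b = ln a + l * (ln b - ln a)); last by ring.
by rewrite expRD lnK ?posrE// ler_wpM2l ?(ltW a0)//; exact: expR_ge1Dx.
Qed.

Section LipschitzRates.
Context {R : realType} {d : nat} (mu : probability (borelRd R d) R).
Variables (u H : 'rV[R]_d -> R) (M L r0 : R).
Hypotheses (u0M : forall x, 0 <= u x <= M) (uH : slope_le u H)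
  (H0 : forall x, 0 <= H x)
  (mH : measurable_fun setT (H : borelRd R d -> measurableTypeR R))
  (L0 : 0 <= L) (r00 : 0 < r0)
  (uL : forall y z, enorm (y - z) < r0 -> `|u y - u z| <= L * enorm (y - z)).

Let cu : continuous u.
Proof. exact: slope_le_continuous uH. Qed.

Let mu_ : measurable_fun setT (u : borelRd R d -> measurableTypeR R).
Proof. exact: continuous_measurable_borelRd. Qed.

Lemma isoperimetric_rate_Lipschitz (w : R) : 0 <= w ->
  (forall t, 0 <= t -> (w%:E * mu [set x | (t < u x)%R]
     <= boundary_measure mu [set x | (t < u x)%R])%E) ->
  (w%:E * \int[mu]_x (u x)%:E <= 4%:E * \int[mu]_x (H x)%:E)%E.
Proof.
move=> w0 hw.
pose rho n : R := r0 / 2 / n.+1%:R.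
have rho0 n : 0 < rho n by rewrite !divr_gt0.
have rho2 n : 2 * rho n <= r0.
  rewrite /rho mulrA mulrCA divff// mulr1 ler_pdivrMr// ler_peMr ?(ltW r00)//.
  by rewrite ler1n.
have rho_cvg : rho n @[n --> \oo] --> 0.
  rewrite -[X in _ --> X](mulr0 (r0 / 2)); apply: cvgMr; exact: cvg_harmonic.
have mup n := @measurable_upper R d 1 (rho n) M u (rho0 n) u0M cu.
have mlo n := @measurable_lower R d 1 (rho n) M u (rho0 n) u0M cu.
pose A n t : set (borelRd R d) := [set x | lower 1 (rho n) u x <= t < upper 1 (rho n) u x].
have key t : 0 <= t -> (w%:E * mu [set x | (t < u x)%R] <=
    limn_einf (fun n => 4%:E * ((2 * rho n)^-1%:E * mu (A n t))))%E.
  move=> t0; apply: le_trans (hw t t0) _.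
  (* Enlarging by half of [rho n] leaves room for a distance that is not attained. This halving and
     the diameter [2 * rho n] in the difference quotient make up the factor 4. *)
  apply: le_trans (@limf_einf_le_limn_einf _ _ _ _ (fun n => rho n / 2) _) _.
    have half_cvg : rho n / 2 @[n --> \oo] --> (0 : R).
      by rewrite -[X in _ --> X](mul0r 2^-1); apply: cvgMl.
    move=> V hV; have /= [N _ hN] := half_cvg _ hV; exists N => // n Nn /=.
    by apply: hN => //=; rewrite divr_gt0.
  apply: le_limn_einf => n /=.
  have -> : (rho n / 2)^-1 = 4 * (2 * rho n)^-1.
    by field; exact: lt0r_neq0.
  rewrite EFinM -muleA; apply: lee_wpmul2l => //; apply: lee_wpmul2l.
    by rewrite lee_fin invr_ge0 mulr_ge0// ltW.
  have mS : measurable ([set x | t < u x] : set (borelRd R d)).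
    exact: measurable_gt_set.
  have mA : measurable (A n t).
    rewrite (_ : A n t = [set x | lower 1 (rho n) u x <= t] `&` [set x | t < upper 1 (rho n) u x]).
      by apply: measurableI; [exact: measurable_le_set (mlo n) t|exact: measurable_gt_set (mup n) t].
    by apply/seteqP; split=> x /andP.
  rewrite leeBlDr; last by rewrite fin_num_measure.
  apply: le_trans (measureU2 _ mA mS).
  apply: le_measure; rewrite ?inE; [exact: measurable_enlargement|exact: measurableU|].
  have hrho : rho n / 2 < rho n by rewrite ltr_pdivrMr// ltr_pMr// ltr1n.
  move=> x /(enlargement_lt hrho)[y /= ty xy].
  have [tx|xt] := ltP t (u x); [by right|left].
  rewrite /A /=; apply/andP; split.
    have h0 : enorm (0 : 'rV[R]_d) < rho n by rewrite enorm0.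
    by apply: le_trans xt; have := lower_le 1 (rho0 n) u0M x h0; rewrite scale1r addr0.
  apply: lt_le_trans ty _; have yx : enorm (y - x) < rho n by rewrite enorm_distC.
  by have := upper_ge 1 (rho0 n) u0M x yx; rewrite scale1r addrC subrK.
have LC (f : borelRd R d -> R) : measurable_fun setT f -> (forall x, 0 <= f x) ->
   (\int[mu]_x (f x)%:E = \int[@lebesgue_measure R]_t mu [set x | (0 <= t < f x)%R])%E.
  move=> mf f0.
  transitivity (\int[mu]_x (f x - cst 0 x)%:E)%E.
    by apply: eq_integral => x _; rewrite /= subr0.
  exact: layer_cake.
have mB n : measurable_fun setT (fun t : measurableTypeR R => mu (A n t)).
  exact: (@measurable_layer _ _ _ mu _ _ (mlo n) (mup n)).
have mB' n : measurable_fun setT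
    (fun t : measurableTypeR R => ((2 * rho n)^-1%:E * mu (A n t))%E).
  exact: measurable_funeM.
have p0 n : (0 <= (2 * rho n)^-1%:E :> \bar R)%E.
  by rewrite lee_fin invr_ge0 mulr_ge0// ltW.
rewrite LC//; last by move=> x; have /andP[] := u0M x.
apply: le_trans (_ : \int[@lebesgue_measure R]_t
  limn_einf (fun n => 4%:E * ((2 * rho n)^-1%:E * mu (A n t))) <= _)%E.
  rewrite -ge0_integralZl_EFin//; last exact: (@measurable_layer _ _ _ mu (cst 0) u).
  apply: integral_monotone => t _; have [t0|t0] := leP 0 t; first exact: key.
  rewrite (_ : mkset _ = set0) ?measure0 ?mule0; last by apply/seteqP; split.
  rewrite limn_einf_lim; apply: lime_ge; first exact: is_cvg_einfs.
  apply: nearW => n; apply: le_ereal_inf_tmp => _ [m _ <-].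
  by rewrite mule_ge0// mule_ge0.
apply: le_trans (fatou _ _ _ _) _ => //.
- by move=> n; exact: measurable_funeM.
- by move=> n t _; rewrite mule_ge0// mule_ge0.
have E n : (\int[@lebesgue_measure R]_t (4%:E * ((2 * rho n)^-1%:E * mu (A n t))) =
   4%:E * \int[mu]_x ((upper 1 (rho n) u x - lower 1 (rho n) u x) / (2 * rho n))%:E)%E.
  rewrite ge0_integralZl_EFin//; last by move=> t _; rewrite mule_ge0.
  have q0 : 0 <= (2 * rho n)^-1 by rewrite -lee_fin.
  have lu x : lower 1 (rho n) u x <= upper 1 (rho n) u x by exact: lower_le_upper u0M x.
  congr (_ * _)%E; rewrite ge0_integralZl_EFin//.
  rewrite -(layer_cake mu (mlo n) (mup n))//.
  rewrite -ge0_integralZl_EFin//.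
  - by apply: eq_integral => x _; rewrite -EFinM mulrC.
  - by move=> x _; rewrite lee_fin subr_ge0.
  - by apply/measurable_EFinP; exact: (measurable_funB (mup n) (mlo n)).
apply: le_trans (@le_limn_einf _ _ (fun n => 4%:E * _)%E (fun n => eq_ind_r (fun z => z <= _)%E (lexx _) (E n))) _.
apply: le_trans (limn_einf_pZl_le _ _) _ => //.
apply: lee_wpmul2l => //.
by apply: (@osc_limit R d mu u H M L r0 (cst 1) rho) => //; exact: cvg_cst.
Qed.

Let M0 : 0 <= M.
Proof. by have /andP[u0 uM] := u0M 0; exact: le_trans uM. Qed.

(** Mixing with the ball is applied to {u > t} and to {u <= t}. The two resulting masses exceed 1 in
    sum by at most the mass of the boundary layer, so a set never has to be compared with its own
    dilate. *)
Lemma log_concave_rate_Lipschitz (r c : R) : log_concave mu -> 0 < r -> 0 <= c ->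
  0 < fine (mu [set x | enorm x < r]) ->
  (forall t, 0 <= t -> t < M ->
    let p := fine (mu [set x | t < u x]) in
    [/\ 0 < p, p < 1 & c <= ln (fine (mu [set x | enorm x < r])) - p * ln p]) ->
  ((M * c)%:E <= (4 * r)%:E * \int[mu]_x (H x)%:E)%E.
Proof.
move=> lc rp c0; set b := fine _ => b0 hc.
(* The bound 1/2 keeps the dilation factor below 2; with it, [l * (4 * r) <= r0] keeps the balls
   inside the range of the Lipschitz bound. *)
pose l0 := Num.min 2^-1 (r0 / (4 * r)).
have l00 : 0 < l0 by rewrite lt_min invr_gt0 ltr0n divr_gt0// mulr_gt0.
pose l n := l0 / n.+1%:R.
have lp n : 0 < l n by rewrite divr_gt0.
have ll0 n : l n <= l0 by rewrite ler_pdivrMr// ler_peMr ?(ltW l00)// ler1n.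
have l2 n : l n <= 2^-1 by apply: le_trans (ll0 n) _; rewrite /l0 ge_min lexx.
have l1 n : 0 < 1 - l n by have := l2 n; lra.
have lr n : l n * (4 * r) <= r0.
  rewrite -ler_pdivlMr ?mulr_gt0//; apply: le_trans (ll0 n) _.
  by rewrite /l0 ge_min lexx orbT.
have l_cvg : l n @[n --> \oo] --> (0 : R).
  rewrite -[X in _ --> X](mulr0 l0); apply: cvgMr; exact: cvg_harmonic.
pose k n := (1 - l n)^-1.
pose rho n := l n * r * k n.
have k0 n : 0 < k n by rewrite invr_gt0.
have k2 n : k n <= 2.
  by rewrite /k -[leRHS]invrK lef_pV2 ?posrE ?invr_gt0//; have := l2 n; lra.
have k_cvg : k n @[n --> \oo] --> (1 : R).
  rewrite -[X in _ --> X]invr1; apply: cvgV; first exact: oner_neq0.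
  rewrite -[X in _ --> X](subr0 1); apply: cvgB => //; exact: cvg_cst.
have rho0 n : 0 < rho n by rewrite !mulr_gt0.
have rho_cvg : rho n @[n --> \oo] --> (0 : R).
  rewrite (_ : 0 = 0 * r * 1 :> R); last by rewrite !mul0r.
  by apply: cvgM => //; apply: cvgM => //; exact: cvg_cst.
have rho2 n : 2 * rho n <= r0.
  apply: le_trans (lr n); rewrite /rho.
  have lrn : 0 <= l n * r by apply: mulr_ge0; exact: ltW.
  have := ler_wpM2l lrn (k2 n); lra.
have mup n := @measurable_upper R d (k n) (rho n) M u (rho0 n) u0M cu.
have mlo n := @measurable_lower R d (k n) (rho n) M u (rho0 n) u0M cu.
pose A n t : set (borelRd R d) :=
  [set x | lower (k n) (rho n) u x <= t < upper (k n) (rho n) u x].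
have fm (S : set (borelRd R d)) : measurable S -> mu S = (fine (mu S))%:E.
  by move=> mS; rewrite fineK// fin_num_measure.
have mball : measurable ([set x | enorm x < r] : set (borelRd R d)).
  apply: measurable_lt_set; apply: continuous_measurable_borelRd.
  exact: continuous_enorm.
have lu n x : lower (k n) (rho n) u x <= upper (k n) (rho n) u x by exact: lower_le_upper u0M x.
have key n t : 0 <= t -> t < M -> ((l n * c)%:E <= mu (A n t))%E.
  move=> t0 tM; have [p0 p1 cp] := hc t t0 tM.
  have mt := measurable_gt_set mu_ t; have mt' := measurable_le_set mu_ t.
  have mU := measurable_gt_set (mup n) t; have mL := measurable_le_set (mlo n) t.
  have ln1 : l n < 1 by have := l1 n; lra.
  (* Dilating the convex combination by [k n = 1 / (1 - l n)] returns [x] up to [l n * k n] times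
     [y], which is shorter than [rho n] when [y] lies in the ball of radius [r]. *)
  have xE (x y : 'rV[R]_d) : k n *: ((1 - l n) *: x + l n *: y) + (- (l n * k n)) *: y = x.
    rewrite scalerDr !scalerA -addrA -scalerDl /k mulVf ?scale1r; last exact: lt0r_neq0.
    by rewrite mulrC subrr scale0r addr0.
  have yE (y : 'rV[R]_d) : enorm y < r -> enorm ((- (l n * k n)) *: y) < rho n.
    move=> yr; rewrite enormZ normrN gtr0_norm ?mulr_gt0// /rho mulrAC.
    by rewrite ltr_pM2r// ltr_pM2l.
  have : forall x y : 'rV[R]_d, t < u x -> enorm y < r ->
     t < upper (k n) (rho n) u ((1 - l n) *: x + l n *: y).
    move=> x y tx yr; apply: lt_le_trans tx _.
    by have := upper_ge (k n) (rho0 n) u0M ((1 - l n) *: x + l n *: y) (yE y yr); rewrite xE.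
  move=> /(log_concave_prekopa_leindler lc (lp n) ln1 mt mball mU) plU.
  have plL : forall x y : 'rV[R]_d, u x <= t -> enorm y < r ->
     lower (k n) (rho n) u ((1 - l n) *: x + l n *: y) <= t.
    move=> x y tx yr; apply: le_trans tx.
    by have := lower_le (k n) (rho0 n) u0M ((1 - l n) *: x + l n *: y) (yE y yr); rewrite xE.
  move: plL => /(log_concave_prekopa_leindler lc (lp n) ln1 mt' mball mL) plL.
  have mA : measurable (A n t).
    rewrite (_ : A n t = [set x | lower (k n) (rho n) u x <= t] `&`
        [set x | t < upper (k n) (rho n) u x]); first exact: measurableI.
    by apply/seteqP; split=> x /andP.
  (* The boundary layer is the intersection of the two sets on the left, and their union has mass at
     most 1. *)
  have tot : (mu [set x | (t < upper (k n) (rho n) u x)%R] +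
       mu [set x | (lower (k n) (rho n) u x <= t)%R] <= mu (A n t) + 1)%E.
    rewrite (measureDI _ mU mL) -addeA [leRHS]addeC addeCA [leRHS]addeC.
    apply: leeD.
      apply: le_measure; rewrite ?inE//; first exact: measurableI.
      by move=> x [/= h1 h2]; rewrite /A /= h1 h2.
    have mUL := measurableD mU mL.
    have dj : ([set x | t < upper (k n) (rho n) u x] `\` [set x | lower (k n) (rho n) u x <= t])
        `&` [set x | lower (k n) (rho n) u x <= t] = set0.
      by rewrite setDE -setIA setICl setI0.
    rewrite -(measureU _ mUL mL dj) -(@probability_setT _ _ _ mu).
    by apply: le_measure; rewrite ?inE//; exact: measurableU.
  rewrite (fm _ mU) (fm _ mL) (fm _ mA) -!EFinD !lee_fin in tot *.
  set pU := fine (mu [set x | t < upper _ _ u x]) in tot plU.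
  set pL := fine (mu [set x | lower _ _ u x <= t]) in tot plL.
  set p := fine (mu [set x | t < u x]) in p0 p1 cp plU.
  have pE : fine (mu [set x | u x <= t]) = 1 - p.
    rewrite (_ : [set x | u x <= t] = ~` [set x | t < u x]).
      by rewrite probability_setC// fm.
    by apply/seteqP; split=> x /=; [move=> h; apply/negP; rewrite -leNgt|move=> /negP; rewrite -leNgt].
  rewrite pE in plL.
  have q0 : 0 < 1 - p by rewrite subr_gt0.
  (* The sum of the two expansions is 1 plus [l n] times [ln b - p ln p - (1 - p) ln (1 - p)]; the
     last term is nonnegative and is dropped. *)
  have i1 := powR_interp_ge (l n) p0 b0; have i2 := powR_interp_ge (l n) q0 b0.
  have lnq : ln (1 - p) <= 0 by apply: ln_le0; lra.
  rewrite -/b in plU plL.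
  have := lp n; set D := 1 - p in q0 i2 lnq plL *; have DE : D = 1 - p by [].
  move=> lnp; have h1 : l n * c <= l n * (ln b - p * ln p) by rewrite ler_wpM2l ?(ltW lnp).
  have h2 : 0 <= D * (l n * - ln D).
    by apply: mulr_ge0; [exact: ltW|apply: mulr_ge0; [exact: ltW|rewrite oppr_ge0]].
  nra.
have osc n : ((M * (l n * c))%:E <= \int[mu]_x (upper (k n) (rho n) u x - lower (k n) (rho n) u x)%:E)%E.
  rewrite (layer_cake mu (mlo n) (mup n))//.
  apply: (@le_trans _ _ (\int[@lebesgue_measure R]_(t in `[0%R, M[) (l n * c)%:E)%E).
    rewrite integral_cst//= lebesgue_measure_itv/= lte_fin.
    case: ltP => M0'; first by rewrite -EFinD subr0 -EFinM mulrC.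
    have -> : M = 0 by apply/eqP; rewrite eq_le M0' M0.
    by rewrite mul0r mule0.
  rewrite integral_mkcond; apply: integral_monotone => t _; rewrite patchE.
  case: ifPn => [/set_mem|_]; last exact: measure_ge0.
  by rewrite /= in_itv/= => /andP[t0 tM]; exact: key.
have qn n : ((c * M / (4 * r))%:E <=
   \int[mu]_x ((upper (k n) (rho n) u x - lower (k n) (rho n) u x) / (2 * rho n))%:E)%E.
  have q0 : 0 <= (2 * rho n)^-1 by rewrite invr_ge0 mulr_ge0// ltW.
  rewrite (_ : (fun x => _) = (fun x => (2 * rho n)^-1%:E *
      (upper (k n) (rho n) u x - lower (k n) (rho n) u x)%:E)%E); last first.
    by apply/funext => x; rewrite -EFinM mulrC.
  rewrite ge0_integralZl_EFin//; last 2 first.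
  - by move=> x _; rewrite lee_fin subr_ge0.
  - by apply/measurable_EFinP; exact: (measurable_funB (mup n) (mlo n)).
  have q0E : (0 <= (2 * rho n)^-1%:E :> \bar R)%E by rewrite lee_fin.
  apply: le_trans (lee_wpmul2l q0E (osc n)).
  rewrite -EFinM lee_fin /rho /k.
  rewrite (_ : (2 * (l n * r * (1 - l n)^-1))^-1 * (M * (l n * c)) = c * M / (2 * r) * (1 - l n)); last first.
    by field; rewrite !lt0r_neq0.
  rewrite (_ : c * M / (4 * r) = c * M / (2 * r) * 2^-1); last by field; rewrite lt0r_neq0.
  apply: ler_wpM2l; last by have := l2 n; lra.
  by apply: divr_ge0; apply: mulr_ge0 => //; exact: ltW.
have lim := @osc_limit R d mu u H M L r0 k rho u0M uH H0 mH uL rho0 rho2 rho_cvg k_cvg L0.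
rewrite -lee_pdivrMl ?mulr_gt0// -EFinM mulrC (mulrC M).
apply: le_trans lim.
rewrite limn_einf_lim; apply: lime_ge; first exact: is_cvg_einfs.
by apply: nearW => n; apply: le_ereal_inf_tmp => _ [m _ <-]; exact: qn.
Qed.

End LipschitzRates.

(** * Layers *)

Section Cutoff.
Context {R : realType} {d : nat} (mu : probability (borelRd R d) R).

Lemma clamp_slope_le (a b : R) : a < b ->
  line_slope_le (fun t => Num.min (Num.max (t - a) 0) (b - a))
    (fun t => (a <= t <= b)%R%:R).
Proof.
move=> ab t e e0.
have lip s s' : `|Num.min (Num.max (s - a) 0) (b - a) - Num.min (Num.max (s' - a) 0) (b - a)|
    <= `|s - s'|.
  wlog ss' : s s' / s <= s'.
    move=> h; have [/h//|/ltW/h] := leP s s'.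
    by rewrite distrC (distrC s).
  rewrite ler_norml.
  have := ler_norm (s' - s); rewrite distrC => h.
  have -> : `|s - s'| = s' - s by rewrite distrC ger0_norm// subr_ge0.
  rewrite !minEle !maxEle; do 4 case: ifPn => //; rewrite -?ltNge => *; apply/andP; split; lra.
have [tab|] := boolP (a <= t <= b).
  exists 1 => // s s' _ _; apply: le_trans (lip s s') _.
  by rewrite ler_peMl//= lerDl ltW.
have pos (c : bool) (s s' : R) : 0 <= (c%:R + e) * `|s - s'|.
  by rewrite mulr_ge0// addr_ge0// ltW.
rewrite negb_and -!ltNge => /orP[ta|bt].
  exists (a - t); first by rewrite subr_gt0.
  move=> s s'; rewrite !ltr_norml => /andP[_ h] /andP[_ h'].
  have z x : x <= a -> Num.min (Num.max (x - a) 0) (b - a) = 0.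
    by move=> xa; rewrite max_r ?subr_le0// min_l// subr_ge0 ltW.
  rewrite (z s) ?(z s') ?subrr ?normr0 ?pos//; lra.
exists (t - b); first by rewrite subr_gt0.
move=> s s'; rewrite !ltr_norml => /andP[h _] /andP[h' _].
have z x : b <= x -> Num.min (Num.max (x - a) 0) (b - a) = b - a.
  by move=> bx; rewrite min_r// le_max lerD2r bx.
rewrite (z s) ?(z s') ?subrr ?normr0 ?pos//; lra.
Qed.

Lemma cutoff_slope_le (c : R) : 0 < c ->
  line_slope_le (fun t => Num.max 0 (Num.min 1 (2 - c * t))) (cst c).
Proof.
move=> c0 t e e0; exists 1 => // s s' _ _ /=.
apply: le_trans (_ : `|c * (s - s')| <= _); last first.
  by rewrite normrM (gtr0_norm c0) ler_wpM2r// lerDl ltW.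
wlog ss' : s s' / s <= s'.
  move=> h; have [/h//|/ltW/h] := leP s s'.
  by rewrite distrC !mulrBr (distrC (c * s')).
have cs : c * s <= c * s' by rewrite ler_wpM2l// ltW.
have -> : `|c * (s - s')| = c * s' - c * s.
  by rewrite -normrN -mulrN opprB mulrBr ger0_norm// subr_ge0.
rewrite ler_norml !minEle !maxEle; do 4 case: ifPn => //; rewrite -?ltNge => *; apply/andP; split; lra.
Qed.

(** Truncating [v] to the layer and multiplying by a radial cutoff gives a function of bounded
    support, to which the uniform Lipschitz rates apply. The cutoff has slope [1 / n.+1], which is
    the origin of the error term. The layer is closed because the truncation has local Lipschitz
    constant 1 at both end levels. *)
Lemma layer_cutoff (v G : 'rV[R]_d -> R) (a b : R) (n : nat) :
  slope_le v G -> (forall x, 0 <= G x) ->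
  measurable_fun setT (G : borelRd R d -> measurableTypeR R) -> a < b ->
  exists (u H : 'rV[R]_d -> R) (L r0 : R),
    ((forall x, 0 <= u x <= b - a) /\ slope_le u H /\ (forall x, 0 <= H x) /\
     measurable_fun setT (H : borelRd R d -> measurableTypeR R)) /\
    (0 <= L /\ 0 < r0 /\
     forall y z, enorm (y - z) < r0 -> `|u y - u z| <= L * enorm (y - z)) /\
    (forall x, 0 < u x -> a < v x) /\
    (forall x, b <= v x -> enorm x <= n.+1%:R -> u x = b - a) /\
    (\int[mu]_x (H x)%:E <=
      \int[mu]_(x in [set x | (a <= v x <= b)%R]) (G x)%:E + ((b - a) / n.+1%:R)%:E)%E.
Proof.
move=> vG G0 mG ab.
have ba : 0 < b - a by rewrite subr_gt0.
pose f t : R := Num.min (Num.max (t - a) 0) (b - a).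
pose c : R := n.+1%:R^-1.
have c0 : 0 < c by rewrite invr_gt0.
pose g t : R := Num.max 0 (Num.min 1 (2 - c * t)).
have vc := slope_le_continuous vG.
have mv : measurable_fun setT (v : borelRd R d -> measurableTypeR R).
  exact: continuous_measurable_borelRd.
have s1 := slope_le_comp vG (clamp_slope_le ab) G0 (fun t => ler0n _ _).
have s2 := slope_le_comp (@slope_le_enorm R d) (cutoff_slope_le c0) (fun=> ler01) (fun=> ltW c0).
have f01 x : 0 <= (f \o v) x <= b - a.
  rewrite /f /= ge_min lexx orbT andbT le_min (ltW ba) andbT.
  by rewrite le_max lexx orbT.
have g01 x : 0 <= (g \o @enorm R d) x <= 1.
  by rewrite /g /= le_max lexx /= ge_max ler01 /= ge_min lexx.
have H10 x : 0 <= (a <= v x <= b)%R%:R * G x by rewrite mulr_ge0.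
have H20 (x : 'rV[R]_d) : 0 <= (cst c (enorm x)) * (cst 1 x) by rewrite /= mulr1 ltW.
have H10' (x : borelRd R d) : (0 <= ((a <= v x <= b)%R%:R * G x)%:E)%E by rewrite lee_fin.
have s := slope_le_mul s1 s2 f01 g01 H10 H20.
pose u x := f (v x) * g (enorm x).
pose H x := (a <= v x <= b)%R%:R * G x + (b - a) * (c * 1).
have H0 x : 0 <= H x by rewrite /H mulr1 addr_ge0// mulr_ge0// ltW.
have u0 (x : 'rV[R]_d) : 2 * n.+1%:R < enorm x -> u x = 0.
  move=> nx; rewrite /u /g max_l ?mulr0//; rewrite ge_min; apply/orP; right.
  by rewrite subr_le0 /c mulrC ler_pdivlMr// ltW.
have [L [r0 [L0 r00 uL]]] := slope_le_unif s H0 u0.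
have mlay : measurable ([set x | a <= v x <= b] : set (borelRd R d)).
  rewrite (_ : mkset _ = [set x | a <= v x] `&` [set x | v x <= b]).
    by apply: measurableI; [exact: measurable_ge_set mv a|exact: measurable_le_set mv b].
  by apply/seteqP; split=> x /andP.
have mind : measurable_fun setT (fun x : borelRd R d => ((a <= v x <= b)%R%:R : R)).
  rewrite (_ : (fun x => _) = (\1_[set x | a <= v x <= b] : _ -> R)); first exact: measurable_indic.
  by apply/funext => x; rewrite indicE; congr (nat_of_bool _)%:R; apply/idP/idP; rewrite inE.
have mHH : measurable_fun setT (H : borelRd R d -> measurableTypeR R).
  by apply: measurable_funD => //; exact: measurable_funM.
exists u, H, L, r0; split; [split; [|by []]|split; [by split=> //; exact: ltW|split; [|split]]].
- move=> x; have /andP[fx0 fx1] := f01 x; have /andP[gx0 gx1] := g01 x.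
  rewrite /u mulr_ge0//=; apply: le_trans fx1; exact: ler_piMr.
- move=> x; rewrite ltNge => /negP ux; rewrite ltNge; apply/negP => va; apply: ux.
  by rewrite /u /f max_r ?subr_le0// min_l ?mul0r// ltW.
- move=> x bv xn; rewrite /u /f min_r; last by rewrite le_max lerD2r bv.
  rewrite /g min_l ?max_r ?mulr1//.
  have : c * enorm x <= 1 by rewrite /c mulrC ler_pdivrMr// mul1r.
  lra.
- rewrite (_ : (fun x => (H x)%:E) = (fun x => ((a <= v x <= b)%R%:R * G x)%:E + ((b - a) / n.+1%:R)%:E)%E); last first.
    by apply/funext => x; rewrite /H -EFinD mulr1.
  have h1 : measurable_fun setT (fun x : borelRd R d => ((a <= v x <= b)%R%:R * G x)%:E).
    by apply/measurable_EFinP; exact: measurable_funM.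
  have h0 : (0 <= ((b - a) / n.+1%:R)%:E :> \bar R)%E by rewrite lee_fin divr_ge0// ltW.
  rewrite (@ge0_integralD _ _ _ mu setT measurableT _ _ (fun x _ => H10' x) h1 (fun=> fun=> h0) (measurable_cst _)).
  apply: leeD; last first.
    rewrite integral_cst//; apply: le_trans (lee_wpmul2l h0 (probability_le1 mu measurableT)) _.
    by rewrite mule1.
  rewrite [leRHS]integral_mkcond; apply: integral_monotone => x _.
  rewrite patchE; case: ifPn => [/set_mem/= ->|]; first by rewrite mul1r.
  by move=> /negP h; rewrite (_ : (a <= v x <= b) = false) ?mul0r//; apply/negbTE/negP => h'; apply: h; rewrite inE.
Qed.

Lemma probability_tight (e : R) : 0 < e ->
  exists N : nat, forall n, (N <= n)%N ->
    fine (mu [set x | n.+1%:R < enorm x]) < e.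
Proof.
move=> e0.
have mE : measurable_fun setT (@enorm R d : borelRd R d -> measurableTypeR R).
  apply: continuous_measurable_borelRd; exact: continuous_enorm.
pose F n : set (borelRd R d) := [set x | n.+1%:R < enorm x].
have mF n : measurable (F n) by exact: measurable_gt_set mE _.
have F0 : \bigcap_n F n = set0.
  apply/seteqP; split=> x //= Fx.
  have := Fx (Num.trunc (enorm x)) I; rewrite /F /= ltNge => /negP; apply.
  by apply/ltW; exact: truncnS_gt.
have : mu (F n) @[n --> \oo] --> mu (\bigcap_n F n).
  apply: nonincreasing_cvg_mu => //.
  - by apply: le_lt_trans (probability_le1 _ _) _ => //; rewrite ltry.
  - exact: bigcapT_measurable.
  - move=> m k mk; apply/subsetPset => x; rewrite /F /=; apply: le_lt_trans.
    by rewrite ler_nat ltnS.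
rewrite F0 measure0 => /fine_cvgP[_ /cvgrPdist_lt/(_ e e0)[N _ hN]].
exists N => n Nn; have := hN n Nn; rewrite /= sub0r normrN ger0_norm//.
exact: fine_ge0.
Qed.

End Cutoff.

Section Layers.
Context {R : realType} {d : nat} (mu : probability (borelRd R d) R).
Variables (v G : 'rV[R]_d -> R) (a b : R).
Hypotheses (vG : slope_le v G) (G0 : forall x, 0 <= G x)
  (mG : measurable_fun setT (G : borelRd R d -> measurableTypeR R)) (ab : a < b).

Let mv : measurable_fun setT (v : borelRd R d -> measurableTypeR R).
Proof. exact: slope_le_measurable vG. Qed.

Let mge t : measurable ([set x | t <= v x] : set (borelRd R d)).
Proof. exact: measurable_ge_set mv t. Qed.

Let m := fine (mu [set x | b <= v x]).

Let mE : mu [set x | b <= v x] = m%:E.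
Proof. by rewrite fineK// fin_num_measure. Qed.

(** Raising [b'] to [b] turns closed layers into the half-open one, so that consecutive layers
    become disjoint and can be summed, while the cutoff errors tend to 0. *)
Lemma layer_limit (w K e0 : R) : 0 <= w -> 0 < K -> 0 < e0 ->
  (forall e b', 0 < e -> e < e0 -> a < b' -> b' < b ->
    ((w * (b' - a) * (m - e))%:E <=
     K%:E * (\int[mu]_(x in [set x | (a <= v x <= b')%R]) (G x)%:E + e%:E))%E) ->
  ((w * (b - a))%:E * mu [set x | (b <= v x)%R] <=
    K%:E * \int[mu]_(x in [set x | (a <= v x < b)%R]) (G x)%:E)%E.
Proof.
move=> w0 K0 e00 H.
have ba : 0 < b - a by rewrite subr_gt0.
set X := (\int[mu]_(x in [set x | (a <= v x < b)%R]) (G x)%:E)%E.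
have X0 : (0 <= X)%E by apply: integral_ge0 => x _; rewrite lee_fin.
have mlay : measurable ([set x | a <= v x < b] : set (borelRd R d)).
  rewrite (_ : mkset _ = [set x | a <= v x] `&` [set x | v x < b]).
    by apply: measurableI; [exact: mge|exact: measurable_lt_set mv b].
  by apply/seteqP; split=> x /andP.
have [Xoo|Xoo] := eqVneq X +oo%E; first by rewrite Xoo gt0_muley ?lte_fin// leey.
have Xf : X \is a fin_num by rewrite ge0_fin_numE// ltey.
rewrite mE -(fineK Xf) -!EFinM lee_fin; set x := fine X.
have m0 : 0 <= m by exact: fine_ge0.
rewrite leNgt; apply/negP => lt1.
(* [D] is the gap to be contradicted, and [Q] exceeds the coefficient of [e] in the error made at
   [b - e]; with [e * Q <= D / 2] the error cannot fill the gap. *)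
pose D := w * (b - a) * m - K * x; have D0 : 0 < D by rewrite subr_gt0.
pose Q := K + w * (m + (b - a)) + 1.
have Q0 : 0 < Q by rewrite /Q ltr_wpDl// addr_ge0 ?(ltW K0)// mulr_ge0// addr_ge0// ltW.
pose e := Num.min (Num.min (e0 / 2) ((b - a) / 2)) (D / (2 * Q)).
have e_gt0 : 0 < e by rewrite !lt_min !divr_gt0// mulr_gt0.
have ee0 : e < e0.
  apply: (@le_lt_trans _ _ (e0 / 2)); first by rewrite /e !ge_min lexx.
  by rewrite ltr_pdivrMr// ltr_pMr// ltr1n.
have eba : e < b - a.
  apply: (@le_lt_trans _ _ ((b - a) / 2)); first by rewrite /e !ge_min lexx orbT.
  by rewrite ltr_pdivrMr// ltr_pMr// ltr1n.
have eD : e * Q <= D / 2.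
  rewrite -ler_pdivlMr//; apply: (@le_trans _ _ (D / (2 * Q))).
    by rewrite /e !ge_min lexx !orbT.
  by rewrite invfM mulrA.
have b1 : a < b - e by lra.
have b2 : b - e < b by lra.
have := H e (b - e) e_gt0 ee0 b1 b2.
have Xle : (\int[mu]_(x in [set x | (a <= v x <= b - e)%R]) (G x)%:E <= X)%E.
  rewrite /X [leLHS]integral_mkcond [leRHS]integral_mkcond.
  apply: integral_monotone => y _; rewrite !patchE.
  case: ifPn => [/set_mem/= /andP[h1 h2]|_]; last by case: ifP => _; rewrite ?lee_fin.
  by rewrite mem_set//= h1 (le_lt_trans h2).
move=> /le_trans/(_ (lee_wpmul2l _ (leeD2r e%:E Xle))).
rewrite lee_fin => /(_ (ltW K0)).
rewrite -(fineK Xf) -EFinD -EFinM lee_fin -/x => h.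
have : w * (b - a) * m - K * x <= e * (K + w * (m + (b - a))).
  have : 0 <= w * (e * e) by rewrite !mulr_ge0// ltW.
  nra.
rewrite -/D; have : e * (K + w * (m + (b - a))) <= e * Q.
  by rewrite ler_wpM2l ?(ltW e_gt0)// /Q lerDl.
lra.
Qed.

Let cut_mass (b' e : R) (n : nat) : b' < b ->
  fine (mu [set x | n.+1%:R < enorm x]) < e ->
  m - e <= fine (mu ([set x | b' <= v x] `&` [set x | enorm x <= n.+1%:R])).
Proof.
move=> b'b he.
have mN : measurable_fun setT (@enorm R d : borelRd R d -> measurableTypeR R).
  apply: continuous_measurable_borelRd; exact: continuous_enorm.
have mle := measurable_le_set mN n.+1%:R; have mgt := measurable_gt_set mN n.+1%:R.
have mI : measurable ([set x | b' <= v x] `&` [set x | enorm x <= n.+1%:R] : set (borelRd R d)).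
  exact: measurableI.
rewrite lerBlDr; apply: (@le_trans _ _ (fine (mu ([set x | b' <= v x] `&` [set x | enorm x <= n.+1%:R])) + fine (mu [set x | n.+1%:R < enorm x]))); last first.
  by rewrite lerD2l ltW.
rewrite -lee_fin EFinD !fineK ?fin_num_measure//.
apply: le_trans (measureU2 _ mI mgt).
apply: le_measure; rewrite ?inE//; first exact: measurableU.
move=> x /= bx; have [xn|xn] := leP (enorm x) n.+1%:R; last by right.
by left; split=> //=; exact: le_trans (ltW b'b) bx.
Qed.

Let cut_n (e c : R) : 0 < e -> 0 <= c -> exists n : nat,
  fine (mu [set x | n.+1%:R < enorm x]) < e /\ c / n.+1%:R <= e.
Proof.
move=> e0 c0; have [N hN] := probability_tight mu e0.
pose k := Num.trunc (c / e).
exists (maxn N k); split; first by apply: hN; rewrite leq_maxl.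
rewrite ler_pdivrMr// mulrC -ler_pdivrMr//.
apply: le_trans (ltW (truncnS_gt _)) _.
by rewrite ler_nat ltnS leq_maxr.
Qed.

Lemma isoperimetric_layer (w : R) : 0 <= w ->
  (forall S : set (borelRd R d), measurable S -> S `<=` [set x | a < v x] ->
    (w%:E * mu S <= boundary_measure mu S)%E) ->
  ((w * (b - a))%:E * mu [set x | (b <= v x)%R] <=
    4%:E * \int[mu]_(x in [set x | (a <= v x < b)%R]) (G x)%:E)%E.
Proof.
move=> w0 H; apply: (@layer_limit w 4 1) => // e b' e0 _ ab' b'b.
have ba : 0 <= b' - a by rewrite subr_ge0 ltW.
have [n [n1 n2]] := cut_n e0 ba.
have [u [Hs [L [r0 [[u0M [uH [H0 mH]]] [[L0 [r00 uL]] [ua [ub uint]]]]]]]] :=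
  layer_cutoff mu n vG G0 mG ab'.
have mu_ := slope_le_measurable uH.
have rate : (w%:E * \int[mu]_x (u x)%:E <= 4%:E * \int[mu]_x (Hs x)%:E)%E.
  apply: (isoperimetric_rate_Lipschitz u0M uH H0 mH L0 r00 uL) => // t t0.
  apply: H; first exact: measurable_gt_set mu_ t.
  by move=> x /= tu; apply: ua; exact: le_lt_trans tu.
have mI : measurable ([set x | b' <= v x] `&` [set x | enorm x <= n.+1%:R] : set (borelRd R d)).
  apply: measurableI; first exact: mge.
  apply: measurable_le_set; apply: continuous_measurable_borelRd; exact: continuous_enorm.
apply: (@le_trans _ _ (w%:E * \int[mu]_x (u x)%:E)%E).
  rewrite -mulrA EFinM; apply: lee_wpmul2l; first by rewrite lee_fin.
  apply: (@le_trans _ _ (\int[mu]_(x in [set x | (b' <= v x)%R] `&` [set x | (enorm x <= n.+1%:R)%R]) (cst (b' - a)%:E x))%E).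
    rewrite integral_cst// EFinM; apply: lee_wpmul2l; first by rewrite lee_fin.
    have := cut_mass b'b n1; rewrite -lee_fin fineK//; exact: fin_num_measure.
  rewrite integral_mkcond; apply: integral_monotone => x _; rewrite patchE.
  case: ifPn => [/set_mem[/= h1 h2]|_]; first by rewrite ub.
  by rewrite lee_fin; have /andP[] := u0M x.
apply: le_trans rate _; apply: lee_wpmul2l => //.
by apply: le_trans uint _; apply: leeD => //; rewrite lee_fin.
Qed.

(** Every level set of the cutoff function has mass at least m/2, so the gain is at least
    [m / 2 * - ln p0]. The tail hypothesis bounds the loss by m/8, which half of the gain absorbs
    because [- ln p0 >= 1/2]; what remains is [m / 4 * - ln p0]. *)
Lemma log_concave_layer (r : R) : log_concave mu -> 0 < r ->
  let p0 := fine (mu [set x | a < v x]) in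
  0 < p0 -> p0 <= 2^-1 -> 
  fine (mu [set x | r <= enorm x]) <= m / 16 ->
  ((- ln p0 / (16 * r) * (b - a))%:E * mu [set x | (b <= v x)%R] <=
    \int[mu]_(x in [set x | (a <= v x < b)%R]) (G x)%:E)%E.
Proof.
move=> lc r0 p0 p00 p02 hr.
have lnp0 : 0 <= - ln p0 by rewrite oppr_ge0 ln_le0//; lra.
have m0 : 0 <= m by exact: fine_ge0.
have mlt := measurable_gt_set mv a.
have [mz|mn0] := eqVneq m 0.
  by rewrite mE mz mule0; apply: integral_ge0 => x _; rewrite lee_fin.
have m1 : 0 < m by rewrite lt_neqAle eq_sym mn0.
have mp0 : m <= p0.
  apply: fine_le; rewrite ?fin_num_measure//.
  by apply: le_measure; rewrite ?inE// => x /=; exact: lt_le_trans.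
suff H : (((- ln p0 / (16 * r)) * (b - a))%:E * mu [set x | (b <= v x)%R] <=
    1%:E * \int[mu]_(x in [set x | (a <= v x < b)%R]) (G x)%:E)%E by rewrite mul1e in H.
have w0 : 0 <= - ln p0 / (16 * r) by rewrite divr_ge0// mulr_ge0// ltW.
have e00 : 0 < m / 2 by rewrite divr_gt0.
apply: (layer_limit w0 ltr01 e00) => e b' e0 em ab' b'b; rewrite mul1e.
have ba : 0 <= b' - a by rewrite subr_ge0 ltW.
have [n [n1 n2]] := cut_n e0 ba.
have [u [Hs [L [rr [[u0M [uH [H0 mH]]] [[L0 [rr0 uL]] [ua [ub uint]]]]]]]] :=
  layer_cutoff mu n vG G0 mG ab'.
have mu_ := slope_le_measurable uH.
have mN : measurable_fun setT (@enorm R d : borelRd R d -> measurableTypeR R).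
  apply: continuous_measurable_borelRd; exact: continuous_enorm.
have mI : measurable ([set x | b' <= v x] `&` [set x | enorm x <= n.+1%:R] : set (borelRd R d)).
  by apply: measurableI; [exact: mge|exact: measurable_le_set].
have cm := cut_mass b'b n1.
set br := fine (mu [set x | enorm x < r]).
have brE : br = 1 - fine (mu [set x | r <= enorm x]).
  rewrite /br (_ : [set x | enorm x < r] = ~` [set x | r <= enorm x]).
    rewrite probability_setC ?fineB// ?fin_num_measure//; exact: measurable_ge_set mN r.
  by apply/seteqP; split=> x /=; [rewrite ltNge => /negP|rewrite ltNge => /negP].
have br1 : 1 - m / 16 <= br by rewrite brE; lra.
have br0 : 0 < br by lra.
have lnbr : - (m / 8) <= ln br.
  have : ln (br^-1) <= br^-1 - 1.
    have bri : 0 < br^-1 by rewrite invr_gt0.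
    have := @le_ln1Dx R (br^-1 - 1); rewrite addrCA subrr addr0; apply; lra.
  rewrite lnV ?posrE// => h.
  have : br^-1 - 1 <= m / 8.
    rewrite lerBlDr -(ler_pM2r br0) mulVf ?lt0r_neq0//.
    have : (m / 8 + 1) * (1 - m / 16) <= (m / 8 + 1) * br by rewrite ler_wpM2l//; lra.
    apply: le_trans; nra.
  lra.
have ln2 : 2^-1 <= - ln p0.
  have : ln p0 <= p0 - 1.
    by have := @le_ln1Dx R (p0 - 1); rewrite addrCA subrr addr0; apply; lra.
  lra.
pose c := m / 4 * - ln p0.
have c0 : 0 <= c by rewrite mulr_ge0// divr_ge0.
have rate : (((b' - a) * c)%:E <= (4 * r)%:E * \int[mu]_x (Hs x)%:E)%E.
  apply: (log_concave_rate_Lipschitz u0M uH H0 mH L0 rr0 uL lc r0 c0 br0) => t t0 tM p.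
  have mt := measurable_gt_set mu_ t.
  have pp0 : p <= p0.
    apply: fine_le; rewrite ?fin_num_measure//.
    by apply: le_measure; rewrite ?inE// => x /= tu; apply: ua; exact: le_lt_trans tu.
  have mp : m / 2 <= p.
    apply: (@le_trans _ _ (fine (mu ([set x | b' <= v x] `&` [set x | enorm x <= n.+1%:R])))).
      by apply: le_trans cm; lra.
    apply: fine_le; rewrite ?fin_num_measure//.
    by apply: le_measure; rewrite ?inE// => x [/= h1 h2]; rewrite ub.
  have p_gt0 : 0 < p by lra.
  split => //; first by lra.
  have lnp : ln p <= ln p0 by rewrite ler_ln ?posrE.
  have h1 : m / 2 * - ln p0 <= p * - ln p.
    by apply: ler_pM => //; [lra|rewrite lerN2].
  have h2 : m / 8 <= m / 4 * - ln p0 by nra.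
  rewrite /c -/br; lra.
have step : ((- ln p0 / (16 * r) * (b' - a) * (m - e))%:E <= \int[mu]_x (Hs x)%:E)%E.
  apply: (@le_trans _ _ ((4 * r)^-1%:E * ((b' - a) * c)%:E)%E); last first.
    by rewrite lee_pdivrMl// mulr_gt0.
  rewrite -EFinM lee_fin /c.
  rewrite (_ : _^-1 * _ = - ln p0 / (16 * r) * (b' - a) * m); last first.
    by field; rewrite lt0r_neq0.
  rewrite ler_wpM2l//; last by lra.
  by rewrite mulr_ge0.
by apply: le_trans step _; apply: le_trans uint _; apply: leeD => //; rewrite lee_fin.
Qed.

End Layers.

(** * Dyadic sums and the Poincare inequality *)

Section Median.
Context d (T : measurableType d) {R : realType} (mu : probability T R).
Variables (f : T -> R).
Hypothesis mf : measurable_fun setT f.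

Let med := inf [set t : R | (mu [set x | (t < f x)%R] <= (2^-1)%:E)%E].

Let has_inf_med : has_inf [set t : R | (mu [set x | (t < f x)%R] <= (2^-1)%:E)%E].
Proof.
have h2 : 0 < 2^-1 :> R by rewrite invr_gt0.
split.
  pose F n := [set x | n%:R < f x].
  have F0 : \bigcap_n F n = set0.
    apply/seteqP; split=> x //= Fx.
    have := Fx (Num.trunc (f x)).+1 I; rewrite /F /= ltNge => /negP; apply.
    by apply/ltW; exact: truncnS_gt.
  have : mu (F n) @[n --> \oo] --> mu (\bigcap_n F n).
    apply: nonincreasing_cvg_mu => //.
    - by apply: le_lt_trans (probability_le1 _ _) _; rewrite ?ltry//; exact: measurable_gt_set.
    - by move=> n; exact: measurable_gt_set.
    - by apply: bigcapT_measurable => n; exact: measurable_gt_set.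
    - move=> m k mk; apply/subsetPset => x; rewrite /F /=; apply: le_lt_trans.
      by rewrite ler_nat.
  rewrite F0 measure0 => /fine_cvgP[_ /cvgrPdist_lt/(_ _ h2)[N _ /(_ N (leqnn N)) /=]].
  rewrite sub0r normrN ger0_norm ?fine_ge0// => h.
  exists N%:R => /=; rewrite -[leLHS]fineK ?fin_num_measure//; last exact: measurable_gt_set.
  by rewrite lee_fin; exact: ltW.
pose F n := [set x | - n%:R < f x].
have F0 : \bigcup_n F n = setT.
  apply/seteqP; split=> x //= _; exists (Num.trunc (- f x)).+1 => //.
  by rewrite /F /= ltrNl; exact: truncnS_gt.
have mF n : measurable (F n) by exact: measurable_gt_set.
have : mu (F n) @[n --> \oo] --> mu (\bigcup_n F n).
  apply: nondecreasing_cvg_mu => //; first exact: bigcupT_measurable.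
  move=> m k mk; apply/subsetPset => x; rewrite /F /=; apply: le_lt_trans.
  by rewrite lerN2 ler_nat.
rewrite F0 probability_setT => /fine_cvgP[_ /cvgrPdist_lt/(_ _ h2)[N _ /(_ N (leqnn N)) /=]].
move=> h; exists (- N%:R) => t /= ht; rewrite leNgt; apply/negP => tN.
have : fine (mu (F N)) <= 2^-1.
  rewrite -lee_fin fineK ?fin_num_measure//; apply: le_trans ht.
  apply: le_measure; rewrite ?inE//; first exact: measurable_gt_set.
  by move=> x; rewrite /F /=; exact: lt_trans.
by move: h; rewrite ltr_norml => /andP[_]; lra.
Qed.

Lemma median_gt_le : (mu [set x | (med < f x)%R] <= (2^-1)%:E)%E.
Proof.
pose F n := [set x | med + n.+1%:R^-1 < f x].
have FE : \bigcup_n F n = [set x | med < f x].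
  apply/seteqP; split=> x /=.
    by move=> [n _]; rewrite /F /=; apply: lt_trans; rewrite ltrDl invr_gt0.
  move=> h; have h0 : 0 < f x - med by rewrite subr_gt0.
  exists (Num.trunc (f x - med)^-1) => //; rewrite /F /= -ltrBrDl.
  rewrite invf_plt ?posrE//; exact: truncnS_gt.
have mF n : measurable (F n) by exact: measurable_gt_set.
have : mu (F n) @[n --> \oo] --> mu (\bigcup_n F n).
  apply: nondecreasing_cvg_mu => //; first exact: bigcupT_measurable.
  move=> m k mk; apply/subsetPset => x; rewrite /F /=; apply: le_lt_trans.
  by rewrite lerD2l lef_pV2 ?posrE// ler_nat.
rewrite FE => cv; rewrite -(cvg_lim _ cv)//; apply: lime_le; first by apply/cvg_ex; eexists; exact: cv.
apply: nearW => n; have n0 : 0 < n.+1%:R^-1 :> R by rewrite invr_gt0.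
have /= [t ht tm] := inf_adherent n0 has_inf_med.
apply: le_trans ht; apply: le_measure; rewrite ?inE//; first exact: measurable_gt_set.
by move=> x; rewrite /F /=; exact: lt_trans.
Qed.

Lemma median_lt_le : (mu [set x | (f x < med)%R] <= (2^-1)%:E)%E.
Proof.
pose F n := [set x | f x <= med - n.+1%:R^-1].
have FE : \bigcup_n F n = [set x | f x < med].
  apply/seteqP; split=> x /=.
    by move=> [n _]; rewrite /F /= => /le_lt_trans; apply; rewrite ltrBlDr ltrDl invr_gt0.
  move=> h; have h0 : 0 < med - f x by rewrite subr_gt0.
  exists (Num.trunc (med - f x)^-1) => //; rewrite /F /= lerBrDr -lerBrDl ltW//.
  rewrite invf_plt ?posrE//; exact: truncnS_gt.
have mF n : measurable (F n) by exact: measurable_le_set.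
have : mu (F n) @[n --> \oo] --> mu (\bigcup_n F n).
  apply: nondecreasing_cvg_mu => //; first exact: bigcupT_measurable.
  move=> m k mk; apply/subsetPset => x; rewrite /F /= => /le_trans; apply.
  by rewrite lerD2l lerN2 lef_pV2 ?posrE// ler_nat.
rewrite FE => cv; rewrite -(cvg_lim _ cv)//; apply: lime_le; first by apply/cvg_ex; eexists; exact: cv.
apply: nearW => n; have n0 : 0 < n.+1%:R^-1 :> R by rewrite invr_gt0.
have mG : measurable [set x | med - n.+1%:R^-1 < f x] by exact: measurable_gt_set.
have -> : F n = ~` [set x | med - n.+1%:R^-1 < f x].
  by apply/seteqP; split=> x; rewrite /F /= leNgt => /negP.
rewrite probability_setC// -(fineK (fin_num_measure mu _ mG)) -EFinB lee_fin.
rewrite lerBlDr -lerBlDl (_ : 1 - 2^-1 = 2^-1); last by lra.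
rewrite leNgt; apply/negP => h.
have : med <= med - n.+1%:R^-1.
  apply: ge_inf; first by have [] := has_inf_med.
  by rewrite /= -(fineK (fin_num_measure mu _ mG)) lee_fin ltW.
by rewrite leNgt ltrBlDr ltrDl n0.
Qed.

End Median.

Section Dyadic.
Context {R : realType} {d : nat} (mu : probability (borelRd R d) R).

(* Layers across which the mass drops by a factor 40 are excluded: the dyadic sums do not need them. *)
Definition layer_rate (w : R -> R) := forall (v G : 'rV[R]_d -> R) (a b s : R),
  slope_le v G -> (forall x, 0 <= G x) ->
  measurable_fun setT (G : borelRd R d -> measurableTypeR R) -> a < b ->
  2 <= s -> (mu [set x | (a < v x)%R] <= (s^-1)%:E)%E ->
  fine (mu [set x | a < v x]) / 40 <= fine (mu [set x | b <= v x]) ->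
  ((w s * (b - a))%:E * mu [set x | (b <= v x)%R] <=
    \int[mu]_(x in [set x | (a <= v x < b)%R]) (G x)%:E)%E.

Variable (w : R -> R).
Hypothesis hw : layer_rate w.
Variables (v G E : 'rV[R]_d -> R).
Hypotheses (vG : slope_le v G) (G0 : forall x, 0 <= G x)
  (mG : measurable_fun setT (G : borelRd R d -> measurableTypeR R))
  (E0 : forall x, 0 <= E x)
  (mE : measurable_fun setT (E : borelRd R d -> measurableTypeR R)).

Let mv : measurable_fun setT (v : borelRd R d -> measurableTypeR R).
Proof. exact: slope_le_measurable vG. Qed.

Let mge t : measurable ([set x | t <= v x] : set (borelRd R d)).
Proof. exact: measurable_ge_set mv t. Qed.

Let mlay a b : measurable ([set x | a <= v x < b] : set (borelRd R d)).
Proof.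
rewrite (_ : mkset _ = [set x | a <= v x] `&` [set x | v x < b]).
  by apply: measurableI; [exact: mge|exact: measurable_lt_set mv b].
by apply/seteqP; split=> x /andP.
Qed.

Lemma dyadic_step (a b s W W' : R) : a < b -> 2 <= s ->
  (mu [set x | (a < v x)%R] <= (s^-1)%:E)%E -> 0 < w s -> 0 < W -> 0 <= W' ->
  W' <= 20 * W ->
  (forall x, a <= v x -> v x < b -> W' / (w s * (b - a)) * G x <= W / 2 + E x) ->
  (W'%:E * mu [set x | (b <= v x)%R] <=
   (W / 2)%:E * mu [set x | (a <= v x)%R] +
   \int[mu]_(x in [set x | (a <= v x < b)%R]) (E x)%:E)%E.
Proof.
move=> ab s2 ps w0 W0 W'0 WW' H.
have EE0 : (0 <= \int[mu]_(x in [set x | (a <= v x < b)%R]) (E x)%:E)%E.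
  by apply: integral_ge0 => x _; rewrite lee_fin.
have fm t := fineK (fin_num_measure mu _ (mge t)).
have mgt := measurable_gt_set mv a.
(* When the mass drops by the factor 40, the growth bound [W' <= 20 * W] already yields 20/40 = 1/2,
   with no gradient term. *)
have [h|h] := leP (fine (mu [set x | a < v x]) / 40) (fine (mu [set x | b <= v x])); last first.
  apply: le_trans (leeDl _ EE0).
  rewrite -(fm a) -(fm b) -!EFinM lee_fin.
  have : fine (mu [set x | a < v x]) <= fine (mu [set x | a <= v x]).
    apply: fine_le; rewrite ?fin_num_measure//.
    by apply: le_measure; rewrite ?inE// => x /= /ltW.
  move=> h1; apply: le_trans (ler_wpM2l W'0 (ltW h)) _.
  have p0 : 0 <= fine (mu [set x | a < v x]) by exact: fine_ge0.
  have h2 : W' * fine (mu [set x | a < v x]) <= 20 * W * fine (mu [set x | a < v x]).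
    by rewrite ler_wpM2r.
  have h3 : W * fine (mu [set x | a < v x]) <= W * fine (mu [set x | a <= v x]).
    by rewrite ler_wpM2l// ltW.
  lra.
have := hw vG G0 mG ab s2 ps h.
have wb : 0 < w s * (b - a) by rewrite mulr_gt0// subr_gt0.
have k0 : 0 <= W' / (w s * (b - a)) by rewrite divr_ge0// ltW.
have mGE : measurable_fun ([set x | (a <= v x < b)%R] : set (borelRd R d)) (fun x : borelRd R d => (G x)%:E).
  by apply: measurable_funTS; exact/measurable_EFinP.
have mEE : measurable_fun ([set x | (a <= v x < b)%R] : set (borelRd R d)) (fun x : borelRd R d => (E x)%:E).
  by apply: measurable_funTS; exact/measurable_EFinP.
have k0E : (0 <= (W' / (w s * (b - a)))%:E :> \bar R)%E by rewrite lee_fin.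
move=> /(lee_wpmul2l k0E); rewrite muleA -EFinM divfK ?lt0r_neq0// => /le_trans; apply.
rewrite -ge0_integralZl_EFin//; last by move=> x _; rewrite lee_fin.
apply: (@le_trans _ _ (\int[mu]_(x in [set x | (a <= v x < b)%R]) ((W / 2)%:E + (E x)%:E))%E).
  by apply: integral_monotone => x /= /andP[h1 h2]; rewrite -EFinM -EFinD lee_fin; exact: H.
have W20 : (0 <= (W / 2)%:E :> \bar R)%E by rewrite lee_fin divr_ge0// ltW.
rewrite ge0_integralD//; last by move=> x _; rewrite lee_fin.
apply: leeD => //; rewrite integral_cst//; apply: lee_wpmul2l => //.
by apply: le_measure; rewrite ?inE// => x /= /andP[].
Qed.

Lemma dyadic_sum (t W : nat -> R) (n : nat) : (forall j, t j < t j.+1) ->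
  (forall j, 0 <= W j) ->
  (forall j, (j < n)%N -> ((W j.+1)%:E * mu [set x | (t j.+1 <= v x)%R] <=
     (W j / 2)%:E * mu [set x | (t j <= v x)%R] +
     \int[mu]_(x in [set x | (t j <= v x < t j.+1)%R]) (E x)%:E)%E) ->
  (\sum_(j < n) (W j.+1)%:E * mu [set x | (t j.+1 <= v x)%R] <=
    (W 0)%:E * mu [set x | (t 0 <= v x)%R] +
    2%:E * \int[mu]_(x in [set x | (t 0 <= v x < t n)%R]) (E x)%:E)%E.
Proof.
move=> tS W0 H.
have A0 j : (0 <= (W j)%:E * mu [set x | (t j <= v x)%R])%E by rewrite mule_ge0// lee_fin.
have AE j : ((W j)%:E * mu [set x | (t j <= v x)%R])%E =
    (W j * fine (mu [set x | t j <= v x]))%:E.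
  by rewrite EFinM fineK// fin_num_measure.
(* The induction keeps a second copy of the last term: two copies of the next term cost, by the
   halving hypothesis, one copy of the present one plus twice the integral over the layer. *)
suff : (\sum_(j < n) (W j.+1)%:E * mu [set x | (t j.+1 <= v x)%R] +
    (W n)%:E * mu [set x | (t n <= v x)%R] <=
    (W 0)%:E * mu [set x | (t 0 <= v x)%R] +
    2%:E * \int[mu]_(x in [set x | (t 0 <= v x < t n)%R]) (E x)%:E)%E.
  by apply: le_trans; exact: leeDl.
have t0n k : t 0 <= t k by elim: k => // k /le_trans; apply; exact: ltW.
elim: n H => [|n IH] H.
  rewrite big_ord0 add0e; apply: leeDl; apply: mule_ge0 => //.
  by apply: integral_ge0 => x _; rewrite lee_fin.
rewrite big_ord_recr /=.
have := IH (fun j jn => H j (ltnW jn)).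
have := H n (ltnSn n).
set a := (\sum_(j < n) _)%E; set X := (\int[mu]_(x in _) _)%E; set Y := (\int[mu]_(x in _) _)%E.
set Z := (\int[mu]_(x in _) _)%E.
have -> : Z = (Y + X)%E.
  rewrite /Z /Y /X -ge0_integral_setU//.
  - congr (integral _ _ _); apply/seteqP; split=> x /=.
      move=> /andP[h1 h2]; have [h|h] := ltP (v x) (t n); first by left; apply/andP.
      by right; apply/andP.
    move=> [/= /andP[h1 h2]|/= /andP[h1 h2]]; apply/andP; split=> //.
      exact: lt_trans h2 (tS n).
    exact: le_trans (t0n n) h1.
  - by apply: measurable_funTS; exact/measurable_EFinP.
  - by move=> x _; rewrite lee_fin.
  - apply/disj_setPS => x [/= /andP[_ h1] /andP[h2 _]].
    by move: h1; rewrite ltNge h2.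
have X0 : (0 <= X)%E by apply: integral_ge0 => x _; rewrite lee_fin.
have Y0 : (0 <= Y)%E by apply: integral_ge0 => x _; rewrite lee_fin.
have aE : a = (\sum_(j < n) (W j.+1 * fine (mu [set x | t j.+1 <= v x])))%:E.
  by rewrite /a -sumEFin; apply: eq_bigr => j _; exact: AE.
have fm := fineK (fin_num_measure mu _ (mge (t n))).
rewrite !AE aE -{1}fm -EFinM.
have [S|S] := eqVneq (Y + X)%E +oo%E.
  by move=> _ _; rewrite S gt0_muley ?lte_fin// addey// leey.
have Sf : (Y + X < +oo)%E by rewrite ltey.
have Xf : X \is a fin_num by rewrite ge0_fin_numE// (le_lt_trans _ Sf)// leeDr.
have Yf : Y \is a fin_num by rewrite ge0_fin_numE// (le_lt_trans _ Sf)// leeDl.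
rewrite -(fineK Xf) -(fineK Yf) -!EFinD !lee_fin; lra.
Qed.

End Dyadic.

Section SimpleIntegral.
Context d (T : measurableType d) {R : realType} (mu : probability T R).

Lemma integral_const_add_indic_sum (c0 : R) (c : nat -> R) (A : nat -> set T) (n : nat) :
  0 <= c0 -> (forall j, 0 <= c j) -> (forall j, measurable (A j)) ->
  (\int[mu]_x (c0 + \sum_(j < n) c j * \1_(A j) x)%:E =
   c0%:E + \sum_(j < n) (c j)%:E * mu (A j))%E.
Proof.
move=> c00 cp mA.
have mind j : measurable_fun setT (fun x => (c j)%:E * (\1_(A j) x)%:E)%E.
  by apply: measurable_funeM; apply/measurable_EFinP; exact: measurable_indic.
have p0 j x : (0 <= (c j)%:E * (\1_(A j) x)%:E)%E by rewrite mule_ge0// lee_fin.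
transitivity (\int[mu]_x (c0%:E + \sum_(j < n) (c j)%:E * (\1_(A j) x)%:E))%E.
  by apply: eq_integral => x _; rewrite EFinD -sumEFin.
have c0E : (0 <= c0%:E :> \bar R)%E by rewrite lee_fin.
have S0 x : (0 <= \sum_(j < n) (c j)%:E * (\1_(A j) x)%:E)%E by apply: sume_ge0 => j _; exact: p0.
have mS : measurable_fun setT (fun x => \sum_(j < n) (c j)%:E * (\1_(A j) x)%:E)%E.
  by apply: emeasurable_sum => j; exact: mind.
rewrite (@ge0_integralD _ _ _ mu setT measurableT _ _ (fun _ _ => c0E) (measurable_cst _) (fun x _ => S0 x) mS).
congr (_ + _)%E.
  rewrite integral_cst// [X in (_ * X)%E](_ : _ = 1%E) ?mule1//; exact: probability_setT.
rewrite ge0_integral_sum//; apply: eq_bigr => j _.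
rewrite ge0_integralZl_EFin//; first by rewrite integral_indic// setIT.
by apply/measurable_EFinP; exact: measurable_indic.
Qed.

End SimpleIntegral.

Section Cheeger.
Context {R : realType} {d : nat} (mu : probability (borelRd R d) R).
Variable (w : R -> R).
Hypotheses (hw : layer_rate mu w) (w0 : 0 < w 2).

(* The truncation at [M] makes the dyadic sum over the levels [M / 2 ^ n, ..., M] start from a term that vanishes as [n] tends to infinity. *)
Lemma truncated_cheeger (v G : 'rV[R]_d -> R) (M : R) : slope_le v G ->
  (forall x, 0 <= G x) ->
  measurable_fun setT (G : borelRd R d -> measurableTypeR R) ->
  (mu [set x | (0 < v x)%R] <= (2^-1)%:E)%E -> 0 < M ->
  (\int[mu]_x ((Num.min (Num.max (v x) 0) M) ^+ 2)%:E <=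
    (64 / w 2 ^+ 2)%:E * \int[mu]_(x in [set x | (0 < v x < M)%R]) (G x ^+ 2)%:E)%E.
Proof.
move=> vG G0 mG vhalf M0.
have mv := slope_le_measurable vG.
have mge t := measurable_ge_set mv t.
pose E x := 8 / w 2 ^+ 2 * G x ^+ 2.
have E0 x : 0 <= E x by rewrite mulr_ge0// ?divr_ge0 ?sqr_ge0.
have mE : measurable_fun setT (E : borelRd R d -> measurableTypeR R).
  by apply: measurable_funM => //; exact: measurable_funX.
set X := (\int[mu]_(x in [set x | (0 < v x < M)%R]) (G x ^+ 2)%:E)%E.
have X0 : (0 <= X)%E by apply: integral_ge0 => x _; rewrite lee_fin sqr_ge0.
(* 64 is 4 * 2 * 8: the pointwise majorant has coefficient 4, the dyadic sum doubles, and [E]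
   carries 8. The lowest level contributes once by itself and twice with coefficient 4, which makes
   9. *)
suff H (n : nat) : (\int[mu]_x ((Num.min (Num.max (v x) 0) M) ^+ 2)%:E <=
    (9 * (M / 2 ^+ n) ^+ 2)%:E + (64 / w 2 ^+ 2)%:E * X)%E.
  apply/lee_addgt0Pr => e e0; have M9 : 0 < e / (9 * M ^+ 2) by rewrite divr_gt0// mulr_gt0// exprn_gt0.
  have [n hn] : exists n : nat, (e / (9 * M ^+ 2))^-1 < n%:R.
    by exists (Num.trunc (e / (9 * M ^+ 2))^-1).+1; exact: truncnS_gt.
  apply: le_trans (H n) _; rewrite addeC leeD2l// lee_fin.
  have n2 : n%:R <= 2 ^+ n :> R by rewrite -natrX ler_nat ltnW// ltn_expl.
  have p2 : 1 <= 2 ^+ n :> R by apply: exprn_ege1; rewrite ler1n.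
  have i1 : (2 ^+ n)^-1 <= e / (9 * M ^+ 2).
    have P0 : 0 < 2 ^+ n :> R by exact: lt_le_trans ltr01 p2.
    by rewrite invf_ple ?posrE//; exact: le_trans (ltW hn) n2.
  have i2 : (2 ^+ n)^-1 <= 1 :> R by rewrite invf_le1// (lt_le_trans ltr01 p2).
  have i0 : 0 <= (2 ^+ n)^-1 :> R by rewrite invr_ge0; exact: le_trans ler01 p2.
  rewrite exprMn mulrA -ler_pdivlMl ?mulr_gt0 ?exprn_gt0// mulrC expr2.
  by apply: le_trans i1; exact: ler_piMr.
pose t j : R := M / 2 ^+ n * 2 ^+ j.
have s0 : 0 < M / 2 ^+ n by rewrite divr_gt0// exprn_gt0.
have t0 j : 0 < t j by rewrite mulr_gt0// exprn_gt0.
have tS j : t j.+1 = 2 * t j by rewrite /t exprS; ring.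
have tlt j : t j < t j.+1 by rewrite tS; have := t0 j; lra.
have tn : t n = M by rewrite /t divfK// lt0r_neq0// exprn_gt0.
pose W j := t j ^+ 2.
have W0 j : 0 <= W j by exact: sqr_ge0.
have step j : ((W j.+1)%:E * mu [set x | (t j.+1 <= v x)%R] <=
     (W j / 2)%:E * mu [set x | (t j <= v x)%R] +
     \int[mu]_(x in [set x | (t j <= v x < t j.+1)%R]) (E x)%:E)%E.
  apply: (dyadic_step hw vG G0 mG E0 mE (tlt j) (lexx 2) _ w0).
  - apply: le_trans vhalf; apply: le_measure; rewrite ?inE.
    + exact: measurable_gt_set mv _.
    + exact: measurable_gt_set mv _.
    + by move=> x /=; apply: lt_trans; exact: t0.
  - by rewrite exprn_gt0.
  - exact: W0.
  - by rewrite /W tS exprMn; have := W0 j; rewrite /W; lra.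
  move=> x _ _; rewrite /W tS /E.
  have tj := lt0r_neq0 (t0 j); have w2 := lt0r_neq0 w0.
  rewrite (_ : 2 * t j - t j = t j); last by ring.
  rewrite (_ : (2 * t j) ^+ 2 / (w 2 * t j) = 4 * (t j / w 2)); last first.
    by field; rewrite w2 tj.
  (* Young's inequality [4 t g <= t^2 / 2 + 8 g^2] with [g = G x / w 2]; this is the origin of the 8
     in [E]. *)
  have := sqr_ge0 (t j - 4 * (G x / w 2)).
  rewrite (_ : 8 / w 2 ^+ 2 * G x ^+ 2 = 8 * (G x / w 2) ^+ 2); last first.
    by field; rewrite lt0r_neq0.
  rewrite (_ : 4 * (t j / w 2) * G x = 4 * t j * (G x / w 2)); last by ring.
  nra.
have sum := dyadic_sum (mu := mu) vG E0 mE tlt W0 (fun j (_ : (j < n)%N) => step j).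
(* At a point where [v >= t 0], the truncated value is at most twice the highest level [t k]
   reached, so one term [4 * W k] of the sum suffices. *)
apply: (@le_trans _ _ (\int[mu]_x (t 0 ^+ 2 + \sum_(j < n.+1) 4 * W j * \1_[set x | t j <= v x] x)%:E)%E).
  apply: integral_monotone => x _; rewrite lee_fin.
  set u := Num.min _ _.
  have u0 : 0 <= u by rewrite /u le_min (ltW M0) andbT le_max lexx orbT.
  have term j : 0 <= 4 * W j * \1_[set x | t j <= v x] x :> R by apply: mulr_ge0; [apply: mulr_ge0|rewrite indicE].
  have sum0 k (P : pred 'I_k) : 0 <= \sum_(j < k | P j) 4 * W j * \1_[set x | t j <= v x] x :> R.
    by apply: sumr_ge0 => j _; exact: term.
  have [vt|vt] := ltP (v x) (t 0%N).
    apply: le_trans (_ : t 0%N ^+ 2 <= _); last by rewrite lerDl.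
    rewrite ler_pXn2r ?nnegrE ?(ltW (t0 0%N))// /u ge_min ge_max (ltW vt) (ltW (t0 _)).
    by [].
  have ex k : (forall i, (i < k)%N -> ~~ ((t i <= v x) && (v x < t i.+1))) -> t k <= v x.
    elim: k => // k IHk h; have tk := IHk (fun i ik => h i (ltnW ik)).
    by have := h k (ltnSn k); rewrite tk /= -leNgt.
  have [k kn uk] : exists2 k, (k < n.+1)%N & (t k <= v x) && (u <= 2 * t k).
    have [/existsP[[k kn] /= /andP[h1 h2]]|/existsPn h] :=
      boolP [exists i : 'I_n, (t i <= v x) && (v x < t i.+1)].
      exists k; first exact: ltnW.
      rewrite h1 /= -tS /u ge_min ge_max (ltW h2) /= (ltW (t0 _)).
      by [].
    exists n => //; rewrite ex/=; last by move=> i ik; exact: (h (Ordinal ik)).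
    by rewrite tn /u ge_min; apply/orP; right; lra.
  have /andP[tk u2] := uk.
  rewrite (bigD1 (Ordinal kn))//= indicE mem_set// mulr1 /W.
  have h3 : u ^+ 2 <= 4 * t k ^+ 2.
    rewrite (_ : 4 * t k ^+ 2 = (2 * t k) ^+ 2); last by ring.
    by rewrite ler_pXn2r ?nnegrE// mulr_ge0// ltW.
  have := sum0 _ (fun i : 'I_n.+1 => i != Ordinal kn); have := sqr_ge0 (t 0%N).
  by rewrite /W; lra.
have W40 j : 0 <= 4 * W j by rewrite mulr_ge0.
rewrite (@integral_const_add_indic_sum _ _ _ mu (t 0%N ^+ 2) (fun j => 4 * W j)
  (fun j => [set x | t j <= v x]) n.+1 (sqr_ge0 _) W40 (fun j => mge (t j))).
have W4 j : ((4 * W j)%:E * mu [set x | (t j <= v x)%R] = 4%:E * ((W j)%:E * mu [set x | (t j <= v x)%R]))%E.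
  by rewrite muleA -EFinM.
under eq_bigr do rewrite W4.
rewrite -ge0_sume_distrr; last by move=> j _; rewrite mule_ge0// lee_fin.
rewrite big_ord_recl /=.
have p1 : ((W 0%N)%:E * mu [set x | (t 0%N <= v x)%R] <= (W 0%N)%:E)%E.
  by rewrite -[leRHS]mule1; apply: lee_wpmul2l; [rewrite lee_fin|exact: probability_le1].
have eqE : (\int[mu]_(x in [set x | (t 0 <= v x < t n)%R]) (E x)%:E <= (8 / w 2 ^+ 2)%:E * X)%E.
  have mlay : measurable ([set x | 0 < v x < M] : set (borelRd R d)).
    rewrite (_ : mkset _ = [set x | 0 < v x] `&` [set x | v x < M]).
      by apply: measurableI; [exact: measurable_gt_set mv _|exact: measurable_lt_set mv _].
    by apply/seteqP; split=> x /andP.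
  rewrite /X -ge0_integralZl_EFin//; last 3 first.
  - by move=> x _; rewrite lee_fin sqr_ge0.
  - by apply: measurable_funTS; apply/measurable_EFinP; exact: measurable_funX.
  - by rewrite divr_ge0// sqr_ge0.
  rewrite [leLHS]integral_mkcond [leRHS]integral_mkcond.
  apply: integral_monotone => x _; rewrite !patchE.
  case: ifPn => [/set_mem/= /andP[h1 h2]|_].
    by rewrite mem_set//= -tn h2 andbT; exact: lt_le_trans h1.
  by case: ifP => _ //; rewrite mule_ge0// lee_fin ?divr_ge0 ?sqr_ge0.
apply: (@le_trans _ _ ((t 0%N ^+ 2)%:E + 4%:E * ((W 0%N)%:E + ((W 0%N)%:E + 2%:E * ((8 / w 2 ^+ 2)%:E * X))))%E).
  rewrite leeD2l//; apply: lee_wpmul2l => //; apply: leeD => //.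
  apply: le_trans sum _; apply: leeD => //.
  by apply: lee_wpmul2l.
have [->|Xoo] := eqVneq X +oo%E.
  have c1 : 0 < 64 / w 2 ^+ 2 by rewrite divr_gt0// exprn_gt0.
  by rewrite (gt0_muley (x := (64 / w 2 ^+ 2)%:E)) ?lte_fin// addey// leey.
have Xf : X \is a fin_num by rewrite ge0_fin_numE// ltey.
rewrite -(fineK Xf); rewrite -!(EFinM, EFinD) lee_fin /W.
rewrite (_ : t 0%N = M / 2 ^+ n); last by rewrite /t expr0 mulr1.
lra.
Qed.

End Cheeger.

Section Poincare.
Context {R : realType} {d : nat} (mu : probability (borelRd R d) R).
Variable (w : R -> R).
Hypotheses (hw : layer_rate mu w) (w0 : 0 < w 2).

Let C := 64 / w 2 ^+ 2.

Let C0 : 0 <= C.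
Proof. by rewrite divr_ge0// sqr_ge0. Qed.

Lemma slope_le_subr (v G : 'rV[R]_d -> R) (m : R) :
  slope_le v G -> slope_le (fun x => v x - m) G.
Proof.
move=> vG x e e0; have [r r0 h] := vG x e e0; exists r => // y z yr zr.
by rewrite opprB addrA subrK; exact: h.
Qed.

Lemma slope_le_subl (v G : 'rV[R]_d -> R) (m : R) :
  slope_le v G -> slope_le (fun x => m - v x) G.
Proof.
move=> vG x e e0; have [r r0 h] := vG x e e0; exists r => // y z yr zr.
by rewrite opprB addrC addrA subrK distrC; exact: h.
Qed.

Lemma cheeger (v G : 'rV[R]_d -> R) : slope_le v G ->
  (forall x, 0 <= G x) ->
  measurable_fun setT (G : borelRd R d -> measurableTypeR R) ->
  (mu [set x | (0 < v x)%R] <= (2^-1)%:E)%E ->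
  (\int[mu]_x ((Num.max (v x) 0) ^+ 2)%:E <=
    C%:E * \int[mu]_(x in [set x | (0 < v x)%R]) (G x ^+ 2)%:E)%E.
Proof.
move=> vG G0 mG vhalf.
have mv := slope_le_measurable vG.
pose f n (x : borelRd R d) : \bar R := ((Num.min (Num.max (v x) 0) n.+1%:R) ^+ 2)%:E.
have mf n : measurable_fun setT (f n).
  apply/measurable_EFinP; apply: measurable_funX; apply: measurable_minr => //.
  exact: measurable_maxr.
have fcvg (x : borelRd R d) : f n x @[n --> \oo] --> ((Num.max (v x) 0) ^+ 2)%:E.
  apply: cvg_near_cst; near=> n; rewrite /f min_l//.
  apply: (@le_trans _ _ n%:R); last by rewrite ler_nat.
  by near: n; exact: nbhs_infty_ger.
have mono (x : borelRd R d) : setT x -> {homo f^~ x : n m / (n <= m)%N >-> (n <= m)%E}.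
  have p k : 0 <= Num.min (Num.max (v x) 0) k.+1%:R by rewrite le_min le_max lexx orbT ler0n.
  move=> _ n m nm; rewrite lee_fin ler_pXn2r ?nnegrE//.
  by rewrite le_min ge_min lexx /= ge_min ler_nat ltnS nm orbT.
have f0 n x : setT x -> (0 <= f n x)%E by move=> _; rewrite lee_fin sqr_ge0.
have -> : (\int[mu]_x ((Num.max (v x) 0) ^+ 2)%:E = limn (fun n => \int[mu]_x f n x))%E.
  rewrite -monotone_convergence//; apply: eq_integral => x _.
  by apply/esym/cvg_lim => //; exact: fcvg.
apply: lime_le.
  apply: ereal_nondecreasing_is_cvgn => n m nm.
  by apply: integral_monotone => x _; exact: mono.
apply: nearW => n; apply: le_trans (truncated_cheeger hw w0 vG G0 mG vhalf (ltr0Sn _ n)) _.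
apply: lee_wpmul2l; first by rewrite lee_fin.
rewrite [leLHS]integral_mkcond [leRHS]integral_mkcond; apply: integral_monotone => x _.
rewrite !patchE; case: ifPn => [/set_mem/= /andP[h _]|_]; first by rewrite mem_set.
by case: ifP => _ //; rewrite lee_fin sqr_ge0.
Unshelve. all: by end_near. Qed.

Lemma sqr_pos_neg_parts (t : R) : t ^+ 2 = Num.max t 0 ^+ 2 + Num.max (- t) 0 ^+ 2.
Proof.
have [t0|t0] := leP 0 t; first by rewrite (@max_r _ _ (- t)) ?oppr_le0//; ring.
by rewrite (@max_l _ _ (- t)) ?oppr_ge0 ?(ltW t0)//; ring.
Qed.

Lemma measurable_enorm_grad (f : 'rV[R]_d -> R) : smooth f ->
  measurable_fun setT ((fun x => enorm (grad f x)) : borelRd R d -> measurableTypeR R).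
Proof.
move=> sf; apply: (measurableT_comp (f := @Num.sqrt R)).
  by apply: continuous_measurable_fun; exact: sqrt_continuous.
apply: measurable_sum => i; apply: measurable_funX.
rewrite (_ : (fun x => _) = partial i f); last by apply/funext => x; rewrite mxE.
by apply: continuous_measurable_borelRd; exact: smooth_partial_continuous.
Qed.

(** Both [f - m] and [m - f] are positive on at most half of the mass, so the Cheeger inequality
    applies to each. This supplies the admissible [lambda2] whose existence the theorem asserts. *)
Lemma poincare_of_layer_rate : median_poincare mu (2 * C).
Proof.
move=> f sf.
pose G (x : 'rV[R]_d) := enorm (grad f x).
have fG : slope_le f G := smooth_slope_le sf.
have G0 x : 0 <= G x := enorm_ge0 _.
have mf : measurable_fun setT (f : borelRd R d -> measurableTypeR R).
  by apply: continuous_measurable_borelRd; exact: smooth_continuous.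
have mG : measurable_fun setT (G : borelRd R d -> measurableTypeR R).
  exact: measurable_enorm_grad.
set m := median mu f.
have h1 : (mu [set x | (0 < f x - m)%R] <= (2^-1)%:E)%E.
  apply: le_trans (median_gt_le mu mf); rewrite (_ : mkset _ = [set x | (m < f x)%R])//.
  by apply/seteqP; split=> x /=; rewrite subr_gt0.
have h2 : (mu [set x | (0 < m - f x)%R] <= (2^-1)%:E)%E.
  apply: le_trans (median_lt_le mu mf); rewrite (_ : mkset _ = [set x | (f x < m)%R])//.
  by apply/seteqP; split=> x /=; rewrite subr_gt0.
have c1 := cheeger (slope_le_subr m fG) G0 mG h1.
have c2 := cheeger (slope_le_subl m fG) G0 mG h2.
have mp : measurable_fun setT (fun x : borelRd R d => ((Num.max (f x - m) 0) ^+ 2)%:E).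
  apply/measurable_EFinP; apply: measurable_funX; apply: measurable_maxr => //.
  exact: measurable_funB.
have mn : measurable_fun setT (fun x : borelRd R d => ((Num.max (m - f x) 0) ^+ 2)%:E).
  apply/measurable_EFinP; apply: measurable_funX; apply: measurable_maxr => //.
  exact: measurable_funB.
rewrite (_ : (fun x => ((f x - m) ^+ 2)%:E) =
  (fun x => ((Num.max (f x - m) 0) ^+ 2)%:E + ((Num.max (m - f x) 0) ^+ 2)%:E)%E); last first.
  by apply/funext => x; rewrite -EFinD sqr_pos_neg_parts opprB.
rewrite ge0_integralD//; [|by move=> x _; rewrite lee_fin sqr_ge0..].
have sub (D : set (borelRd R d)) : (\int[mu]_(x in D) (G x ^+ 2)%:E <= \int[mu]_x (G x ^+ 2)%:E)%E.
  rewrite [leLHS]integral_mkcond; apply: integral_monotone => x _.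
  by rewrite patchE; case: ifP => _ //; rewrite lee_fin sqr_ge0.
have C0E : (0 <= C%:E :> \bar R)%E by rewrite lee_fin.
have X0 : (0 <= \int[mu]_x (G x ^+ 2)%:E)%E by apply: integral_ge0 => x _; rewrite lee_fin sqr_ge0.
apply: le_trans (leeD c1 c2) _.
apply: le_trans (leeD (lee_wpmul2l C0E (sub _)) (lee_wpmul2l C0E (sub _))) _.
by rewrite -ge0_muleDl// -EFinD -/(G _) mulr_natl mulr2n.
Qed.

Section Variance.
Variables (v G : 'rV[R]_d -> R).
Hypotheses (vG : slope_le v G) (G0 : forall x, 0 <= G x)
  (mG : measurable_fun setT (G : borelRd R d -> measurableTypeR R))
  (v0 : forall x, 0 <= v x) (v1 : (\int[mu]_x (v x ^+ 2)%:E = 1)%E).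

Let mv : measurable_fun setT (v : borelRd R d -> measurableTypeR R).
Proof. exact: slope_le_measurable vG. Qed.

Let iv2 : mu.-integrable setT (fun x => (v x ^+ 2)%:E).
Proof.
apply/integrableP; split; first by apply/measurable_EFinP; exact: measurable_funX.
under eq_integral do rewrite gee0_abs ?lee_fin ?sqr_ge0//.
by rewrite v1 ltry.
Qed.

Let iv : mu.-integrable setT (fun x => (v x)%:E).
Proof.
have i1 : mu.-integrable setT (fun x : borelRd R d => (1 + v x ^+ 2)%:E).
  rewrite (_ : (fun x => _) = (cst 1%:E \+ (fun x => (v x ^+ 2)%:E))%E) //.
  by apply: integrableD => //; exact: finite_measure_integrable_cst.
apply: le_integrable i1 => //; first exact/measurable_EFinP.
move=> x _; rewrite !gee0_abs ?lee_fin//; last by rewrite addr_ge0 ?sqr_ge0.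
by have := sqr_ge0 (v x - 1); have := v0 x; nra.
Qed.

Let m1 := fine (\int[mu]_x (v x)%:E).

Let int_sqr_sub (c : R) :
  (\int[mu]_x ((v x - c) ^+ 2)%:E = (1 - 2 * c * m1 + c ^+ 2)%:E)%E.
Proof.
have ic : mu.-integrable setT (cst (c ^+ 2)%:E) by exact: finite_measure_integrable_cst.
have icv : mu.-integrable setT (fun x => ((2 * c)%:E * (v x)%:E)%E) by exact: integrableZl.
have i12 : mu.-integrable setT (fun x => ((v x ^+ 2)%:E - (2 * c)%:E * (v x)%:E)%E) by exact: integrableB.
transitivity (\int[mu]_x (((v x ^+ 2)%:E - (2 * c)%:E * (v x)%:E) + cst (c ^+ 2)%:E x))%E.
  by apply: eq_integral => x _; rewrite -EFinM -EFinB -EFinD; congr EFin; ring.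
rewrite integralD// integralB// v1 integralZl//.
rewrite integral_cst// [X in (_ + _ * X)%E](_ : _ = 1%E) ?mule1; last exact: probability_setT.
by rewrite -(fineK (integrable_fin_num measurableT iv)) -EFinM -EFinB -EFinD.
Qed.

(** Let [m1] be the mean. The left side is [2 - 2 m1], the variance is [1 - m1^2], and [m1] lies in
    [0, 1], so the left side is at most twice the variance, hence at most twice the second moment
    about the median. *)
Lemma variance_le : (\int[mu]_x ((v x - 1) ^+ 2)%:E <=
  (4 * C)%:E * \int[mu]_(x in [set x | (0 < v x)%R]) (G x ^+ 2)%:E)%E.
Proof.
set m := median mu v.
set X := (\int[mu]_(x in [set x | (0 < v x)%R]) (G x ^+ 2)%:E)%E.
have X0 : (0 <= X)%E by apply: integral_ge0 => x _; rewrite lee_fin sqr_ge0.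
have C0E : (0 <= C%:E :> \bar R)%E by rewrite lee_fin.
have m_ge0 : 0 <= m.
  apply: lb_le_inf.
    exists (median mu v).
    exact: (median_gt_le mu mv).
  move=> t /= ht; rewrite leNgt; apply/negP => t0.
  have : (mu [set x | (t < v x)%R] = 1)%E.
    rewrite (_ : mkset _ = setT); first exact: probability_setT.
    by apply/seteqP; split => x //= _; exact: lt_le_trans t0 (v0 x).
  by move=> h; move: ht; rewrite h lee_fin; lra.
have h1 : (mu [set x | (0 < v x - m)%R] <= (2^-1)%:E)%E.
  apply: le_trans (median_gt_le mu mv); rewrite (_ : mkset _ = [set x | (m < v x)%R])//.
  by apply/seteqP; split=> x /=; rewrite subr_gt0.
have h2 : (mu [set x | (0 < m - v x)%R] <= (2^-1)%:E)%E.
  apply: le_trans (median_lt_le mu mv); rewrite (_ : mkset _ = [set x | (v x < m)%R])//.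
  by apply/seteqP; split=> x /=; rewrite subr_gt0.
have mono (D : set 'rV[R]_d) : (forall x, D x -> 0 < v x) ->
    (\int[mu]_(x in D) (G x ^+ 2)%:E <= X)%E.
  move=> DX; rewrite /X [leLHS]integral_mkcond [leRHS]integral_mkcond.
  apply: integral_monotone => x _; rewrite !patchE.
  case: ifPn => [/set_mem/DX h|_]; first by rewrite mem_set.
  by case: ifP => _ //; rewrite lee_fin sqr_ge0.
have c1 : (\int[mu]_x ((Num.max (v x - m) 0) ^+ 2)%:E <= C%:E * X)%E.
  apply: le_trans (cheeger (slope_le_subr m vG) G0 mG h1) _.
  apply: lee_wpmul2l => //; apply: mono => x /=; rewrite subr_gt0.
  exact: le_lt_trans.
have c2 : (\int[mu]_x ((Num.max (m - v x) 0) ^+ 2)%:E <= C%:E * X)%E.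
  move: m_ge0; rewrite le_eqVlt => /predU1P[mz|m_gt0].
    rewrite integral0_eq; first by rewrite mule_ge0.
    by move=> x _; rewrite -mz max_r ?expr0n// sub0r oppr_le0.
  (* As [v >= 0], truncating [m - v] at [m] loses nothing, while the open layer 0 < m - v < m lies
     in {v > 0}: the zeros of [v] do not enter the gradient integral. *)
  have := truncated_cheeger hw w0 (slope_le_subl m vG) G0 mG h2 m_gt0.
  rewrite (_ : (fun x => _) = (fun x => ((Num.max (m - v x) 0) ^+ 2)%:E)); last first.
    apply/funext => x; rewrite min_l// ge_max (ltW m_gt0) andbT.
    by rewrite lerBlDr lerDl.
  move=> /le_trans; apply; apply: lee_wpmul2l => //.
  by apply: mono => x /= /andP[_]; rewrite ltrBlDr ltrDl.
have mp : measurable_fun setT (fun x : borelRd R d => ((Num.max (v x - m) 0) ^+ 2)%:E).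
  apply/measurable_EFinP; apply: measurable_funX; apply: measurable_maxr => //.
  exact: measurable_funB.
have mn : measurable_fun setT (fun x : borelRd R d => ((Num.max (m - v x) 0) ^+ 2)%:E).
  apply/measurable_EFinP; apply: measurable_funX; apply: measurable_maxr => //.
  exact: measurable_funB.
have : (\int[mu]_x ((v x - m) ^+ 2)%:E <= C%:E * X + C%:E * X)%E.
  rewrite (_ : (fun x => ((v x - m) ^+ 2)%:E) =
    (fun x => ((Num.max (v x - m) 0) ^+ 2)%:E + ((Num.max (m - v x) 0) ^+ 2)%:E)%E); last first.
    by apply/funext => x; rewrite -EFinD sqr_pos_neg_parts opprB.
  rewrite ge0_integralD//; [exact: leeD|by move=> x _; rewrite lee_fin sqr_ge0..].
rewrite !int_sqr_sub.
have := int_sqr_sub m1.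
have pos : (0 <= \int[mu]_x ((v x - m1) ^+ 2)%:E)%E.
  by apply: integral_ge0 => x _; rewrite lee_fin sqr_ge0.
move=> h; move: pos; rewrite h lee_fin => m1le.
have m10 : 0 <= m1 by apply/fine_ge0/integral_ge0 => x _; rewrite lee_fin.
have [Xoo|Xoo] := eqVneq X +oo%E.
  have c0 : 0 < 4 * C by rewrite mulr_gt0// divr_gt0// exprn_gt0.
  by move=> _; rewrite Xoo gt0_muley ?lte_fin// leey.
have Xf : X \is a fin_num by rewrite ge0_fin_numE// ltey.
rewrite -(fineK Xf) -!EFinM -!EFinD !lee_fin => h3.
have : 0 <= (m - m1) ^+ 2 by exact: sqr_ge0.
nra.
Qed.

Lemma markov_sqr (t : R) : 0 < t ->
  (mu [set x | (t < v x)%R] <= ((t ^+ 2)^-1)%:E)%E.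
Proof.
move=> t0; have mt := measurable_gt_set mv t.
have t2 : 0 < t ^+ 2 by rewrite exprn_gt0.
rewrite -[leRHS]mule1 lee_pdivlMl// -v1.
rewrite -(setIT [set x | t < v x]) -(integral_indic mu measurableT mt).
have mi : measurable_fun setT (fun x : borelRd R d => (\1_[set x | t < v x] x : R)%:E).
  by apply/measurable_EFinP; exact: measurable_indic.
rewrite -(ge0_integralZl_EFin _ measurableT _ mi (ltW t2))//.
apply: integral_monotone => x _; rewrite -EFinM lee_fin indicE.
case: (boolP (x \in _)) => [/set_mem/= h|_]; last by rewrite mulr0 sqr_ge0.
by rewrite mulr1 ler_pXn2r ?nnegrE ?(ltW t0)// ltW.
Qed.

Lemma mass_ge2_le : (mu [set x | (2 <= v x)%R] <= \int[mu]_x ((v x - 1) ^+ 2)%:E)%E.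
Proof.
have mt := measurable_ge_set mv 2.
rewrite -(setIT [set x | 2 <= v x]) -(integral_indic mu measurableT mt).
apply: integral_monotone => x _; rewrite lee_fin indicE.
case: (boolP (x \in _)) => [/set_mem/= h|_]; last by rewrite sqr_ge0.
by rewrite -[leLHS](expr1n _ 2) ler_pXn2r ?nnegrE//; lra.
Qed.

End Variance.

End Poincare.

(** * The functions phi, F_tau and c_{A,q} *)

Section Concave.
Context {R : realType} (phi : R -> R).
Hypothesis hA1 : condA1 phi.

Lemma condA1_concave (x y t : R) : 0 < x -> 0 < y -> 0 <= t <= 1 ->
  t * phi x + (1 - t) * phi y <= phi (t * x + (1 - t) * y).
Proof.
case: hA1 => cv _ _ x0 y0 /andP[t0 t1].
have xI : x \in (`]0, +oo[%classic : set R) by rewrite inE/= in_itv/= x0.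
have yI : y \in (`]0, +oo[%classic : set R) by rewrite inE/= in_itv/= y0.
have h : - phi (t * x + (1 - t) * y) <= t * - phi x + (1 - t) * - phi y.
  exact: cv (Itv01 t0 t1) x y xI yI.
lra.
Qed.

Lemma condA1_lt (x y : R) : 0 < x -> x < y -> phi x < phi y.
Proof.
case: hA1 => _ inc _ x0 xy; apply: inc => //; rewrite in_itv/= ?x0//.
by rewrite (lt_trans x0 xy).
Qed.

Lemma condA1_le (x y : R) : 0 < x -> x <= y -> phi x <= phi y.
Proof.
move=> x0; rewrite le_eqVlt => /predU1P[->//|xy]; exact/ltW/condA1_lt.
Qed.

Lemma condA1_1 : phi 1 = 0.
Proof. by case: hA1. Qed.

Lemma condA1_gt0 (x : R) : 1 < x -> 0 < phi x.
Proof. by move=> x1; rewrite -condA1_1; exact: condA1_lt. Qed.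

Lemma condA1_ratio (s S : R) : 1 < s -> s <= S ->
  phi S * (s - 1) <= phi s * (S - 1).
Proof.
move=> s1 sS; have S1 : 0 < S - 1 by lra.
pose t := (s - 1) / (S - 1).
have t01 : 0 <= t <= 1 by rewrite divr_ge0 ?ler_pdivrMr//; lra.
have S0 : 0 < S by lra.
have := condA1_concave S0 ltr01 t01.
rewrite condA1_1 mulr0 addr0 mulr1 (_ : t * S + (1 - t) = s); last first.
  by rewrite /t; field; exact: lt0r_neq0.
by rewrite [X in _ -> X <= _]mulrC -ler_pdivrMr// /t mulrAC.
Qed.

Lemma condA1_slopes (u y : R) : 0 < u -> u < 1 -> 1 < y ->
  phi y / (y - 1) <= - phi u / (1 - u).
Proof.
move=> u0 u1 y1; pose t := (y - 1) / (y - u).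
have yu : 0 < y - u by lra.
have t01 : 0 <= t <= 1 by rewrite divr_ge0 ?ler_pdivrMr//; lra.
have y0 : 0 < y by lra.
have := condA1_concave u0 y0 t01.
rewrite (_ : t * u + (1 - t) * y = 1); last by rewrite /t; field; exact: lt0r_neq0.
rewrite condA1_1 => h.
have {}h : (y - 1) * phi u + (1 - u) * phi y <= 0.
  have -> : (y - 1) * phi u + (1 - u) * phi y = (y - u) * (t * phi u + (1 - t) * phi y).
    by rewrite /t; field; exact: lt0r_neq0.
  by rewrite pmulr_rle0.
have y1' : 0 < y - 1 by rewrite subr_gt0.
have u1' : 0 < 1 - u by rewrite subr_gt0.
rewrite ler_pdivrMr// mulrAC ler_pdivlMr//; lra.
Qed.

(** [a] is the right derivative at 1, obtained as the supremum of the chord slopes to the right of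
    1; every chord slope to the left of 1 is an upper bound for them. *)
Lemma condA1_tangent : exists2 a : R, 0 <= a & forall y, 0 < y -> phi y <= a * (y - 1).
Proof.
pose S := [set phi y / (y - 1) | y in [set y : R | 1 < y]].
have h2 : 0 < 2^-1 :> R by rewrite invr_gt0.
have h21 : 2^-1 < 1 :> R by rewrite invf_lt1// ltr1n.
have ub (u : R) : 0 < u -> u < 1 -> ubound S (- phi u / (1 - u)).
  by move=> u0 u1 _ [y y1 <-]; exact: condA1_slopes.
have S0 : S !=set0 by exists (phi 2 / (2 - 1)), 2 => //=; rewrite ltr1n.
have hs : has_sup S by split => //; exists (- phi 2^-1 / (1 - 2^-1)); exact: ub.
exists (sup S).
  apply: (@le_trans _ _ (phi 2 / (2 - 1))).
    by rewrite divr_ge0 ?subr_ge0 ?ler1n// ltW// condA1_gt0// ltr1n.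
  by apply: ub_le_sup; [case: hs|exists 2 => //=; rewrite ltr1n].
move=> y y0; have [y1|y1|->] := ltgtP y 1; last by rewrite condA1_1 subrr mulr0.
  have : sup S <= - phi y / (1 - y) by apply: ge_sup => //; exact: ub.
  rewrite ler_pdivlMr ?subr_gt0//; lra.
have : phi y / (y - 1) <= sup S by apply: ub_le_sup; [case: hs|exists y].
by rewrite ler_pdivrMr ?subr_gt0.
Qed.

Lemma F_tau_le (x0 tau y : R) : 0 < x0 -> phi x0 = 1 -> 0 < tau -> tau <= 1 -> 0 < y ->
  F_tau phi x0 tau y <= phi y.
Proof.
move=> x00 px0 t0 t1 y0; rewrite /F_tau; case: (leP y x0) => // x0y.
have p1 : 1 < phi y by rewrite -px0; exact: condA1_lt.
move: t1; rewrite le_eqVlt => /predU1P[->|t1].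
  by rewrite invr1 mul1r powRr1 ?subrK//; exact: ltW (lt_trans ltr01 p1).
have t0' : 0 < 1 - tau by rewrite subr_gt0.
(* Weighted means of 1 and [phi y]: [phi y ^ tau <= 1 - tau + tau * phi y]. *)
have := @weighted_AMGM R tau 1 (phi y) t0 t1 ler01 (ltW (lt_trans ltr01 p1)).
rewrite powR1 mul1r mulr1 => h.
rewrite -lerBrDr ler_pdivrMl//; lra.
Qed.

Lemma F_tau_le_powR (x0 tau y : R) : 0 < x0 -> phi x0 = 1 -> 0 < tau -> tau <= 1 -> x0 < y ->
  F_tau phi x0 tau y <= tau^-1 * phi y `^ tau.
Proof.
move=> x00 px0 t0 t1 xy; rewrite /F_tau (leNgt y) xy /=.
have : 1 <= tau^-1 by rewrite invf_ge1.
lra.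
Qed.

End Concave.

Lemma cost_lower (R : realType) (A q y : R) : 0 < A -> 2 <= q -> 0 <= y -> A < y ->
  A `^ (2 - q) * (y `^ q / q) <= cost A q y.
Proof.
move=> A0 q2 y0 Ay; rewrite /cost ger0_norm// (leNgt y A) Ay /= lerDl.
have h1 : 0 <= q - 2 by rewrite subr_ge0.
have h2 : 0 <= 2 * q by rewrite mulr_ge0// (le_trans _ q2).
by rewrite mulr_ge0 ?sqr_ge0// divr_ge0.
Qed.

Lemma cost_ge0 (R : realType) (A q y : R) : 0 < A -> 2 <= q -> 0 <= y -> 0 <= cost A q y.
Proof.
move=> A0 q2 y0; have [yA|Ay] := leP y A.
  by rewrite /cost ger0_norm// yA divr_ge0 ?sqr_ge0.
have q0 : 0 <= q by rewrite (le_trans _ q2).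
by apply: le_trans (cost_lower A0 q2 y0 Ay); rewrite mulr_ge0 ?powR_ge0// divr_ge0 ?powR_ge0.
Qed.

Lemma sqr_le_cost (R : realType) (A q y : R) : 0 < A -> 2 <= q -> 0 <= y -> y ^+ 2 <= q * cost A q y.
Proof.
move=> A0 q2 y0; have [yA|Ay] := leP y A.
  rewrite /cost ger0_norm// yA; have := sqr_ge0 y; nra.
have q0 : 0 < q by lra.
apply: le_trans (ler_wpM2l (ltW q0) (cost_lower A0 q2 y0 Ay)).
have y1 : 0 < y by exact: lt_trans Ay.
have -> : q * (A `^ (2 - q) * (y `^ q / q)) = A `^ (2 - q) * (y `^ (q - 2) * y ^+ 2).
  rewrite -powR_mulrn ?(ltW y1)// -powRD ?(gt_eqF y1) ?implybT// subrK.
  by field; exact: lt0r_neq0.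
rewrite mulrA -[leLHS]mul1r ler_wpM2r ?sqr_ge0//.
rewrite -opprB powRN -ler_pdivrMl ?invr_gt0 ?powR_gt0// invrK mulr1.
by rewrite ge0_ler_powR ?nnegrE ?(ltW A0) ?(ltW y1) ?(ltW Ay)//; lra.
Qed.

Lemma powR_le_cost (R : realType) (A q y : R) : 0 < A -> 2 <= q -> 0 <= y ->
  y `^ q <= q * A `^ (q - 2) * cost A q y.
Proof.
move=> A0 q2 y0; have q0 : 0 < q by lra.
have [yA|Ay] := leP y A.
  rewrite /cost ger0_norm// yA.
  have -> : y `^ q = y `^ (q - 2) * y ^+ 2.
    by rewrite -powR_mulrn// -powRD subrK// (gt_eqF q0).
  have : y `^ (q - 2) <= A `^ (q - 2).
    by rewrite ge0_ler_powR ?nnegrE ?(ltW A0)//; lra.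
  have := sqr_ge0 y; have := powR_ge0 A (q - 2).
  set a := A `^ _; set b := y `^ _; set z := y ^+ 2 => a0 z0 ba.
  have h1 : b * z <= a * z by rewrite ler_wpM2r.
  have h2 : 0 <= a * z by rewrite mulr_ge0.
  nra.
have c0 : 0 <= q * A `^ (q - 2) by rewrite mulr_ge0 ?powR_ge0// ltW.
apply: le_trans (ler_wpM2l c0 (cost_lower A0 q2 y0 Ay)).
rewrite (_ : q * A `^ (q - 2) * (A `^ (2 - q) * (y `^ q / q)) =
  (A `^ (q - 2) * A `^ (2 - q)) * y `^ q); last first.
  by field; exact: lt0r_neq0.
by rewrite -powRD ?(gt_eqF A0) ?implybT// addrC addrA subrK subrr powRr0 mul1r.
Qed.

Lemma measurable_cost (R : realType) (A q : R) : measurable_fun setT (cost A q).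
Proof.
rewrite /cost; apply: measurable_fun_ifT => //=.
- by apply: measurable_fun_ler => //; exact: normr_measurable.
- by apply: measurable_funM => //; exact: measurable_funX.
- apply: measurable_funD => //; apply: measurable_funM => //; apply: measurable_funM => //.
  by apply: (measurableT_comp (f := @powR R ^~ q)) => //; exact: normr_measurable.
Qed.

Lemma powR_rescale (R : realType) (A p z : R) : 0 < A -> 0 <= z ->
  A `^ (2 - p) * ((A * z) `^ p / p) = A ^+ 2 * (z `^ p / p).
Proof.
move=> A0 z0; rewrite powRM ?(ltW A0)// mulrA mulrA -powRD ?subrK ?(gt_eqF A0) ?implybT//.
by rewrite powR_mulrn ?(ltW A0)// -!mulrA.
Qed.

Lemma bernoulli_powR (R : realType) (q z : R) : 1 < q -> 0 <= z -> 1 + q * (z - 1) <= z `^ q.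
Proof.
move=> q1 z0; have q0 : 0 < q by lra.
have l0 : 0 < 1 - q^-1 by rewrite subr_gt0 invf_lt1.
have l1 : 1 - q^-1 < 1 by rewrite gtrBl invr_gt0.
have := weighted_AMGM l0 l1 (powR_ge0 z q) ler01.
rewrite powR1 mulr1 subKr -powRrM mulfV ?lt0r_neq0// powRr1// mulr1.
rewrite -(ler_pM2l q0); have -> : q * (q^-1 * z `^ q + (1 - q^-1)) = z `^ q + q - 1.
  by field; exact: lt0r_neq0.
lra.
Qed.

(* Above the threshold [A] the cost lies above its tangents at points of [0, A]. *)
Lemma cost_tangent (R : realType) (A q x y : R) : 0 < A -> 1 < q -> A < x -> 0 <= y <= A ->
  x * y - y ^+ 2 / 2 <= cost A q x.
Proof.
move=> A0 q1 Ax /andP[y0 yA]; have q0 : 0 < q by lra.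
have x0 : 0 < x by exact: lt_trans Ax.
rewrite /cost gtr0_norm// (leNgt x A) Ax /=.
pose z := x / A; have xE : x = z * A by rewrite /z divfK// lt0r_neq0.
have z0 : 0 <= z by rewrite divr_ge0// ltW.
have -> : A `^ (2 - q) * (x `^ q / q) = A ^+ 2 * (z `^ q / q).
  by rewrite xE (mulrC z) powR_rescale.
have h := bernoulli_powR q1 z0.
have h2 : A ^+ 2 * (1 + q * (z - 1)) / q <= A ^+ 2 * (z `^ q / q).
  by rewrite -mulrA ler_wpM2l ?sqr_ge0// ler_wpM2r// invr_ge0 ltW.
have h3 : A ^+ 2 * (1 + q * (z - 1)) / q + A ^+ 2 * ((q - 2) / (2 * q)) = A * x - A ^+ 2 / 2.
  by rewrite xE; field; exact: lt0r_neq0.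
have : x * y - y ^+ 2 / 2 <= A * x - A ^+ 2 / 2 by nra.
lra.
Qed.

(** Young's inequality in four regimes, by the positions of [x] and [y] relative to [A]: a square
    when both lie below, [cost_tangent] in the mixed cases, and conjugate powers when both lie
    above, where the additive constants cancel because [alpha^-1 + q^-1 = 1]. *)
Lemma conjugate_cost (R : realType) (A alpha x : R) : 0 < A -> 1 < alpha -> 0 <= x ->
  conjugate (cost A alpha) x = (cost A (alpha / (alpha - 1)) x)%:E.
Proof.
move=> A0 a1 x0; set q := alpha / (alpha - 1).
have al0 : 0 < alpha by lra.
have a10 : 0 < alpha - 1 by lra.
have q1 : 1 < q by rewrite /q ltr_pdivlMr//; lra.
have q0 : 0 < q by lra.
have dual : alpha^-1 + q^-1 = 1 by rewrite /q; field; rewrite !lt0r_neq0.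
have young (y : R) : 0 <= y -> x * y - cost A alpha y <= cost A q x.
  move=> y0; have [yA|Ay] := leP y A; have [xA|Ax] := leP x A.
  - rewrite /cost !ger0_norm// yA xA; have := sqr_ge0 (x - y); nra.
  - by rewrite {1}/cost ger0_norm// yA; apply: cost_tangent => //; rewrite y0.
  - have h : 0 <= x <= A by rewrite x0.
    have := cost_tangent A0 a1 Ay h; rewrite [cost A q x]/cost ger0_norm// xA; lra.
  - rewrite /cost !ger0_norm// (leNgt y A) (leNgt x A) Ay Ax /=.
    have xi0 : 0 <= x / A by rewrite divr_ge0// ltW.
    have ze0 : 0 <= y / A by rewrite divr_ge0// ltW.
    have := conjugate_powR ze0 xi0 al0 q0 dual.
    rewrite -(ler_pM2l (exprn_gt0 2 A0)).
    have pw (p z : R) : 0 <= z -> A ^+ 2 * ((z / A) `^ p / p) = A `^ (2 - p) * (z `^ p / p).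
      move=> z0; rewrite -powR_rescale ?divr_ge0 ?(ltW A0)//.
      by rewrite (_ : A * (z / A) = z)//; field; exact: lt0r_neq0.
    rewrite mulrDr !pw//.
    have -> : A ^+ 2 * (y / A * (x / A)) = x * y by field; exact: lt0r_neq0.
    have : A ^+ 2 * ((alpha - 2) / (2 * alpha)) + A ^+ 2 * ((q - 2) / (2 * q)) = 0.
      have -> : A ^+ 2 * ((alpha - 2) / (2 * alpha)) + A ^+ 2 * ((q - 2) / (2 * q)) =
          A ^+ 2 * (1 - (alpha^-1 + q^-1)) by field; rewrite !lt0r_neq0.
      by rewrite dual subrr mulr0.
    lra.
apply/eqP; rewrite eq_le; apply/andP; split.
  by apply: ge_ereal_sup => _ [y /= y0 <-]; rewrite lee_fin; exact: young.
have [xA|Ax] := leP x A.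
  apply: le_ereal_sup_tmp; exists (x * x - cost A alpha x)%:E; first by exists x.
  by rewrite lee_fin /cost ger0_norm// xA; lra.
(* The maximiser: the solution of [A^(2 - alpha) * y^(alpha - 1) = x], where the derivative of the
   cost equals [x]. *)
pose xi := x / A; pose y := A * xi `^ (alpha - 1)^-1.
have xi1 : 1 < xi by rewrite /xi ltr_pdivlMr// mul1r.
have xi0 : 0 < xi by lra.
have y0 : 0 <= y by rewrite mulr_ge0 ?powR_ge0// ltW.
have Ay : A < y.
  have i0 : 0 < (alpha - 1)^-1 by rewrite invr_gt0.
  have := gt0_ltr_powR i0 (_ : 1 \in Num.nneg) (_ : xi \in Num.nneg) xi1.
  by rewrite !nnegrE powR1 => /(_ ler01 (ltW xi0)) h; rewrite /y ltr_pMr.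
apply: le_ereal_sup_tmp; exists (x * y - cost A alpha y)%:E; first by exists y.
rewrite lee_fin /cost !ger0_norm// (leNgt y A) (leNgt x A) Ay Ax /=.
have xE : x = A * xi by rewrite /xi; field; exact: lt0r_neq0.
rewrite {1}xE powR_rescale ?(ltW xi0)// {2}/y powR_rescale ?powR_ge0//.
rewrite -powRrM (mulrC _ alpha) -/q.
have -> : x * y = A ^+ 2 * xi `^ q.
  rewrite xE /y.
  have -> : xi `^ q = xi * xi `^ (alpha - 1)^-1.
    rewrite -{2}(powRr1 (ltW xi0)) -powRD ?(gt_eqF xi0) ?implybT//.
    by congr (_ `^ _); rewrite /q; field; exact: lt0r_neq0.
  ring.
have h0 : A ^+ 2 * ((alpha - 2) / (2 * alpha)) + A ^+ 2 * ((q - 2) / (2 * q)) = 0.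
  have -> : A ^+ 2 * ((alpha - 2) / (2 * alpha)) + A ^+ 2 * ((q - 2) / (2 * q)) =
      A ^+ 2 * (1 - (alpha^-1 + q^-1)) by field; rewrite !lt0r_neq0.
  by rewrite dual subrr mulr0.
have h1 : A ^+ 2 * xi `^ q - A ^+ 2 * (xi `^ q / alpha) = A ^+ 2 * (xi `^ q / q).
  have -> : A ^+ 2 * (xi `^ q / q) = A ^+ 2 * xi `^ q * (1 - alpha^-1) by rewrite -dual; ring.
  ring.
lra.
Qed.

Section TailWeights.
Context {R : realType} (phi : R -> R).
Hypothesis hA1 : condA1 phi.

(** With [y = v^2], the tangent bound [a * (y - 1)] for [F_tau] gives
    [y F <= a (y - 1) + a (y - 1)^2], and [(y - 1)^2 = (v + 1)^2 (v - 1)^2] is a bounded multiple of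
    [(v - 1)^2] up to [s]. Beyond [s], [v^2] exceeds [x0], so [F_tau] is at most
    [tau^-1 * phi^tau]. *)
Lemma F_tau_pointwise (x0 tau : R) : 0 < x0 -> phi x0 = 1 -> 0 < tau -> tau <= 1 ->
  exists a B : R, [/\ 0 <= a, 0 <= B & forall v : R, 0 <= v ->
    v ^+ 2 * F_tau phi x0 tau (v ^+ 2) <= a * (v ^+ 2 - 1) + B * (v - 1) ^+ 2 +
      (if 2 <= v then tau^-1 * (v ^+ 2 * phi (v ^+ 2) `^ tau) else 0)].
Proof.
move=> x00 px0 t0 t1; have [a a0 ha] := condA1_tangent hA1.
pose s := Num.max 2 (Num.sqrt x0); have s2 : 2 <= s by rewrite le_max lexx.
exists a, (a * (s + 1) ^+ 2); split => //; first by rewrite mulr_ge0 ?sqr_ge0.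
move=> v v0.
have tail0 : 0 <= (if 2 <= v then tau^-1 * (v ^+ 2 * phi (v ^+ 2) `^ tau) else 0).
  by case: ifP => // _; rewrite !mulr_ge0 ?invr_ge0 ?sqr_ge0 ?powR_ge0// ltW.
have [vs|sv] := leP v s.
  (* At [v = 0] the left side vanishes whatever the value of [F_tau] at 0, which the tangent bound
     does not cover. *)
  move: v0; rewrite le_eqVlt => /predU1P[vz|v0].
    move: tail0; rewrite -vz expr0n /= mul0r => h.
    have : a * 1 <= a * (s + 1) ^+ 2 by rewrite ler_wpM2l//; nra.
    by rewrite sub0r sqrrN expr1n; lra.
  have v2 : 0 < v ^+ 2 by rewrite exprn_gt0.
  have h1 := le_trans (F_tau_le hA1 x00 px0 t0 t1 v2) (ha _ v2).
  have h2 := ler_wpM2l (ltW v2) h1.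
  have h3 : a * (v ^+ 2 - 1) ^+ 2 <= a * (s + 1) ^+ 2 * (v - 1) ^+ 2.
    rewrite -mulrA ler_wpM2l//.
    rewrite (_ : (v ^+ 2 - 1) ^+ 2 = (v + 1) ^+ 2 * (v - 1) ^+ 2); last by ring.
    rewrite ler_wpM2r ?sqr_ge0// ler_pXn2r ?nnegrE ?lerD2r// ?addr_ge0 ?(ltW v0)//.
    exact: le_trans s2.
  rewrite expr2 in h3; lra.
have v2 : 2 < v by exact: le_lt_trans sv.
rewrite (ltW v2).
have x0v : x0 < v ^+ 2.
  rewrite -[ltLHS](sqr_sqrtr (ltW x00)) ltr_pXn2r ?nnegrE ?sqrtr_ge0//.
  by apply: le_lt_trans sv; rewrite le_max lexx orbT.
have h := F_tau_le_powR (phi := phi) x00 px0 t0 t1 x0v.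
have h2 := ler_wpM2l (sqr_ge0 v) h.
have h3 : 0 <= a * (v ^+ 2 - 1) by rewrite mulr_ge0//; nra.
have h4 : 0 <= a * (s + 1) ^+ 2 * (v - 1) ^+ 2 by rewrite mulr_ge0 ?sqr_ge0// mulr_ge0 ?sqr_ge0.
lra.
Qed.

Variable (tau : R).
Hypotheses (tau0 : 0 < tau) (tau1 : tau <= 1).

Definition level (j : nat) : R := 2 * 2 ^+ j.

Definition weight (j : nat) : R := level j ^+ 2 * phi (level j ^+ 2) `^ tau.

Lemma level_ge2 j : 2 <= level j.
Proof. by rewrite /level ler_peMr// exprn_ege1// ler1n. Qed.

Lemma levelS j : level j.+1 = 2 * level j.
Proof. by rewrite /level exprS; ring. Qed.

Lemma level_gt0 j : 0 < level j.
Proof. exact: lt_le_trans (level_ge2 j). Qed.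

Lemma level_ltS j : level j < level j.+1.
Proof. by rewrite levelS ltr_pMl ?level_gt0// ltr1n. Qed.

Lemma level_sqr_ge4 j : 4 <= level j ^+ 2.
Proof. have := level_ge2 j; nra. Qed.

Lemma phi_level_gt0 j : 0 < phi (level j ^+ 2).
Proof. by apply: (condA1_gt0 hA1); have := level_sqr_ge4 j; lra. Qed.

Lemma weight_gt0 j : 0 < weight j.
Proof. by rewrite mulr_gt0 ?powR_gt0 ?phi_level_gt0// exprn_gt0// level_gt0. Qed.

(** 20 is 4 * 5: the square of the level grows by 4, and the chord bound gives
    [phi (4 S) <= 5 * phi S], because [4 S - 1 <= 5 (S - 1)] for [S >= 4]. *)
Lemma weightS j : weight j.+1 <= 20 * weight j.
Proof.
rewrite /weight levelS exprMn.
set S := level j ^+ 2; have S4 : 4 <= S := level_sqr_ge4 j.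
have p0 : 0 < phi S := phi_level_gt0 j.
have S1 : 1 < S by lra.
have r : phi (2 ^+ 2 * S) <= 5 * phi S.
  have h : S <= 2 ^+ 2 * S by lra.
  have := condA1_ratio hA1 S1 h => h2.
  rewrite -(@ler_pM2r _ (S - 1)) ?subr_gt0//; apply: le_trans h2 _; nra.
have p40 : 0 < phi (2 ^+ 2 * S) by apply: (condA1_gt0 hA1); lra.
have h2 : phi (2 ^+ 2 * S) `^ tau <= 5 * phi S `^ tau.
  apply: (@le_trans _ _ ((5 * phi S) `^ tau)).
    by rewrite ge0_ler_powR ?nnegrE ?(ltW tau0) ?(ltW p40)// mulr_ge0// ltW.
  rewrite powRM ?(ltW p0)// ler_wpM2r ?powR_ge0//.
  by apply: ler1_powR => //; rewrite ler1n.
have : S * phi (2 ^+ 2 * S) `^ tau <= S * (5 * phi S `^ tau) by rewrite ler_wpM2l//; lra.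
lra.
Qed.

Lemma tail_le_weight (v : R) : 2 <= v ->
  exists2 j, level j <= v & v ^+ 2 * phi (v ^+ 2) `^ tau <= 20 * weight j.
Proof.
move=> v2.
have ex : exists n, v < level n.
  exists (Num.trunc v).+1; apply: lt_trans (truncnS_gt _) _.
  apply: (@lt_le_trans _ _ (2 ^+ (Num.trunc v).+1)).
    by rewrite -natrX ltr_nat ltn_expl.
  by rewrite /level ler_peMl ?exprn_ge0// ler1n.
case: (ex_minnP ex) => -[|n] vn nmin.
  by move: vn; rewrite /level expr0 mulr1 ltNge v2.
exists n; first by rewrite leNgt; apply/negP => /nmin; rewrite ltnn.
apply: le_trans (weightS n); rewrite /weight.
have v0 : 0 <= v by lra.
have h : v ^+ 2 <= level n.+1 ^+ 2.
  by rewrite ler_pXn2r ?nnegrE ?(ltW (level_gt0 _))// ltW.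
have v4 : 4 <= v ^+ 2 by nra.
apply: ler_pM; rewrite ?sqr_ge0 ?powR_ge0//.
have q : 0 < phi (v ^+ 2) by apply: (condA1_gt0 hA1); lra.
rewrite ge0_ler_powR ?nnegrE ?(ltW tau0) ?(ltW q) ?(ltW (phi_level_gt0 _))//.
by apply: (condA1_le hA1) => //; lra.
Qed.

End TailWeights.

Section ModifiedLogSobolev.
Context {R : realType}.

(* Either [Y] is small compared with [P `^ beta], or [P] is controlled by a power of [Y]. *)
Lemma young_powR (P Y e beta tau : R) : 0 < P -> 0 <= Y -> 0 < e -> 0 < beta -> beta <= tau ->
  P `^ (tau - beta) * Y <= e * P `^ tau + e `^ (1 - tau / beta) * Y `^ (tau / beta).
Proof.
move=> P0 Y0 e0 b0 bt; set q := tau / beta.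
have q1 : 1 <= q by rewrite /q ler_pdivlMr// mul1r.
have [h|h] := leP Y (e * P `^ beta).
  apply: (@le_trans _ _ (e * P `^ tau)); last by rewrite lerDl mulr_ge0 ?powR_ge0.
  apply: le_trans (ler_wpM2l (powR_ge0 _ _) h) _.
  by rewrite mulrCA -powRD ?subrK// (gt_eqF P0) implybT.
apply: (@le_trans _ _ (e `^ (1 - q) * Y `^ q)); last first.
  by rewrite lerDr mulr_ge0 ?powR_ge0// ltW.
have Y1 : 0 < Y by apply: lt_trans h; rewrite mulr_gt0 ?powR_gt0.
have -> : Y `^ q = Y `^ (q - 1) * Y.
  by rewrite -{3}(powRr1 Y0) -powRD ?subrK// (gt_eqF Y1) implybT.
rewrite mulrA ler_wpM2r//.
have eY : e `^ (1 - q) * Y `^ (q - 1) = (e^-1 * Y) `^ (q - 1).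
  have ei : 0 <= e^-1 by rewrite invr_ge0 ltW.
  have e0' : 0 <= e by rewrite ltW.
  by rewrite (powRM _ ei Y0) -powR_inv1// -powRrM mulN1r opprB.
rewrite eY.
have -> : tau - beta = beta * (q - 1) by rewrite /q; field; exact: lt0r_neq0.
rewrite powRrM ge0_ler_powR ?nnegrE ?powR_ge0 ?subr_ge0//.
  by rewrite mulr_ge0// invr_ge0 ltW.
by rewrite ler_pdivlMl// ltW.
Qed.

End ModifiedLogSobolev.

(** * The modified Sobolev inequality from a layer rate *)

Section Core.
Context {R : realType}.

(** Since [v < 2 t], [t * g] is at most [2 t^2 (g / v)], which turns the growth constant 20 into
    [40 / kappa]. Young's inequality with parameter [kappa / 80] then leaves exactly the share 1/2
    of the weight. *)
Lemma layer_young (t v g kappa beta tau A P : R) : 0 < kappa -> 0 < beta -> 2 * beta <= tau ->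
  0 < A -> 0 < P -> 0 < t -> t <= v -> v < 2 * t -> 0 <= g ->
  20 * (t ^+ 2 * P `^ tau) / (kappa * P `^ beta * t) * g <= t ^+ 2 * P `^ tau / 2 +
    40 / kappa * (kappa / 80) `^ (1 - tau / beta) * (tau / beta * A `^ (tau / beta - 2)) *
      (v ^+ 2 * cost A (tau / beta) (g / v)).
Proof.
move=> k0 b0 bt A0 P0 t0 tv vt g0; set q := tau / beta.
have q2 : 2 <= q by rewrite /q ler_pdivlMr.
have v0 : 0 < v by exact: lt_le_trans tv.
have Y0 : 0 <= g / v by rewrite divr_ge0// ltW.
have e0 : 0 < kappa / 80 by rewrite divr_gt0.
have hY := young_powR P0 Y0 e0 b0 (_ : beta <= tau).
have {}hY := hY (le_trans (ler_peMl (ltW b0) (ler1n R 2)) bt).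
have hc := powR_le_cost A0 q2 Y0.
rewrite -/q in hY; set K := (kappa / 80) `^ (1 - q) in hY *.
have K0 : 0 <= K by exact: powR_ge0.
have Pb : 0 < P `^ beta by exact: powR_gt0.
have -> : P `^ tau = P `^ (tau - beta) * P `^ beta.
  by rewrite -powRD ?subrK// (gt_eqF P0) implybT.
have -> : 20 * (t ^+ 2 * (P `^ (tau - beta) * P `^ beta)) / (kappa * P `^ beta * t) * g =
    20 / kappa * (P `^ (tau - beta) * (t * g)).
  by field; rewrite !lt0r_neq0.
have tg : t * g <= 2 * (t ^+ 2 * (g / v)).
  have -> : t * g = t * v * (g / v) by field; rewrite lt0r_neq0.
  by rewrite [leRHS]mulrA; apply: ler_wpM2r => //; nra.
have h1 : 20 / kappa * (P `^ (tau - beta) * (t * g)) <=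
    40 / kappa * t ^+ 2 * (P `^ (tau - beta) * (g / v)).
  have -> : 40 / kappa * t ^+ 2 * (P `^ (tau - beta) * (g / v)) =
     20 / kappa * (P `^ (tau - beta) * (2 * (t ^+ 2 * (g / v)))).
    by field; rewrite !lt0r_neq0.
  apply: ler_wpM2l; first by rewrite divr_ge0// ltW.
  by apply: ler_wpM2l; rewrite ?powR_ge0.
apply: (le_trans h1).
have kt0 : 0 <= 40 / kappa * t ^+ 2 by rewrite mulr_ge0 ?sqr_ge0// divr_ge0 ?(ltW k0).
apply: (le_trans (ler_wpM2l kt0 hY)).
rewrite mulrDr; apply: lerD.
  rewrite -powRD; last by rewrite (gt_eqF P0) implybT.
  by rewrite subrK le_eqVlt; apply/orP; left; apply/eqP; field; rewrite lt0r_neq0.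
have -> : 40 / kappa * K * (q * A `^ (q - 2)) * (v ^+ 2 * cost A q (g / v)) =
   40 / kappa * K * (v ^+ 2 * (q * A `^ (q - 2) * cost A q (g / v))) by ring.
have -> : 40 / kappa * t ^+ 2 * (K * (g / v) `^ q) = 40 / kappa * K * (t ^+ 2 * (g / v) `^ q).
  by ring.
apply: ler_wpM2l; first by rewrite mulr_ge0// divr_ge0// ltW.
by apply: ler_pM; rewrite ?sqr_ge0 ?powR_ge0// ler_pXn2r ?nnegrE ?(ltW t0) ?(ltW v0).
Qed.

Context {d : nat} (mu : probability (borelRd R d) R) (phi : R -> R).
Variables (kappa beta tau A : R).
Hypotheses (hA1 : condA1 phi) (k0 : 0 < kappa) (b0 : 0 < beta) (bt : 2 * beta <= tau)
  (tau1 : tau <= 1) (A0 : 0 < A)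
  (hw : layer_rate mu (fun s => kappa * phi s `^ beta)).
Variables (v G : 'rV[R]_d -> R).
Hypotheses (vG : slope_le v G) (G0 : forall x, 0 <= G x)
  (mG : measurable_fun setT (G : borelRd R d -> measurableTypeR R))
  (v0 : forall x, 0 <= v x) (v1 : (\int[mu]_x (v x ^+ 2)%:E = 1)%E).

Let q := tau / beta.
Let q2 : 2 <= q. Proof. by rewrite /q ler_pdivlMr. Qed.
Let tau0 : 0 < tau. Proof. by rewrite (lt_le_trans _ bt)// mulr_gt0. Qed.
Let K := 40 / kappa * (kappa / 80) `^ (1 - q) * (q * A `^ (q - 2)).
Let K0 : 0 <= K.
Proof.
have q0 : 0 <= q by exact: le_trans q2.
by apply: mulr_ge0; apply: mulr_ge0 => //; rewrite ?powR_ge0// divr_ge0// ltW.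
Qed.
Let e x := v x ^+ 2 * cost A q (G x / v x).
Let e0 x : 0 <= e x.
Proof. by rewrite mulr_ge0 ?sqr_ge0// cost_ge0// divr_ge0. Qed.
Let mv : measurable_fun setT (v : borelRd R d -> measurableTypeR R).
Proof. exact: slope_le_measurable vG. Qed.
Let me : measurable_fun setT (e : borelRd R d -> measurableTypeR R).
Proof.
apply: measurable_funM; first exact: measurable_funX.
apply: (measurableT_comp (f := cost A q)); first exact: measurable_cost.
apply: measurable_funM => //.
rewrite (_ : (fun x => _) = (fun x => v x `^ (-1))).
  exact: (measurableT_comp (f := @powR R ^~ (-1))).
by apply/funext => x; rewrite powR_inv1.
Qed.
Let C2 := 64 / (kappa * phi 2 `^ beta) ^+ 2.

Let variance_bound : (\int[mu]_x ((v x - 1) ^+ 2)%:E <=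
  (4 * C2 * q)%:E * \int[mu]_x (e x)%:E)%E.
Proof.
have w2 : 0 < kappa * phi 2 `^ beta by rewrite mulr_gt0// powR_gt0// (condA1_gt0 hA1)// ltr1n.
have C0 : 0 <= 4 * C2 by rewrite mulr_ge0// divr_ge0 ?sqr_ge0.
apply: le_trans (variance_le hw w2 vG G0 mG v0 v1) _.
rewrite (EFinM (4 * C2)) -muleA; apply: lee_wpmul2l; first by rewrite lee_fin.
have q0 : 0 <= q by exact: le_trans q2.
have mE : measurable_fun setT (fun x : borelRd R d => (e x)%:E) by exact/measurable_EFinP.
have eE x : setT x -> (0 <= (e x)%:E)%E by rewrite lee_fin.
rewrite -(ge0_integralZl_EFin mu measurableT eE mE q0).
rewrite [leLHS]integral_mkcond; apply: integral_monotone => x _.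
rewrite patchE; case: ifPn => [/set_mem/= vx|_]; last by rewrite mule_ge0 ?lee_fin.
rewrite -EFinM lee_fin /e mulrCA -ler_pdivrMl ?exprn_gt0//.
apply: le_trans (sqr_le_cost A0 q2 _); last by rewrite divr_ge0.
by rewrite expr_div_n mulrC.
Qed.

Let EE0 : (0 <= \int[mu]_x (e x)%:E)%E.
Proof. by apply: integral_ge0 => x _; rewrite lee_fin. Qed.

Let tail_bound (n : nat) :
  (\sum_(j < n) (weight phi tau j)%:E * mu [set x | (level j <= v x)%R] <=
    (2 * weight phi tau 0 * (4 * C2 * q) + 2 * K)%:E * \int[mu]_x (e x)%:E)%E.
Proof.
have C0 : 0 <= 4 * C2 * q.
  have q0 : 0 <= q by exact: le_trans q2.
  by apply: mulr_ge0 => //; apply: mulr_ge0 => //; rewrite divr_ge0 ?sqr_ge0.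
have W0 j : 0 < weight phi tau j by exact: weight_gt0.
case: n => [|n].
  rewrite big_ord0 mule_ge0// lee_fin addr_ge0//; apply: mulr_ge0 => //.
  by apply: mulr_ge0 => //; exact: ltW.
have Ke0 x : 0 <= K * e x by rewrite mulr_ge0.
have mKe : measurable_fun setT ((fun x => K * e x) : borelRd R d -> measurableTypeR R).
  exact: measurable_funM.
have step j : ((weight phi tau j.+1)%:E * mu [set x | (level j.+1 <= v x)%R] <=
     (weight phi tau j / 2)%:E * mu [set x | (level j <= v x)%R] +
     \int[mu]_(x in [set x | (level j <= v x < level j.+1)%R]) (K * e x)%:E)%E.
  have s2 : 2 <= level j ^+ 2 :> R by have := level_sqr_ge4 (R := R) j; lra.
  have P0 : 0 < phi (level j ^+ 2) := phi_level_gt0 hA1 j.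
  have t0 : 0 < level j :> R := level_gt0 j.
  have w0 : 0 < kappa * phi (level j ^+ 2) `^ beta by rewrite mulr_gt0// powR_gt0.
  apply: (dyadic_step hw vG G0 mG Ke0 mKe (level_ltS j) s2 (markov_sqr vG v0 v1 t0) w0
    (W0 j) (ltW (W0 j.+1)) (weightS hA1 tau0 tau1 j)) => x jx xj.
  rewrite levelS in xj.
  have := layer_young k0 b0 bt A0 P0 t0 jx xj (G0 x); apply: le_trans.
  rewrite ler_wpM2r// levelS (_ : 2 * level j - level j = level j); last by ring.
  by rewrite ler_wpM2r ?invr_ge0 ?mulr_ge0 ?powR_ge0 ?(ltW k0) ?(ltW t0)// (weightS hA1 tau0 tau1).
have := dyadic_sum vG Ke0 mKe (mu := mu) (n := n) (@level_ltS R) (fun j => ltW (W0 j))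
  (fun j _ => step j).
set I := (\int[mu]_(x in [set x | (_ <= v x < _)%R]) _)%E => hs.
have hI : (I <= K%:E * \int[mu]_x (e x)%:E)%E.
  have mE : measurable_fun setT (fun x : borelRd R d => (e x)%:E) by exact/measurable_EFinP.
  have eE x : setT x -> (0 <= (e x)%:E)%E by rewrite lee_fin.
  rewrite -(ge0_integralZl_EFin mu measurableT eE mE K0) /I.
  rewrite [leLHS]integral_mkcond; apply: integral_monotone => x _.
  by rewrite patchE; case: ifPn => // _; rewrite mule_ge0 ?lee_fin.
(* The lowest level is 2, and above it [(v - 1)^2 >= 1]; so the first term of the sum is controlled
   by the variance rather than by a layer. *)
have h2 : (mu [set x | (level 0 <= v x)%R] <= (4 * C2 * q)%:E * \int[mu]_x (e x)%:E)%E.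
  rewrite /level expr0 mulr1; exact: le_trans (mass_ge2_le mu vG) variance_bound.
rewrite big_ord_recl /=.
apply: (@le_trans _ _ (2%:E * ((weight phi tau 0)%:E * mu [set x | (level 0 <= v x)%R]) + 2%:E * I)%E).
  rewrite (_ : 2%:E * ((weight phi tau 0)%:E * _) = (weight phi tau 0)%:E * mu [set x | (level 0 <= v x)%R] + (weight phi tau 0)%:E * mu [set x | (level 0 <= v x)%R])%E; last first.
    by rewrite -[X in (X%:E * _)%E]/(1 + 1) EFinD ge0_muleDl ?lee_fin// mul1e.
  by rewrite -addeA leeD2l.
have c1 : 0 <= 2 * weight phi tau 0 * (4 * C2 * q).
  by apply: mulr_ge0 => //; apply: mulr_ge0 => //; exact: ltW.
have c2 : 0 <= 2 * K by exact: mulr_ge0.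
rewrite (EFinD _ (2 * K)) [leRHS]ge0_muleDl ?lee_fin//.
apply: leeD.
  rewrite (EFinM _ (4 * C2 * q)) (EFinM 2) -!muleA lee_wpmul2l ?lee_fin//.
  by rewrite lee_wpmul2l ?lee_fin ?(ltW (W0 0)).
by rewrite (EFinM 2) -muleA lee_wpmul2l ?lee_fin.
Qed.

(** The summand 1 ensures positivity. Neither the dimension nor the measure enters, which makes the
    constant uniform over all measures with the same rate. *)
Definition core_constant (B : R) : R :=
  1 + B * (4 * C2 * q) + 20 / tau * (2 * weight phi tau 0 * (4 * C2 * q) + 2 * K).

Let C20 : 0 <= 4 * C2 * q.
Proof.
have q0 : 0 <= q by exact: le_trans q2.
by apply: mulr_ge0 => //; apply: mulr_ge0 => //; rewrite divr_ge0 ?sqr_ge0.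
Qed.

Let D0 : 0 <= 2 * weight phi tau 0 * (4 * C2 * q) + 2 * K.
Proof.
rewrite addr_ge0//; apply: mulr_ge0 => //.
by apply: mulr_ge0 => //; rewrite ltW// (weight_gt0 hA1).
Qed.

Lemma core_constant_gt0 (B : R) : 0 <= B -> 0 < core_constant B.
Proof.
move=> B0; rewrite /core_constant.
have := mulr_ge0 B0 C20.
have : 0 <= 20 / tau by rewrite divr_ge0// ltW.
move=> /mulr_ge0/(_ D0); lra.
Qed.

(** A measurable step majorant of the tail, up to the factor 20; [phi] is evaluated at the dyadic
    levels only. *)
Let S (x : 'rV[R]_d) := (\sum_(0 <= j <oo)
  (weight phi tau j)%:E * (\1_[set y | (level j <= v y)%R] x)%:E)%E.

Let term_ge0 j (x : borelRd R d) : setT x ->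
  (0 <= (weight phi tau j)%:E * (\1_[set y | (level j <= v y)%R] x)%:E)%E.
Proof. by move=> _; rewrite mule_ge0 ?lee_fin ?indic_ge0// ltW// (weight_gt0 hA1). Qed.

Let mterm j : measurable_fun setT (fun x : borelRd R d =>
  ((weight phi tau j)%:E * (\1_[set y | (level j <= v y)%R] x)%:E)%E).
Proof.
apply: measurable_funeM; apply/measurable_EFinP; apply: measurable_indic.
exact: measurable_ge_set.
Qed.

Let S0 x : (0 <= S x)%E.
Proof. by apply: nneseries_ge0 => j _ _; exact: term_ge0. Qed.

Let mS : measurable_fun setT (S : borelRd R d -> \bar R).
Proof. by apply: ge0_emeasurable_sum => // j x _ _; exact: term_ge0. Qed.

Let int_S : (\int[mu]_x S x <=
  (2 * weight phi tau 0 * (4 * C2 * q) + 2 * K)%:E * \int[mu]_x (e x)%:E)%E.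
Proof.
rewrite (integral_nneseries mu measurableT mterm term_ge0).
apply: lime_le.
  by apply: is_cvg_nneseries => j _ _; apply: integral_ge0 => x; exact: term_ge0.
apply: nearW => n; rewrite big_mkord; apply: le_trans (tail_bound n).
apply: lee_sum => j _.
have ml := measurable_ge_set mv (level j).
rewrite ge0_integralZl_EFin//.
- by rewrite integral_indic// setIT.
- by apply/measurable_EFinP; apply: measurable_indic.
- by rewrite ltW// (weight_gt0 hA1).
Qed.

Let tail_le_S x : 2 <= v x ->
  ((v x ^+ 2 * phi (v x ^+ 2) `^ tau)%:E <= 20%:E * S x)%E.
Proof.
move=> vx; have [j jv h] := tail_le_weight hA1 tau0 tau1 vx.
apply: (@le_trans _ _ (20%:E * (weight phi tau j)%:E)%E); first by rewrite -EFinM lee_fin.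
rewrite lee_wpmul2l ?lee_fin//.
apply: le_trans (nneseries_lim_ge j.+1 _); last by move=> i _ _; exact: (@term_ge0 i x).
rewrite big_nat_recr//= indicE mem_set//= mule1 leeDr//.
by apply: sume_ge0 => i _; exact: (@term_ge0 i x).
Qed.

Lemma core_bound (F : R -> R) (a B N : R) : 0 <= a -> 0 <= B -> 0 < N ->
  (forall t, 0 <= t -> t ^+ 2 * F (t ^+ 2) <= a * (t ^+ 2 - 1) + B * (t - 1) ^+ 2 +
    (if 2 <= t then tau^-1 * (t ^+ 2 * phi (t ^+ 2) `^ tau) else 0)) ->
  (\int[mu]_x (N * (v x ^+ 2 * F (v x ^+ 2)))%:E <=
   (core_constant B)%:E * \int[mu]_x (N * (v x ^+ 2 * cost A q (G x / v x)))%:E)%E.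
Proof.
move=> a0 B0 N0 hF.
have N0' := ltW N0.
have Ene0 x : setT x -> (0 <= (e x)%:E)%E by rewrite lee_fin.
have mEe : measurable_fun setT (fun x : borelRd R d => (e x)%:E) by exact/measurable_EFinP.
have -> : (\int[mu]_x (N * (v x ^+ 2 * cost A q (G x / v x)))%:E =
   N%:E * \int[mu]_x (e x)%:E)%E.
  by rewrite -(ge0_integralZl_EFin mu measurableT Ene0 mEe N0').
have cp := core_constant_gt0 B0.
(* An infinite energy makes the claim trivial. A finite one makes the majorant [H] integrable, which
   is what allows a constant to be subtracted from it below. *)
have [Xoo|] := eqVneq (\int[mu]_x (e x)%:E)%E +oo%E.
  by rewrite Xoo gt0_muley ?lte_fin// gt0_muley ?lte_fin// leey.
rewrite -ltey => Xoo.
have it : 0 <= tau^-1 by rewrite invr_ge0 ltW.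
pose H1 (x : borelRd R d) := a * v x ^+ 2 + B * (v x - 1) ^+ 2.
pose H x := ((H1 x)%:E + (20 / tau)%:E * S x)%E.
have H10 x : 0 <= H1 x by rewrite addr_ge0// mulr_ge0// sqr_ge0.
have t20 : 0 <= 20 / tau by exact: mulr_ge0.
have H0 x : (0 <= H x)%E by rewrite adde_ge0 ?lee_fin// mule_ge0 ?lee_fin.
have m1 : measurable_fun setT (fun x : borelRd R d => v x ^+ 2) by exact: measurable_funX.
have m2 : measurable_fun setT (fun x : borelRd R d => (v x - 1) ^+ 2).
  by apply: measurable_funX; exact: measurable_funB.
have mH1 : measurable_fun setT (fun x => (H1 x)%:E).
  by apply/measurable_EFinP; apply: measurable_funD; exact: measurable_funM.
have mSt : measurable_fun setT (fun x : borelRd R d => ((20 / tau)%:E * S x)%E).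
  exact: measurable_funeM.
have mH : measurable_fun setT (H : borelRd R d -> \bar R) by exact: emeasurable_funD.
have iH : (\int[mu]_x H x = a%:E + B%:E * \int[mu]_x ((v x - 1) ^+ 2)%:E +
    (20 / tau)%:E * \int[mu]_x S x)%E.
  have z1 (x : borelRd R d) : setT x -> (0 <= (H1 x)%:E)%E by rewrite lee_fin.
  have z2 (x : borelRd R d) : setT x -> (0 <= (20 / tau)%:E * S x)%E by rewrite mule_ge0 ?lee_fin.
  have z3 (x : borelRd R d) : setT x -> (0 <= S x)%E by [].
  rewrite (@ge0_integralD _ _ _ mu setT measurableT _ _ z1 mH1 z2 mSt).
  rewrite (ge0_integralZl_EFin mu measurableT z3 mS t20); congr (_ + _)%E.
  have z4 (x : borelRd R d) : setT x -> (0 <= (v x ^+ 2)%:E)%E by rewrite lee_fin sqr_ge0.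
  have z5 (x : borelRd R d) : setT x -> (0 <= ((v x - 1) ^+ 2)%:E)%E by rewrite lee_fin sqr_ge0.
  have z6 (x : borelRd R d) : setT x -> (0 <= a%:E * (v x ^+ 2)%:E)%E.
    by move=> h; rewrite mule_ge0 ?lee_fin ?sqr_ge0.
  have z7 (x : borelRd R d) : setT x -> (0 <= B%:E * ((v x - 1) ^+ 2)%:E)%E.
    by move=> h; rewrite mule_ge0 ?lee_fin ?sqr_ge0.
  have n1 : measurable_fun setT (fun x : borelRd R d => (v x ^+ 2)%:E) by exact/measurable_EFinP.
  have n2 : measurable_fun setT (fun x : borelRd R d => ((v x - 1) ^+ 2)%:E).
    exact/measurable_EFinP.
  have n3 := measurable_funeM a%:E n1; have n4 := measurable_funeM B%:E n2.
  rewrite (@eq_integral _ _ _ mu _ (fun x => a%:E * (v x ^+ 2)%:E + B%:E * ((v x - 1) ^+ 2)%:E)%E); last first.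
    by move=> x _; rewrite /H1 EFinD !EFinM.
  rewrite (@ge0_integralD _ _ _ mu setT measurableT _ _ z6 n3 z7 n4).
  rewrite (ge0_integralZl_EFin mu measurableT z4 n1 a0) v1 mule1.
  by rewrite (ge0_integralZl_EFin mu measurableT z5 n2 B0).
set X := (\int[mu]_x (e x)%:E)%E in Xoo *.
have hH : (\int[mu]_x H x <= a%:E + (core_constant B)%:E * X)%E.
  rewrite iH -addeA leeD2l//.
  have h1 : (B%:E * \int[mu]_x ((v x - 1) ^+ 2)%:E <= (B * (4 * C2 * q))%:E * X)%E.
    by rewrite (EFinM B) -muleA lee_wpmul2l ?lee_fin.
  have h2 : ((20 / tau)%:E * \int[mu]_x S x <=
      (20 / tau * (2 * weight phi tau 0 * (4 * C2 * q) + 2 * K))%:E * X)%E.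
    by rewrite (EFinM (20 / tau)) -muleA lee_wpmul2l ?lee_fin.
  apply: (le_trans (leeD h1 h2)).
  have p1 := mulr_ge0 B0 C20; have p2 := mulr_ge0 t20 D0.
  rewrite -ge0_muleDl ?lee_fin//; apply: lee_wpmul2r => //.
  by rewrite -EFinD lee_fin /core_constant -addrA lerDr.
have iHoo : mu.-integrable setT (fun x : borelRd R d => (N%:E * H x)%E).
  apply: integrableZl => //; apply/integrableP; split => //.
  rewrite (eq_integral H) => [|x _]; last by rewrite gee0_abs.
  apply: (le_lt_trans hH); rewrite lte_add_pinfty ?ltry// lte_mul_pinfty ?lee_fin ?(ltW cp)//.
(* The signed integrand is bounded by [N * (H - a)]; since [v^2] has integral 1, the term [a * v^2]
   inside [H] integrates to [a] and the constant cancels it. *)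
apply: (@le_trans _ _ (\int[mu]_x (N%:E * H x - (N * a)%:E))%E).
  apply: integral_monotone => x _; have := hF _ (v0 x) => h.
  have hx : (((v x ^+ 2 * F (v x ^+ 2)) + a)%:E <= H x)%E.
    apply: (@le_trans _ _ (H1 x + (if 2 <= v x then tau^-1 * (v x ^+ 2 * phi (v x ^+ 2) `^ tau) else 0))%:E).
      rewrite lee_fin /H1; move: h; set I := (if _ then _ else _).
      by rewrite -lerBrDr => /le_trans; apply; rewrite le_eqVlt; apply/orP; left; apply/eqP; ring.
    rewrite EFinD leeD2l//; case: ifPn => [v2|_]; last by rewrite mule_ge0 ?lee_fin.
    rewrite EFinM (mulrC 20) (EFinM tau^-1) -muleA lee_wpmul2l ?lee_fin//.
    exact: tail_le_S.
  rewrite leeBrDr// -EFinD -mulrDr EFinM lee_wpmul2l ?lee_fin//.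
rewrite integralB//; last exact: finite_measure_integrable_cst.
rewrite integral_cst// [X in (_ - _ * X)%E](_ : _ = 1%E) ?mule1; last exact: probability_setT.
have z8 (x : borelRd R d) : setT x -> (0 <= H x)%E by [].
rewrite (ge0_integralZl_EFin mu measurableT z8 mH N0').
rewrite leeBlDr// (EFinM N a) [((core_constant B)%:E * _)%E]muleCA -ge0_muleDr ?lee_fin ?mule_ge0 ?lee_fin ?(ltW cp)//.
by rewrite lee_wpmul2l ?lee_fin// addeC.
Qed.

End Core.

Section FromRate.
Context {R : realType} (phi : R -> R) (x0 A : R).
Hypotheses (hA1 : condA1 phi) (x00 : 0 < x0) (px0 : phi x0 = 1) (A0 : 0 < A).

(** Homogeneity reduces to [v = |f| / ||f||], with slope bound [G] scaled alike. The constant is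
    quantified before the dimension and the measure, so that a single choice serves every measure
    with this rate. *)
Lemma sobolev_of_layer_rate (kappa beta tau : R) : 0 < kappa -> 0 < beta ->
  2 * beta <= tau -> tau <= 1 ->
  exists2 C : R, 0 < C & forall (d : nat) (mu : probability (borelRd R d) R),
    layer_rate mu (fun s => kappa * phi s `^ beta) ->
    forall f, test_function mu f ->
      (F_functional mu (F_tau phi x0 tau) f <=
        C%:E * cost_energy mu (EFin \o cost A (tau / beta)) f)%E.
Proof.
move=> k0 b0 bt t1; have t0 : 0 < tau by rewrite (lt_le_trans _ bt)// mulr_gt0.
have [a [B [a0 B0 hF]]] := F_tau_pointwise hA1 x00 px0 t0 t1.
exists (core_constant phi kappa beta tau A B); first exact: core_constant_gt0.
move=> d mu hw f [sf f0 foo].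
pose N := fine (sq_integral mu f).
have NE : sq_integral mu f = N%:E by rewrite fineK// ge0_fin_numE// ltW.
have N0 : 0 < N by rewrite -lte_fin -NE.
pose rN := (Num.sqrt N)^-1.
have rN0 : 0 < rN by rewrite invr_gt0 sqrtr_gt0.
have rN2 : rN ^+ 2 = N^-1 by rewrite exprVn sqr_sqrtr// ltW.
pose v (x : 'rV[R]_d) := rN * `|f x|.
pose G (x : 'rV[R]_d) := rN * enorm (grad f x).
have vG : slope_le v G.
  move=> x e e0; have e1 : 0 < e / rN by rewrite divr_gt0.
  have [r r0 h] := smooth_slope_le sf x e1; exists r => // y z yr zr.
  rewrite /v /G -mulrBr normrM gtr0_norm//.
  apply: (@le_trans _ _ (rN * `|f y - f z|)).
    by rewrite ler_pM2l// ler_dist_dist.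
  have -> : rN * enorm (grad f x) + e = rN * (enorm (grad f x) + e / rN).
    by field; exact: lt0r_neq0.
  by rewrite -mulrA ler_pM2l//; exact: h.
have G0 x : 0 <= G x by rewrite mulr_ge0 ?enorm_ge0 ?(ltW rN0).
have mG : measurable_fun setT (G : borelRd R d -> measurableTypeR R).
  by apply: measurable_funM => //; exact: measurable_enorm_grad.
have v0 x : 0 <= v x by rewrite mulr_ge0 ?(ltW rN0).
have v2 x : v x ^+ 2 = f x ^+ 2 / N by rewrite /v exprMn rN2 real_normK ?num_real// mulrC.
have mf : measurable_fun setT (f : borelRd R d -> measurableTypeR R).
  by apply: continuous_measurable_borelRd; exact: smooth_continuous.
have v1 : (\int[mu]_x (v x ^+ 2)%:E = 1)%E.
  rewrite (@eq_integral _ _ _ mu _ (fun x => (N^-1)%:E * (f x ^+ 2)%:E)%E); last first.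
    by move=> x _; rewrite v2 mulrC EFinM.
  rewrite ge0_integralZl_EFin// ?invr_ge0 ?(ltW N0)//.
  - by rewrite -/(sq_integral mu f) NE -EFinM mulVf// lt0r_neq0.
  - by move=> x _; rewrite lee_fin sqr_ge0.
  - by apply/measurable_EFinP; exact: measurable_funX.
have := core_bound hA1 k0 b0 bt t1 A0 hw vG G0 mG v0 v1 a0 B0 N0 hF.
congr (_ <= _)%E.
  apply: eq_integral => x _; rewrite -/N v2; congr EFin.
  by rewrite mulrA mulrCA divff ?mulr1// lt0r_neq0.
congr (_ * _)%E; apply: eq_integral => x _; rewrite v2 EFinM -[in RHS]EFinM.
rewrite -EFinM mulrA mulrCA divff ?mulr1 ?lt0r_neq0//; congr (_ * cost _ _ _)%:E.
by rewrite /G /v -mulf_div divff ?mul1r// lt0r_neq0.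
Qed.

(** The two special cases are the ends of the range of [tau]: at [2 * (1 - alpha^-1)] the exponent
    is 2 and the cost is [y^2 / 2]; at 1, [F_tau] is [phi] and the exponent is conjugate to
    [alpha]. *)
Lemma modified_sobolevI (d : nat) (mu : probability (borelRd R d) R) (alpha : R) (C : R -> R) :
  1 < alpha -> alpha <= 2 ->
  (forall tau, 2 * (1 - alpha^-1) <= tau -> tau <= 1 -> 0 < C tau /\
    forall f, test_function mu f ->
      (F_functional mu (F_tau phi x0 tau) f <=
        (C tau)%:E * cost_energy mu (EFin \o cost A (tau / (1 - alpha^-1))) f)%E) ->
  modified_sobolev mu phi x0 A alpha C.
Proof.
move=> a1 a2 H; have a0 : 0 < alpha by exact: lt_trans a1.
have beta0 : 0 < 1 - alpha^-1 by rewrite subr_gt0 invf_lt1.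
have qE tau : alpha * tau / (alpha - 1) = tau / (1 - alpha^-1).
  by field; rewrite !lt0r_neq0// subr_gt0.
have tle : 2 * (1 - alpha^-1) <= 1.
  rewrite mulrBr mulr1 lerBlDr -lerBlDl (_ : 2 - 1 = 1); last by ring.
  by rewrite ler_pdivlMr// mul1r.
split.
- move=> tau /andP[t1 t2]; have [? h] := H tau t1 t2; split => // f hf.
  by rewrite qE; exact: h.
- move=> f hf; have [Cp h] := H _ (lexx _) tle.
  apply: le_trans (h f hf) _; rewrite lee_wpmul2l ?lee_fin ?(ltW Cp)//.
  apply: integral_monotone => x _.
  rewrite /= mulfK ?lt0r_neq0// -EFinM lee_fin.
  have cost2 y : 0 <= y -> cost A 2 y = y ^+ 2 / 2.
    move=> y0; rewrite /cost; case: ifP => // _.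
    by rewrite subrr powRr0 mul1r mul0r mulr0 addr0 ger0_norm// powR_mulrn.
  rewrite cost2 ?divr_ge0 ?enorm_ge0//; set p := enorm _.
  rewrite expr_div_n real_normK ?num_real// mulrA mulrCA.
  (* At a zero of [f] the cost side is 0 by the convention for the inverse of 0; elsewhere the
     factors [f^2] cancel. *)
  have [->|fx] := eqVneq (f x) 0; first by rewrite expr0n /= invr0 !(mulr0, mul0r) sqr_ge0.
  by rewrite divff ?sqrf_eq0// mulr1 ler_piMr ?sqr_ge0// invf_le1// ler1n.
have tau1 y : F_tau phi x0 1 y = phi y.
  rewrite /F_tau; case: leP => // yx.
  rewrite invr1 mul1r powRr1 ?subrK// ltW// (condA1_gt0 hA1)//.
  apply: le_lt_trans yx; rewrite leNgt; apply/negP => /ltW/(condA1_le hA1 x00).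
  by rewrite px0 (condA1_1 hA1) ler10.
move=> f hf; have [Cp h] := H _ tle (lexx _).
have eq1 : cost_energy mu (conjugate (cost A alpha)) f =
    cost_energy mu (EFin \o cost A (alpha / (alpha - 1))) f.
  by apply: eq_integral => x _; rewrite conjugate_cost// divr_ge0 ?enorm_ge0.
rewrite eq1; split => //.
have := h f hf; rewrite -qE mulr1; apply: le_trans.
by apply: integral_monotone => x _; rewrite tau1.
Qed.

End FromRate.

(** * The two layer rates *)

Section IsoperimetricRate.
Context {R : realType} {d : nat} (mu : probability (borelRd R d) R).

Lemma boundary_measure_ge0 (S : set (borelRd R d)) : measurable S ->
  (0 <= boundary_measure mu S)%E.
Proof.
move=> mS; rewrite /boundary_measure limf_einfE.
apply: (@le_trans _ _ (ereal_inf [set ((h^-1)%:E * (mu (enlargement S h) - mu S))%E | h in [set h : R | 0 < h]])).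
  apply: le_ereal_inf_tmp => _ [h /= h0 <-]; rewrite mule_ge0//.
    by rewrite lee_fin invr_ge0 ltW.
  rewrite sube_ge0 ?fin_num_measure//; last exact: measurable_enlargement.
  apply: le_measure; rewrite ?inE//; first exact: measurable_enlargement.
  move=> x Sx; apply: (@le_trans _ _ 0%E); last by rewrite lee_fin ltW.
  by apply: ereal_inf_lbound; exists x => //; rewrite subrr enorm0.
apply: ereal_sup_ubound; exists [set h : R | 0 < h] => //.
exact: nbhs_right_gt.
Qed.

(** A subset of {v > a} has mass at most [1 / s], so [phi] evaluated at its inverse mass is at least
    [phi s]: one rate holds for all superlevel sets in the layer. The 1/4 comes from the coarea
    inequality. *)
Lemma layer_rate_of_isoperimetry (phi : R -> R) (k beta : R) : condA1 phi -> 0 < k -> 0 < beta ->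
  (forall t : R, 0 < t -> t <= 2^-1 ->
    ((k * t * phi t^-1 `^ beta)%:E <= isoperimetric_function mu t)%E) ->
  layer_rate mu (fun s => k / 4 * phi s `^ beta).
Proof.
move=> hA1 k0 b0 hI v G a b s vG G0 mG ab s2 ps _.
have mv := slope_le_measurable vG.
have s0 : 0 < s by exact: lt_le_trans s2.
have phs : 0 < phi s by apply: (condA1_gt0 hA1); lra.
have w0 : 0 <= k * phi s `^ beta by rewrite mulr_ge0 ?powR_ge0 ?(ltW k0).
have := @isoperimetric_layer _ _ mu _ _ _ _ vG G0 mG ab _ w0.
have HS (S : set (borelRd R d)) : measurable S -> S `<=` [set x | a < v x] ->
    ((k * phi s `^ beta)%:E * mu S <= boundary_measure mu S)%E.
  move=> mS Sa; have Sfin := fin_num_measure mu _ mS.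
  (* Null sets escape the isoperimetric hypothesis, which concerns [t > 0]; for them nonnegativity
     of the boundary measure is enough. *)
  have := measure_ge0 mu S; rewrite le_eqVlt => /predU1P[<-|Spos].
    by rewrite mule0; exact: boundary_measure_ge0.
  set m := fine (mu S); have mE : mu S = m%:E by rewrite fineK.
  have m0 : 0 < m by rewrite -lte_fin -mE.
  have ms : m <= s^-1.
    rewrite -lee_fin -mE; apply: le_trans ps.
    by apply: le_measure; rewrite ?inE//; exact: measurable_gt_set.
  have m2 : m <= 2^-1 by apply: le_trans ms _; rewrite lef_pV2 ?posrE.
  apply: (@le_trans _ _ (isoperimetric_function mu m)); last first.
    by apply: ereal_inf_lbound; exists S.
  apply: le_trans (hI m m0 m2); rewrite mE -EFinM lee_fin.
  rewrite mulrAC ler_wpM2l// ?mulr_ge0 ?(ltW k0) ?(ltW m0)//.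
  have sm : s <= m^-1 by rewrite -[s]invrK lef_pV2 ?posrE ?invr_gt0.
  have := condA1_le hA1 s0 sm => h.
  by rewrite ge0_ler_powR ?nnegrE ?(ltW b0) ?(ltW phs)// (le_trans (ltW phs)).
move=> /(_ HS) h.
rewrite (_ : k / 4 * phi s `^ beta * (b - a) = 4^-1 * (k * phi s `^ beta * (b - a))); last by ring.
by rewrite EFinM -muleA lee_pdivrMl.
Qed.

End IsoperimetricRate.

(** * Near-concavity of [phi] composed with the exponential *)

Section NearConcavity.
Context {R : realType} (phi : R -> R).
Hypotheses (hA1 : condA1 phi) (hA4 : condA4 phi).

Lemma phi_expR_gt0 (l : R) : 0 < l -> 0 < phi (expR l).
Proof. by move=> l0; apply: (condA1_gt0 hA1); rewrite -expR0 ltr_expR. Qed.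

Lemma phi_expR_mean_value (y0 a b : R) : 0 < y0 ->
  (forall y, y0 <= y -> derivable phi y 1) -> y0 <= expR a -> a < b ->
  exists2 x, a < x < b & phi (expR b) - phi (expR a) = expR x * derive1 phi (expR x) * (b - a).
Proof.
move=> y00 dphi ya ab.
have dfe x : a <= x -> is_derive x (1 : R) (phi \o expR) (expR x * derive1 phi (expR x)).
  move=> ax; have dx : is_derive (expR x) (1 : R) phi (derive1 phi (expR x)).
    by rewrite derive1E; apply: derivableP; apply: dphi; rewrite (le_trans ya)// ler_expR.
  by rewrite mulrC; exact: is_derive1_comp.
have dI x : x \in `]a, b[ -> is_derive x (1 : R) (phi \o expR) (expR x * derive1 phi (expR x)).
  by rewrite in_itv/= => /andP[/ltW ax _]; exact: dfe.
have cI : {within `[a, b], continuous (phi \o expR)}.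
  apply: continuous_in_subspaceT => x; rewrite inE/= in_itv/= => /andP[ax _].
  have [dd _] := dfe x ax.
  exact/differentiable_continuous/derivable1_diffP.
by have [x] := MVT ab dI cI; rewrite in_itv/=; exists x.
Qed.

(* By (A4), [omega l := phi (expR l)] is concave on a half-line, where its derivative is at most 1; near 0 both sides are linear by concavity of [phi]. *)
Lemma phi_expR_near_concave : exists2 C : R, 1 <= C & forall l L : R, 0 < l -> l <= L ->
  phi (expR L) * l <= C * phi (expR l) * L.
Proof.
have [y0 y1 [dphi dec le1]] := hA4.
have y00 : 0 < y0 by exact: lt_le_trans y1.
have [a a0 ha] := condA1_tangent hA1.
pose s := ln y0 + 1.
have s1 : 1 <= s by rewrite lerDr ln_ge0.
have s0 : 0 < s by exact: lt_le_trans s1.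
have ys : y0 <= expR s.
  by rewrite -[y0]lnK ?posrE// ler_expR lerDl.
pose w0 := phi (expR s).
have w00 : 0 < w0 by exact: phi_expR_gt0.
(* Write [omega] for [phi o exp]. From [omega s >= m * s], [m <= 1] and a nonincreasing derivative
   at most 1 beyond [s] follows [omega l >= m * l * omega' l] for [l >= s], a substitute for a graph
   lying above its chords from the origin. *)
pose m := Num.min 1 (w0 / s).
have m0 : 0 < m by rewrite lt_min ltr01 divr_gt0.
have m1 : m <= 1 by rewrite ge_min lexx.
have mw : m * s <= w0 by rewrite -ler_pdivlMr// ge_min lexx orbT.
(* For [l < s] two linear bounds suffice: [phi (expR L) <= M * L] for all [L > 0], and
   [phi (expR l) >= c1 * l], the latter by comparison with the chord of [phi] from 1 to [expR s]. *)
pose M := a * expR s + 1.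
have M0 : 0 < M by rewrite ltr_wpDl// mulr_ge0// expR_ge0.
pose c1 := w0 / (expR s - 1).
have es : 0 < expR s - 1 by rewrite subr_gt0 -expR0 ltr_expR.
have c10 : 0 < c1 by exact: divr_gt0.
pose D x := expR x * derive1 phi (expR x).
have D1 x : s <= x -> D x <= 1.
  by move=> sx; apply: le1; rewrite (le_trans ys)// ler_expR.
have Ddec x y : s <= x -> x <= y -> D y <= D x.
  by move=> sx xy; apply: dec; [rewrite (le_trans ys)// ler_expR|rewrite ler_expR].
have mv l L : s <= l -> l < L -> exists2 x, l < x < L & phi (expR L) - phi (expR l) = D x * (L - l).
  by move=> sl; apply: (phi_expR_mean_value y00 dphi); rewrite (le_trans ys)// ler_expR.
exists (m^-1 + M / c1 + 1).
  by rewrite lerDr addr_ge0// ltW// ?invr_gt0// divr_gt0.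
move=> l L l0 lL; have L0 : 0 < L by exact: lt_le_trans lL.
have wl := phi_expR_gt0 l0; have wL := phi_expR_gt0 L0.
have P0 : 0 <= phi (expR l) * L by rewrite mulr_ge0 ?ltW.
have [sl|ls] := leP s l.
  suff h : phi (expR L) * l <= m^-1 * (phi (expR l) * L).
    apply: (le_trans h); rewrite -(mulrA _ (phi _)) ler_wpM2r// -addrA lerDl addr_ge0// divr_ge0 ?(ltW M0)//.
    by rewrite ltW.
  rewrite ler_pdivlMl//.
  move: lL; rewrite le_eqVlt => /predU1P[<-|lL]; first by rewrite ler_piMl// mulr_ge0 ?ltW.
  have [x /andP[lx xL] hx] := mv _ _ sl lL.
  have hD : D x <= D l by apply: Ddec => //; exact: ltW.
  have hl : m * l * D l <= phi (expR l).
    have [Dl|Dl] := leP (D l) 0.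
      by apply: le_trans (ltW wl); rewrite mulr_ge0_le0// ltW// mulr_gt0.
    move: sl; rewrite le_eqVlt => /predU1P[sl|sl].
      by rewrite -sl -/w0; apply: le_trans mw; rewrite ler_piMr ?D1// ltW// mulr_gt0.
    have [z /andP[sz zl] hz] := mv _ _ (lexx s) sl.
    have h1 : D l <= D z by apply: Ddec; exact: ltW.
    have h2 := D1 l (ltW sl); rewrite -/w0 in hz.
    have h3 : D l * (l - s) <= D z * (l - s) by rewrite ler_wpM2r// subr_ge0 ltW.
    have h4 : m * (l - s) <= l - s by rewrite ler_piMl// subr_ge0 ltW.
    have h5 := ler_wpM2l (ltW Dl) h4.
    have h6 : D l * (m * s) <= m * s by rewrite ler_piMl// ltW// mulr_gt0.
    have -> : m * l * D l = D l * (m * (l - s)) + D l * (m * s) by ring.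
    have -> : phi (expR l) = D z * (l - s) + w0 by rewrite -hz subrK.
    by apply: lerD; [exact: le_trans h5 h3|exact: le_trans h6 mw].
  have -> : phi (expR L) = D x * (L - l) + phi (expR l) by rewrite -hx subrK.
  have h7 : D x * (L - l) <= D l * (L - l) by rewrite ler_wpM2r// subr_ge0 ltW.
  have h8 : m * l * (D x * (L - l)) <= phi (expR l) * (L - l).
    apply: (@le_trans _ _ (m * l * D l * (L - l))).
      by rewrite -(mulrA (m * l)) ler_wpM2l// ltW// mulr_gt0.
    by rewrite ler_wpM2r// subr_ge0 ltW.
  have h9 : m * (phi (expR l) * l) <= phi (expR l) * l by rewrite ler_piMl// ltW// mulr_gt0.
  have -> : m * ((D x * (L - l) + phi (expR l)) * l) =
    m * l * (D x * (L - l)) + m * (phi (expR l) * l) by ring.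
  have -> : phi (expR l) * L = phi (expR l) * (L - l) + phi (expR l) * l by ring.
  exact: lerD.
have hl : c1 * l <= phi (expR l).
  have h1 : l <= expR l - 1 by rewrite lerBrDl; exact: expR_ge1Dx.
  have el : 1 < expR l by rewrite -expR0 ltr_expR.
  have h2 : expR l <= expR s by rewrite ler_expR ltW.
  have := condA1_ratio hA1 el h2; rewrite -/w0 => h3.
  apply: (@le_trans _ _ (c1 * (expR l - 1))); first by rewrite ler_wpM2l// ltW.
  by rewrite /c1 mulrAC ler_pdivrMr.
have hs K : 0 < K -> K <= s -> phi (expR K) <= a * expR s * K.
  move=> K0 Ks; apply: le_trans (ha _ (expR_gt0 K)) _.
  rewrite -mulrA ler_wpM2l//; apply: (@le_trans _ _ (expR K * K)).
    have := expR_ge1Dx (- K); rewrite expRN => h.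
    have := ler_wpM2l (expR_ge0 K) h; rewrite divff ?gt_eqF ?expR_gt0//; lra.
  by rewrite ler_wpM2r ?(ltW K0)// ler_expR.
have hL : phi (expR L) <= M * L.
  have [Ls|sL] := leP L s.
    apply: (le_trans (hs L L0 Ls)); rewrite ler_wpM2r ?(ltW L0)//.
    by rewrite /M lerDl.
  have [x /andP[sx xL] hx] := mv _ _ (lexx s) sL.
  have h1 : D x * (L - s) <= 1 * (L - s).
    by rewrite ler_wpM2r ?D1 ?subr_ge0// ltW.
  have h2 := hs s s0 (lexx s); rewrite -/w0 in h2 hx.
  have h3 : a * expR s * s <= a * expR s * L.
    by rewrite ler_wpM2l ?mulr_ge0 ?expR_ge0// ltW.
  rewrite /M; lra.
suff h : phi (expR L) * l <= M / c1 * (phi (expR l) * L).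
  apply: (le_trans h); rewrite -(mulrA _ (phi _)) ler_wpM2r// addrAC lerDr addr_ge0// invr_ge0 ltW//.
apply: (@le_trans _ _ (M * L * l)); first by rewrite ler_wpM2r// ltW.
rewrite (_ : M * L * l = M / c1 * (c1 * l * L)); last by field; exact: lt0r_neq0.
apply: ler_wpM2l; first by rewrite divr_ge0 ?(ltW M0) ?(ltW c10).
by apply: ler_wpM2r => //; exact: ltW.
Qed.

(** The factor [C * L / l] is at least 1, so raising it to a power [beta <= 1] only decreases it. *)
Lemma powR_phi_expR_near_concave (beta : R) : 0 < beta -> beta <= 1 ->
  exists2 C : R, 1 <= C & forall l L : R, 0 < l -> l <= L ->
    l * phi (expR L) `^ beta <= C * L * phi (expR l) `^ beta.
Proof.
move=> b0 b1; have [C C1 hC] := phi_expR_near_concave; exists C; first exact: C1.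
move=> l L l0 lL; have L0 : 0 < L by exact: lt_le_trans lL.
have C0 : 0 < C by exact: lt_le_trans C1.
have wl := phi_expR_gt0 l0; have wL := phi_expR_gt0 L0.
have h : phi (expR L) <= C * L / l * phi (expR l).
  rewrite -(ler_pM2r l0); apply: le_trans (hC l L l0 lL) _.
  by rewrite le_eqVlt; apply/orP; left; apply/eqP; field; exact: lt0r_neq0.
have t1 : 1 <= C * L / l by rewrite ler_pdivlMr// mul1r (le_trans lL)// ler_peMl// ltW.
have h2 : phi (expR L) `^ beta <= C * L / l * phi (expR l) `^ beta.
  apply: (@le_trans _ _ ((C * L / l * phi (expR l)) `^ beta)).
    by rewrite ge0_ler_powR ?nnegrE ?(ltW b0) ?(ltW wL)// (le_trans (ltW wL)).
  rewrite powRM ?(ltW wl) ?(le_trans ler01 t1)// ler_wpM2r ?powR_ge0//.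
  exact: ler1_powR.
apply: le_trans (ler_wpM2l (ltW l0) h2) _.
by rewrite le_eqVlt; apply/orP; left; apply/eqP; field; exact: lt0r_neq0.
Qed.

End NearConcavity.

(** * Concentration radius and layer rate for log-concave measures *)

Section LogConcaveRate.
Context {R : realType} {d : nat} (mu : probability (borelRd R d) R).
Variables (phi g : R -> R) (c beta : R).
Hypotheses (hA1 : condA1 phi) (hA4 : condA4 phi) (c0 : 0 < c) (b0 : 0 < beta) (b1 : beta <= 1).
Hypothesis ginc : forall r s : R, 0 <= r -> r < s -> g r < g s.
Hypothesis gint : (\int[mu]_x (expR (g (enorm x)))%:E = 1)%E.
Hypothesis ghyp : forall r : R, 0 <= r -> 0 < g r -> c * r <= g r / (phi (expR (g r)) `^ beta).

Let gle r s : 0 <= r -> r <= s -> g r <= g s.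
Proof. by move=> r0; rewrite le_eqVlt => /predU1P[->//|/(ginc r0)/ltW]. Qed.

Let mfar r : measurable ([set x | r <= enorm x] : set (borelRd R d)).
Proof.
apply: measurable_ge_set; apply: continuous_measurable_borelRd; exact: continuous_enorm.
Qed.

Lemma exp_moment_tail (r L : R) : 0 <= r -> L <= g r ->
  fine (mu [set x | r <= enorm x]) <= expR (- L).
Proof.
move=> r0 Lr; rewrite expRN -[leRHS]mul1r ler_pdivlMr ?expR_gt0// mulrC -lee_fin EFinM.
rewrite fineK ?fin_num_measure// -gint -(setIT [set x | r <= enorm x]).
rewrite -(integral_indic mu measurableT (mfar r)).
have z1 (x : borelRd R d) : setT x -> (0 <= (\1_[set x | r <= enorm x] x)%:E :> \bar R)%E.
  by rewrite lee_fin.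
have m1 : measurable_fun setT (fun x : borelRd R d => (\1_[set x | r <= enorm x] x)%:E : \bar R).
  by apply/measurable_EFinP; exact: measurable_indic.
rewrite -(ge0_integralZl_EFin mu measurableT z1 m1 (expR_ge0 L)).
apply: integral_monotone => x _; rewrite -EFinM lee_fin indicE.
case: (boolP (x \in _)) => [/set_mem/= h|_]; last by rewrite mulr0 expR_ge0.
by rewrite mulr1 ler_expR (le_trans Lr)// gle.
Qed.

(** Otherwise [g <= 0] on the half-line, hence [g M < 0] by strict monotonicity; then [e^g] is at
    most [e^(g M) < 1] on a ball of positive mass and at most 1 elsewhere, so its integral would be
    below 1. A radius with [g > 0] is needed to enter [ghyp]. *)
Lemma exp_moment_pos : exists2 r : R, 0 <= r & 0 < g r.
Proof.
apply: contrapT => hn.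
have g0 r : 0 <= r -> g r <= 0.
  by move=> r0; rewrite leNgt; apply/negP => h; apply: hn; exists r.
have [N hN] := probability_tight mu (ltr01 : 0 < 1 :> R).
pose M : R := N.+1%:R.
have M0 : 0 <= M by [].
have gM : g M < 0.
  by apply: lt_le_trans (g0 (M + 1) _); [apply: ginc => //; rewrite ltrDl|rewrite addr_ge0].
have eM : expR (g M) < 1 by rewrite -expR0 ltr_expR.
have mF : measurable ([set x | M < enorm x] : set (borelRd R d)).
  apply: measurable_gt_set; apply: continuous_measurable_borelRd; exact: continuous_enorm.
have : (1 <= (expR (g M) + (1 - expR (g M)) * fine (mu [set x | (M < enorm x)%R]))%:E :> \bar R)%E.
  rewrite -{1}gint; apply: (@le_trans _ _ (\int[mu]_x ((expR (g M))%:E + (1 - expR (g M))%:E * (\1_[set x | M < enorm x] x)%:E))%E).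
    apply: integral_monotone => x _; rewrite -EFinM -EFinD lee_fin indicE.
    case: (boolP (x \in _)) => [_|/negP h].
      by rewrite mulr1 addrC subrK -expR0 ler_expR g0// enorm_ge0.
    rewrite mulr0 addr0 ler_expR gle ?enorm_ge0//.
    by rewrite leNgt; apply/negP => h'; apply: h; apply/mem_set.
  have d0 : 0 <= 1 - expR (g M) by rewrite subr_ge0 ltW.
  have mI : measurable_fun setT (fun x : borelRd R d => (\1_[set x | M < enorm x] x)%:E : \bar R).
    by apply/measurable_EFinP; exact: measurable_indic.
  have z1 (x : borelRd R d) : setT x -> (0 <= (expR (g M))%:E :> \bar R)%E.
    by rewrite lee_fin expR_ge0.
  have z2 (x : borelRd R d) : setT x ->
      (0 <= (1 - expR (g M))%:E * (\1_[set x | M < enorm x] x)%:E :> \bar R)%E.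
    by move=> _; rewrite mule_ge0 ?lee_fin.
  have m1 : measurable_fun setT (fun _ : borelRd R d => (expR (g M))%:E : \bar R) by [].
  have m2 := measurable_funeM (1 - expR (g M))%:E mI.
  rewrite (@ge0_integralD _ _ _ mu setT measurableT _ _ z1 m1 z2 m2).
  rewrite integral_cst// [X in (_ * X)%E](_ : _ = 1%E) ?mule1; last exact: probability_setT.
  have z3 (x : borelRd R d) : setT x -> (0 <= (\1_[set x | M < enorm x] x)%:E :> \bar R)%E.
    by rewrite lee_fin.
  rewrite (ge0_integralZl_EFin mu measurableT z3 mI d0).
  by rewrite integral_indic// setIT (EFinD (expR _)) (EFinM _ (fine _)) fineK// fin_num_measure.
rewrite lee_fin leNgt => /negP; apply.
have hm := hN N (leqnn N); rewrite -/M in hm.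
have d0 : 0 < 1 - expR (g M) by rewrite subr_gt0.
have := ltr_pM2l d0 (fine (mu [set x | M < enorm x])) 1; rewrite hm mulr1 => hh.
by rewrite -ltrBrDl hh.
Qed.

(** If [g r] were below [L = ln (640 s)], near-concavity would turn [ghyp] at [r] into the same
    bound with [L] in place of [g r], that is [r <= r0]. A larger radius therefore has [g r >= L],
    and the exponential moment gives tail mass at most [e^(-L)]. *)
Lemma concentration_radius : exists2 K : R, 0 < K & forall s : R, 2 <= s ->
  exists r : R, [/\ 0 < r, fine (mu [set x | r <= enorm x]) <= (640 * s)^-1 &
    r * phi s `^ beta <= K * ln s].
Proof.
(* 640 = 40 * 16: at [s = 1 / p0] the tail is at most [p0 / 640], and a mass at least [p0 / 40] at
   the top of the layer makes this at most 1/16 of that mass. The numeral is hidden behind a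
   variable. *)
have [k k1 <-] : exists2 k : R, 1 <= k & k = 640 by exists 640 => //; rewrite ler1n.
have k0 : 0 < k by exact: lt_le_trans k1.
have [C C1 hC] := powR_phi_expR_near_concave hA1 hA4 b0 b1.
have C0 : 0 < C by exact: lt_le_trans C1.
have [rg rg0 grg] := exp_moment_pos.
have ln2 : 0 < ln 2 :> R by rewrite ln_gt0// ltr1n.
pose La : R := ln k / ln 2 + 1.
have La1 : 0 < La by rewrite ltr_wpDl// divr_ge0 ?(ltW ln2)// ln_ge0.
exists (2 * (C / c * La) + rg * (C * phi 2 `^ beta / ln 2)).
  rewrite ltr_pwDl//; first by rewrite !mulr_gt0 ?invr_gt0.
  by rewrite mulr_ge0// divr_ge0 ?(ltW ln2)// mulr_ge0 ?powR_ge0 ?(ltW C0).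
move=> s s2; have s0 : 0 < s by exact: lt_le_trans s2.
have lns : ln 2 <= ln s by rewrite ler_ln ?posrE.
have lns0 : 0 < ln s by exact: lt_le_trans lns.
pose L := ln (k * s).
have LE : L = ln k + ln s by rewrite /L lnM ?posrE.
have lk : 0 <= ln k :> R by rewrite ln_ge0.
have lnsL : ln s <= L by rewrite LE lerDr.
have L0 : 0 < L by exact: lt_le_trans lnsL.
have LLa : L <= La * ln s.
  rewrite LE /La mulrDl mul1r lerD2r mulrAC ler_pdivlMr//.
  exact: ler_wpM2l.
have phs : 0 < phi s by apply: (condA1_gt0 hA1); lra.
have phs' : 0 < phi s `^ beta by exact: powR_gt0.
have eL : expR L = k * s by rewrite /L lnK// posrE mulr_gt0.
have phL : phi s <= phi (expR L).
  by apply: (condA1_le hA1) => //; rewrite eL ler_peMl ?(ltW s0).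
have pL : phi s `^ beta <= phi (expR L) `^ beta.
  by rewrite ge0_ler_powR ?nnegrE ?(ltW b0) ?(ltW phs)// (le_trans (ltW phs)).
pose r0 := C / c * L / phi s `^ beta.
have r00 : 0 < r0 by rewrite !mulr_gt0 ?invr_gt0.
(* Doubling [r0] makes the radius exceed it strictly; adding [rg] makes [g] positive there. *)
exists (2 * r0 + rg).
have rr : rg <= 2 * r0 + rg by rewrite lerDr mulr_ge0 ?(ltW r00).
have rp : 0 < 2 * r0 + rg by rewrite ltr_pwDl// mulr_gt0.
have gr0 : 0 < g (2 * r0 + rg) by apply: lt_le_trans grg _; exact: gle.
split => //.
- have -> : (k * s)^-1 = expR (- L) by rewrite expRN eL.
  apply: exp_moment_tail; first exact: ltW.
  rewrite leNgt; apply/negP => grL.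
  have h1 := ghyp (ltW rp) gr0; set r := 2 * r0 + rg in h1 rp rr grL gr0.
  have h2 := hC _ _ gr0 (ltW grL).
  have pg : 0 < phi (expR (g r)) `^ beta by rewrite powR_gt0// phi_expR_gt0.
  rewrite ler_pdivlMr// in h1.
  have h3 : c * r * phi (expR (g r)) `^ beta * phi s `^ beta <= C * L * phi (expR (g r)) `^ beta.
    apply: le_trans h2; apply: (ler_pM _ (ltW phs') h1 pL).
    by apply: mulr_ge0 (ltW pg); apply: mulr_ge0; exact: ltW.
  rewrite mulrAC ler_pM2r// in h3.
  have h4 : r <= r0.
    rewrite /r0 ler_pdivlMr// -(ler_pM2l c0) mulrA (le_trans h3)//.
    by rewrite mulrA (mulrCA c) divff ?mulr1// lt0r_neq0.
  move: h4; apply/negP; rewrite -ltNge /r mulr_natl mulr2n -addrA ltrDl.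
  by rewrite (lt_le_trans r00)// lerDl.
rewrite mulrDl [leRHS]mulrDl; apply: lerD.
  have -> : 2 * r0 * phi s `^ beta = 2 * (C / c) * L by rewrite /r0 -mulrA divfK ?lt0r_neq0// mulrA.
  have -> : 2 * (C / c * La) * ln s = 2 * (C / c) * (La * ln s) by ring.
  by apply: ler_wpM2l => //; apply: mulr_ge0 => //; rewrite divr_ge0 ?(ltW C0) ?(ltW c0).
(* The fixed part [rg] of the radius is also of the required order: near-concavity between [ln 2]
   and [ln s] bounds [phi s ^ beta] by a multiple of [ln s]. *)
rewrite -!mulrA ler_wpM2l//.
have := hC _ _ ln2 lns; rewrite !lnK ?posrE// => h.
rewrite (_ : C * (phi 2 `^ beta * ((ln 2)^-1 * ln s)) = (C * ln s * phi 2 `^ beta) / ln 2); last by ring.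
by rewrite ler_pdivlMr// mulrC.
Qed.

Lemma layer_rate_of_log_concave : log_concave mu ->
  exists2 kappa : R, 0 < kappa & layer_rate mu (fun s => kappa * phi s `^ beta).
Proof.
move=> lc; have [K K0 hK] := concentration_radius.
have K16 : 0 < (16 * K)^-1 by rewrite invr_gt0 mulr_gt0.
exists (16 * K)^-1 => // v G a b s vG G0 mG ab s2 ps p1.
have mv := slope_le_measurable vG.
have ma := measurable_gt_set mv a; have mb := measurable_ge_set mv b.
have I0 : (0 <= \int[mu]_(x in [set x | (a <= v x < b)%R]) (G x)%:E)%E.
  by apply: integral_ge0 => x _; rewrite lee_fin.
have := measure_ge0 mu [set x | a < v x]; rewrite le_eqVlt => /predU1P[pz|ppos].
  rewrite [X in (_ * X)%E](_ : _ = 0%E) ?mule0//; apply/eqP; rewrite -measure_le0 pz.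
  apply: le_measure; rewrite ?inE// => x /=; exact: lt_le_trans.
set p0 := fine (mu [set x | a < v x]).
have pE : mu [set x | a < v x] = p0%:E by rewrite fineK// fin_num_measure.
have p00 : 0 < p0 by rewrite -lte_fin -pE.
have s0 : 0 < s by exact: lt_le_trans s2.
have p0s : p0 <= s^-1 by rewrite -lee_fin -pE.
have sp : s <= p0^-1 by rewrite -[s]invrK lef_pV2 ?posrE ?invr_gt0.
(* The radius is taken at [1 / p0] rather than at [s]: the tail is then small relative to the actual
   mass of the layer, and [phi (1 / p0) >= phi s] preserves the rate. *)
have [r [r0 tr hr]] := hK _ (le_trans s2 sp).
have p02 : p0 <= 2^-1 by apply: le_trans p0s _; rewrite lef_pV2 ?posrE.
have tail : fine (mu [set x | r <= enorm x]) <= fine (mu [set x | b <= v x]) / 16.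
  apply: le_trans tr _; rewrite invfM invrK; rewrite -/p0 in p1; lra.
apply: le_trans (log_concave_layer vG G0 mG ab lc r0 p00 p02 tail).
rewrite lee_wpmul2r// lee_fin ler_wpM2r ?subr_ge0 ?(ltW ab)// -/p0 -lnV ?posrE//.
have phs : 0 < phi s by apply: (condA1_gt0 hA1); lra.
have pp : phi s `^ beta <= phi p0^-1 `^ beta.
  have h := condA1_le hA1 s0 sp.
  by rewrite ge0_ler_powR ?nnegrE ?(ltW b0) ?(ltW phs)// (le_trans (ltW phs)).
rewrite ler_pdivlMr ?mulr_gt0//.
have -> : (16 * K)^-1 * phi s `^ beta * (16 * r) = K^-1 * (r * phi s `^ beta).
  by field; exact: lt0r_neq0.
rewrite ler_pdivrMl//; apply: le_trans hr.
by rewrite ler_wpM2l// ltW.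
Qed.

End LogConcaveRate.

(** * Choice of the constants under the two hypotheses on the measure *)

Theorem theorem1p1 (R : realType) (phi : R -> R) (x0 A : R)
    (hA1 : condA1 phi) (hA2 : condA2 phi) (hA4 : condA4 phi)
    (hx0 : 0 < x0) (hphix0 : phi x0 = 1) (hA : 0 < A) :
  (* C tau alpha k lambda2 Delta *)
  (exists C : R -> R -> R -> R -> R -> R,
    forall (Delta alpha k : R) (d : nat) (mu : probability (borelRd R d) R),
      0 < Delta -> condA3 Delta phi ->
      1 < alpha -> alpha <= 2 -> 0 < k -> (0 < d)%N ->
      mu `<< @lebesgueRd R d ->
      convex_set (measure_support mu) ->
      (forall t : R, 0 < t -> t <= 2^-1 ->
        ((k * t * phi t^-1 `^ (1 - alpha^-1))%:E
          <= isoperimetric_function mu t)%E) ->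
      (exists lambda2 : R, median_poincare mu lambda2) /\
      forall lambda2 : R, median_poincare mu lambda2 ->
        modified_sobolev mu phi x0 A alpha
          (fun tau => C tau alpha k lambda2 Delta))
  /\
  (forall (Delta alpha c : R) (d : nat) (mu : probability (borelRd R d) R)
      (g : R -> R),
      0 < Delta -> condA3 Delta phi ->
      1 < alpha -> alpha <= 2 -> 0 < c -> (0 < d)%N ->
      log_concave mu ->
      (forall r s : R, 0 <= r -> r < s -> g r < g s) ->
      (\int[mu]_x (expR (g (enorm x)))%:E = 1)%E ->
      (forall r : R, 0 <= r -> 0 < g r ->
        c * r <= g r / (phi (expR (g r)) `^ (1 - alpha^-1))) ->
      exists Cg : R -> R, modified_sobolev mu phi x0 A alpha Cg).
Proof.
have beta0 (alpha : R) : 1 < alpha -> 0 < 1 - alpha^-1.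
  by move=> a1; rewrite subr_gt0 invf_lt1// (lt_trans ltr01).
split.
  (* Validity for all dimensions and measures is part of the property, so the value picked by [get]
     is fixed before [d] and [mu]. *)
  pose good (tau alpha k C : R) := 0 < C /\ forall d (mu : probability (borelRd R d) R),
    layer_rate mu (fun s => k / 4 * phi s `^ (1 - alpha^-1)) ->
    forall f, test_function mu f ->
      (F_functional mu (F_tau phi x0 tau) f <=
        C%:E * cost_energy mu (EFin \o cost A (tau / (1 - alpha^-1))) f)%E.
  exists (fun tau alpha k _ _ => get (good tau alpha k)).
  move=> Delta alpha k d mu _ _ a1 a2 k0 _ _ _ hI.
  have hr := layer_rate_of_isoperimetry hA1 k0 (beta0 _ a1) hI.
  have w2 : 0 < k / 4 * phi 2 `^ (1 - alpha^-1).
    by rewrite mulr_gt0 ?divr_gt0// powR_gt0// (condA1_gt0 hA1)// ltr1n.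
  split; first by exists (2 * (64 / (k / 4 * phi 2 `^ (1 - alpha^-1)) ^+ 2)); exact: (poincare_of_layer_rate hr w2).
  move=> lambda2 _; apply: modified_sobolevI => // tau t1 t2.
  have [] : good tau alpha k (get (good tau alpha k)).
    apply: getPex; have k4 : 0 < k / 4 by exact: divr_gt0.
    have [C C0 hC] := sobolev_of_layer_rate hA1 hx0 hphix0 hA k4 (beta0 _ a1) t1 t2.
    by exists C.
  by move=> C0 hC; split => // f; exact: hC.
move=> Delta alpha c d mu g _ _ a1 a2 c0 _ lc ginc gint ghyp.
have b1 : 1 - alpha^-1 <= 1 by rewrite gerBl invr_ge0 (le_trans ler01 (ltW a1)).
have [kappa k0 hr] := layer_rate_of_log_concave hA1 hA4 c0 (beta0 _ a1) b1 ginc gint ghyp lc.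
(* Here [kappa] comes from a radius attached to this [mu] and [g], so the constant is picked after
   them. *)
pose good (tau C : R) := 0 < C /\ forall f, test_function mu f ->
  (F_functional mu (F_tau phi x0 tau) f <=
    C%:E * cost_energy mu (EFin \o cost A (tau / (1 - alpha^-1))) f)%E.
exists (fun tau => get (good tau)); apply: modified_sobolevI => // tau t1 t2.
apply: (getPex (P := good tau)).
have [C C0 hC] := sobolev_of_layer_rate hA1 hx0 hphix0 hA k0 (beta0 _ a1) t1 t2.
by exists C; split => // f; exact: hC.
Qed.
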